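(* Let $n\geq 3$ and $m\in\mathbb{N}$. If the short exact sequence $$1\to B_m(\mathbb{R}P^2\setminus\{x_1,\dots,x_n\})\to B_{n,m}(\mathbb{R}P^2)\xrightarrow{\bar q} B_n(\mathbb{R}P^2)\to 1$$ splits, then $m\equiv 0 \pmod{n(n-1)}$ or $m\equiv (n-1)^2 \pmod{n(n-1)}$.
   Context: For a surface $\Sigma$, $F_k(\Sigma)$ is the ordered configuration space of $k$ distinct points of $\Sigma$, $B_k(\Sigma)=\pi_1(F_k(\Sigma)/S_k)$, and $B_{n,m}(\Sigma)=\pi_1(F_{n+m}(\Sigma)/(S_n\times S_m))$, i.e. the subgroup of $B_{n+m}(\Sigma)$ of braids whose permutation lies in $S_n\times S_m$. The homomorphism $\bar q:B_{n,m}(\mathbb{R}P^2)\to B_n(\mathbb{R}P^2)$ is induced by the map forgetting the last $m$ points (forgetting the last $m$ strands); its kernel is $B_m(\mathbb{R}P^2\setminus\{x_1,\dots,x_n\})$. ''Splits'' means $\bar q$ admits a homomorphic section. *)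

(* Defs.v *)
From HB Require Import structures.
From mathcomp Require Import all_boot all_order all_algebra all_fingroup.
From mathcomp Require Import all_classical all_reals all_analysis.
From mathcomp Require Import Rstruct Rstruct_topology.
Set Implicit Arguments. Unset Strict Implicit. Unset Printing Implicit Defensive.
Import Order.TTheory GRing.Theory Num.Theory.
Local Open Scope classical_set_scope.
Local Open Scope ring_scope.

Notation RR := Rdefinitions.R.

(* Model of RP^2: the rank-one orthogonal projections of R^3, i.e. the
   symmetric idempotent 3x3 real matrices of trace 1 (the space of lines in
   R^3), with the subspace topology of 'M[R]_3 = R^9. *)
Definition mx3 := 'M[RR]_3.
Definition RP2 : set mx3 :=
  [set P | P^T = P /\ P *m P = P /\ \tr P = 1].

Definition I01 : set RR := [set t | 0 <= t <= 1].

Definition in_conf (k : nat) (x : 'I_k -> mx3) : Prop :=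
  (forall i, RP2 (x i)) /\ injective x.

Definition kpath (k : nat) (g : 'I_k -> RR -> mx3) : Prop :=
  (forall i, {within I01, continuous (g i)}) /\
  (forall t, I01 t -> in_conf (fun i => g i t)).

(* A braid based at b: a path in F_k from b to b o sigma.  Its image in the
   unordered configuration space F_k/S_k is a loop based at [b], and every
   such loop lifts uniquely to such a path: these represent B_k(RP^2). *)
Definition braid (k : nat) (b : 'I_k -> mx3) (g : 'I_k -> RR -> mx3)
    (sigma : {perm 'I_k}) : Prop :=
  kpath g /\ (forall i, g i 0 = b i) /\ (forall i, g i 1 = b (sigma i)).

Definition homotopic (k : nat) (g h : 'I_k -> RR -> mx3) : Prop :=
  exists H : 'I_k -> RR -> RR -> mx3,
    (forall i, {within I01 `*` I01, continuous (fun p : RR * RR => H i p.1 p.2)}) /\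
    (forall s t, I01 s -> I01 t -> in_conf (fun i => H i s t)) /\
    (forall i t, I01 t -> H i 0 t = g i t /\ H i 1 t = h i t) /\
    (forall i s, I01 s -> H i s 0 = g i 0 /\ H i s 1 = g i 1).

(* Product of braids: first g (with permutation sigma), then h, where strand i
   of g continues along strand sigma i of h.  The product braid has
   permutation (sigma * tau) (mathcomp convention: (sigma*tau) x = tau (sigma x)). *)
Definition bmul (k : nat) (g : 'I_k -> RR -> mx3) (sigma : {perm 'I_k})
    (h : 'I_k -> RR -> mx3) : 'I_k -> RR -> mx3 :=
  fun i t => if t <= 2^-1 then g i (2 * t) else h (sigma i) (2 * t - 1).

Definition forget (n m : nat) (g : 'I_(n + m) -> RR -> mx3) : 'I_n -> RR -> mx3 :=
  fun i => g (lshift m i).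

Definition mixed_perm (n m : nat) (sigma : {perm 'I_(n + m)}) : Prop :=
  forall i : 'I_n, (sigma (lshift m i) < n)%N.

(* qbar : B_{n,m}(RP^2) -> B_n(RP^2) (basepoint bc, resp. its first n points)
   admits a homomorphic section.  The section is given on representatives
   (braids with their permutations); it must respect homotopy, be
   multiplicative up to homotopy, land in B_{n,m}, and be a right inverse of
   qbar up to homotopy. *)
Definition qbar_splits (n m : nat) (bc : 'I_(n + m) -> mx3) : Prop :=
  let b := fun i : 'I_n => bc (lshift m i) in
  exists s : ('I_n -> RR -> mx3) -> {perm 'I_n} ->
             ('I_(n + m) -> RR -> mx3) * {perm 'I_(n + m)},
    (forall g sigma, braid b g sigma ->
       braid bc (s g sigma).1 (s g sigma).2 /\ mixed_perm (s g sigma).2) /\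
    (forall g sigma h tau, braid b g sigma -> braid b h tau ->
       homotopic g h -> homotopic (s g sigma).1 (s h tau).1) /\
    (forall g sigma h tau, braid b g sigma -> braid b h tau ->
       homotopic (s (bmul g sigma h) (sigma * tau)%g).1
                 (bmul (s g sigma).1 (s g sigma).2 (s h tau).1)) /\
    (forall g sigma, braid b g sigma -> homotopic (forget (s g sigma).1) g).

(* Main.v *)
Require Import Defs.
From HB Require Import structures.
From mathcomp Require Import all_boot all_order all_algebra all_fingroup.
From mathcomp Require Import all_classical all_reals all_analysis.
From mathcomp Require Import Rstruct Rstruct_topology.
From mathcomp Require Import complex ring lra zify.
Set Implicit Arguments. Unset Strict Implicit. Unset Printing Implicit Defensive.
Import Order.TTheory GRing.Theory Num.Theory.
Import numFieldNormedType.Exports.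
Local Open Scope classical_set_scope.
Local Open Scope ring_scope.

(* Homeomorphisms of RP^2 move the base points anywhere, so take q of them (q = n, or q = n - 1
   with one more at the pole) to be equally spaced lines of the equator. Rotating R^3 by pi/q gives
   a braid; let G be its image under the section and tau the permutation of G. Rotating by 4 pi is
   null-homotopic, so G^(4q) is trivial.
   Suppose tau^l fixes two strands off the equator. By isotopy extension one may represent G^l by
   a braid whose base strands rotate rigidly; in the rotating frame the two strands of G^(2l) become
   paths of lines (y1, y2), with y1 avoiding the base lines. Lift y2 to the sphere, and y1 to the
   3-sphere of spinors through the Hopf map, its phase being pinned down up to a q-th root of unity
   by the condition u2^q - u1^q > 0. After one turn by a = 2 pi l / q the lift comes back up to this
   rotation and a root of unity k. Two nowhere vanishing functions of the lift, T and F, get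
   multiplied by k^2 e^(i a) and, once this is 1, by k. Since a power of G^(2l) is homotopic to the
   constant braid, the argument of such a function cannot drift, so both factors are 1 and q | l.
   With q = n - 1 and the pole as one of the two strands, every cycle of tau on the last m strands has
   length divisible by n - 1. With q = n, at most one of them is fixed and all other cycles have
   length divisible by n. The Chinese remainder theorem combines m = 0 mod n - 1 with
   m = 0 or 1 mod n. *)

(** * Continuity of real and matrix valued functions *)

(** The obstacle is that a section yields homotopy classes only. The base strands of the image of a
    rotation need not rotate, and they move during any homotopy between two representatives. Isotopy
    extension therefore serves twice: to make the base strands rotate exactly, and to compare lifts
    along homotopic braids in two rotating frames. That comparison leaves a loop of injections of
    RP^2 fixing the base lines; it acts trivially on lifts because the two points can be deformed to
    base lines, where nothing moves. The exponents have separate origins. Doubling l removes an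
    antipodal sign and makes the frame angle a multiple of 2 pi / q, so that its phase is a q-th
    root of unity. The angle 4 pi instead of 2 pi reflects that pi_1(SO(3)) has order 2. The zeros
    of u2^q - u1^q lie over equatorial vectors that span base lines; since y1 avoids these lines,
    the argument of u2^q - u1^q can be absorbed into the phase of u. *)

Definition cts (T : topologicalType) (f : T -> RR) : Prop := continuous f.
Definition mcts (T : topologicalType) m n (f : T -> 'M[RR]_(m, n)) : Prop :=
  forall i j, cts (fun t => f t i j).

Local Notation cts2 f := (cts (fun p : RR * RR => f p.1 p.2)).
Local Notation mcts2 f := (mcts (fun p : RR * RR => f p.1 p.2)).

Section Cts.
Variable T : topologicalType.
Implicit Types f g : T -> RR.

Lemma cts_cst (a : RR) : cts (fun _ : T => a).
Proof. by move=> t; exact: cvg_cst. Qed.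

Lemma ctsD f g : cts f -> cts g -> cts (fun t => f t + g t).
Proof. by move=> cf cg t; exact: (@continuousD RR RR^o T f g t (cf t) (cg t)). Qed.

Lemma ctsN f : cts f -> cts (fun t => - f t).
Proof. by move=> cf t; exact: (@continuousN RR RR^o T f t (cf t)). Qed.

Lemma ctsB f g : cts f -> cts g -> cts (fun t => f t - g t).
Proof. by move=> cf cg; apply: ctsD => //; exact: ctsN. Qed.

Lemma ctsM f g : cts f -> cts g -> cts (fun t => f t * g t).
Proof. by move=> cf cg t; exact: (@continuousM RR T f g t (cf t) (cg t)). Qed.

Lemma ctsX f n : cts f -> cts (fun t => f t ^+ n).
Proof.
move=> cf; elim: n => [|n IH]; first exact: cts_cst.
have -> : (fun t => f t ^+ n.+1) = (fun t => f t * f t ^+ n).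
  by apply/funext => t; rewrite exprS.
exact: ctsM.
Qed.

Lemma ctsV f : cts f -> (forall t, f t != 0) -> cts (fun t => (f t)^-1).
Proof. by move=> cf f0 t; exact: (@continuousV RR T f t (f0 t) (cf t)). Qed.

Lemma cts_comp (h : RR -> RR) f : continuous h -> cts f -> cts (fun t => h (f t)).
Proof. by move=> ch cf t; apply: continuous_comp; [exact: cf|exact: ch]. Qed.

Lemma cts_norm f : cts f -> cts (fun t => `|f t|).
Proof. by apply: cts_comp => x; exact: (@norm_continuous RR RR^o). Qed.

Lemma cts_sqrt f : cts f -> cts (fun t => Num.sqrt (f t)).
Proof. by apply: cts_comp; exact: sqrt_continuous. Qed.

Lemma cts_cos f : cts f -> cts (fun t => cos (f t)).
Proof. by apply: cts_comp; exact: continuous_cos. Qed.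

Lemma cts_sin f : cts f -> cts (fun t => sin (f t)).
Proof. by apply: cts_comp; exact: continuous_sin. Qed.

Lemma cts_atan f : cts f -> cts (fun t => atan (f t)).
Proof. by apply: cts_comp => x; exact: continuous_atan. Qed.

Lemma cts_max f g : cts f -> cts g -> cts (fun t => Num.max (f t) (g t)).
Proof.
move=> cf cg.
have -> : (fun t => Num.max (f t) (g t)) =
          (fun t => 2^-1 * (f t + g t + `|f t - g t|)).
  by apply/funext => t; have [h|h] := leP (f t) (g t);
    [rewrite ler0_norm; lra|rewrite gtr0_norm; lra].
apply: ctsM; first exact: cts_cst.
by apply: ctsD; [exact: ctsD|apply: cts_norm; exact: ctsB].
Qed.

Lemma cts_min f g : cts f -> cts g -> cts (fun t => Num.min (f t) (g t)).
Proof.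
move=> cf cg.
have -> : (fun t => Num.min (f t) (g t)) = (fun t => - Num.max (- f t) (- g t)).
  by apply/funext => t; rewrite -oppr_min !opprK.
by apply: ctsN; apply: cts_max; exact: ctsN.
Qed.

Lemma cts_sum (I : Type) (r : seq I) (P : pred I) (F : I -> T -> RR) :
  (forall i, cts (F i)) -> cts (fun t => \sum_(i <- r | P i) F i t).
Proof.
move=> cF; elim: r => [|i r IH].
  by under eq_fun do rewrite big_nil; exact: cts_cst.
under eq_fun do rewrite big_cons.
by case: (P i) => //; apply: ctsD.
Qed.

Lemma cts_precomp (U : topologicalType) (g : U -> T) f :
  continuous g -> cts f -> cts (fun t => f (g t)).
Proof. by move=> cg cf t; apply: continuous_comp; [exact: cg|exact: cf]. Qed.

Lemma mcts_precomp (U : topologicalType) (g : U -> T) m n (f : T -> 'M[RR]_(m, n)) :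
  continuous g -> mcts f -> mcts (fun t => f (g t)).
Proof. by move=> cg cf i j; apply: (cts_precomp cg (cf i j)). Qed.

Lemma mcts_cst m n (M : 'M[RR]_(m, n)) : mcts (fun _ : T => M).
Proof. by move=> i j; exact: cts_cst. Qed.

Lemma mctsD m n (f g : T -> 'M[RR]_(m, n)) :
  mcts f -> mcts g -> mcts (fun t => f t + g t).
Proof.
by move=> cf cg i j; under eq_fun do rewrite mxE; apply: ctsD; [exact: cf|exact: cg].
Qed.

Lemma mctsB m n (f g : T -> 'M[RR]_(m, n)) :
  mcts f -> mcts g -> mcts (fun t => f t - g t).
Proof.
move=> cf cg i j; under eq_fun do rewrite !mxE.
by apply: ctsB; [exact: cf|exact: cg].
Qed.

Lemma mctsZ m n (a : T -> RR) (f : T -> 'M[RR]_(m, n)) :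
  cts a -> mcts f -> mcts (fun t => a t *: f t).
Proof.
by move=> ca cf i j; under eq_fun do rewrite mxE; apply: ctsM => //; exact: cf.
Qed.

Lemma mctsM m n p (f : T -> 'M[RR]_(m, n)) (g : T -> 'M[RR]_(n, p)) :
  mcts f -> mcts g -> mcts (fun t => f t *m g t).
Proof.
move=> cf cg i j; under eq_fun do rewrite mxE.
by apply: cts_sum => k; apply: ctsM; [exact: cf|exact: cg].
Qed.

Lemma mcts_tr m n (f : T -> 'M[RR]_(m, n)) : mcts f -> mcts (fun t => (f t)^T).
Proof. by move=> cf i j; under eq_fun do rewrite mxE; exact: cf. Qed.

Lemma mcts_sum m n (I : Type) (r : seq I) (P : pred I) (F : I -> T -> 'M[RR]_(m, n)) :
  (forall i, mcts (F i)) -> mcts (fun t => \sum_(i <- r | P i) F i t).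
Proof.
move=> cF i j; under eq_fun do rewrite summxE.
by apply: cts_sum => k; exact: cF.
Qed.

Lemma cts_trace n (f : T -> 'M[RR]_n) : mcts f -> cts (fun t => \tr (f t)).
Proof. by move=> cf; apply: cts_sum => k; exact: cf. Qed.

(** The passage between entrywise continuity, which reduces to real arithmetic, and the matrix
    topology in which braids and homotopies are given. *)
Lemma mctsP m n (f : T -> 'M[RR]_(m, n)) : mcts f <-> continuous f.
Proof.
split=> [cf t A [B nB sBA]|cf i j t A nA].
  rewrite /nbhs /=.
  have : \forall x \near t, forall ij : 'I_m * 'I_n, B ij.1 ij.2 (f x ij.1 ij.2).
    by apply: filter_forall => -[i j]; apply: (cf i j t); exact: nB.
  by apply: filterS => x Hx; apply: sBA => i j; exact: (Hx (i, j)).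
apply: (cf t [set M | A (M i j)]).
exists (fun i' j' => if (i' == i) && (j' == j) then A else setT).
  move=> i' j'; case: ifP => [/andP[/eqP -> /eqP ->] //|_]; exact: filterT.
by move=> M /(_ i j) /=; rewrite !eqxx.
Qed.

End Cts.

Lemma cts_id : cts (fun t : RR => t). Proof. by move=> t. Qed.

Lemma cts_fst (U V : topologicalType) (f : U -> RR) : cts f -> cts (fun p : U * V => f p.1).
Proof. by move=> cf; apply: cts_precomp cf => p; exact: cvg_fst. Qed.
Lemma cts_snd (U V : topologicalType) (f : V -> RR) : cts f -> cts (fun p : U * V => f p.2).
Proof. by move=> cf; apply: cts_precomp cf => p; exact: cvg_snd. Qed.

Lemma pair_cts (T U V : topologicalType) (f : T -> U) (g : T -> V) :
  continuous f -> continuous g -> continuous (fun t => (f t, g t)).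
Proof. by move=> cf cg t; exact: (cvg_pair (cf t) (cg t)). Qed.

Lemma cts_comp2 (T : topologicalType) (F : RR -> RR -> RR) (f g : T -> RR) :
  cts2 F -> cts f -> cts g -> cts (fun t => F (f t) (g t)).
Proof.
move=> cF cf cg.
exact: (cts_precomp (f := fun p : RR * RR => F p.1 p.2) (pair_cts cf cg) cF).
Qed.

Lemma mcts_comp1 (T : topologicalType) m n (F : RR -> 'M[RR]_(m, n)) (f : T -> RR) :
  mcts F -> cts f -> mcts (fun t => F (f t)).
Proof. by move=> cF cf; exact: (mcts_precomp cf cF). Qed.

Lemma mcts_comp2 (T : topologicalType) m n (F : RR -> RR -> 'M[RR]_(m, n)) (f g : T -> RR) :
  mcts2 F -> cts f -> cts g -> mcts (fun t => F (f t) (g t)).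
Proof.
by move=> cF cf cg i j; apply: (cts_comp2 (F := fun x y => F x y i j)) => //; exact: cF.
Qed.

(** Clamping to [0, 1]. Paths and homotopies are precomposed with [cl], which turns continuity
    within [I01] into continuity on the whole line; the many later equations f (cl t) = f t record
    this normalisation. *)
Definition cl (t : RR) : RR := Num.min (Num.max t 0) 1.

Lemma cl_I t : 0 <= cl t <= 1.
Proof. by rewrite /cl ge_min lexx orbT andbT le_min ler01 andbT le_max lexx orbT. Qed.

Lemma cl_id t : 0 <= t <= 1 -> cl t = t.
Proof. by case/andP=> h0 h1; rewrite /cl max_l // min_l. Qed.

Lemma clK t : cl (cl t) = cl t. Proof. exact/cl_id/cl_I. Qed.
Lemma cl0 : cl 0 = 0. Proof. by rewrite cl_id // lexx ler01. Qed.
Lemma cl1 : cl 1 = 1. Proof. by rewrite cl_id // lexx ler01. Qed.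

Lemma cts_cl (T : topologicalType) (f : T -> RR) : cts f -> cts (fun t => cl (f t)).
Proof.
by move=> cf; apply: cts_min; [apply: cts_max => //|]; exact: cts_cst.
Qed.

(* By compactness of the unit cube. *)
Lemma cube_uniform (D : RR -> RR -> RR -> RR -> RR) (e : RR) :
  cts (fun p : (RR * RR) * (RR * RR) => D p.1.1 p.1.2 p.2.1 p.2.2) ->
  (forall r s t, D r r s t = 0) -> 0 < e ->
  exists N : nat, forall r r' s t, I01 r -> I01 r' -> I01 s -> I01 t ->
    `|r - r'| <= N.+1%:R^-1 -> D r r' s t < e.
Proof.
move=> cD D0 e0.
have cI : compact I01.
  have -> : I01 = `[0, 1]%classic by apply/seteqP; split=> x /=; rewrite in_itv.
  exact: segment_compact.
have cK : compact (I01 `*` (I01 `*` I01)) by do 2 apply: compact_setX => //.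
move/compact_near_coveringP in cK.
pose P (N : nat) (x : RR * (RR * RR)) := forall r', `|x.1 - r'| <= N.+1%:R^-1 ->
  D x.1 r' x.2.1 x.2.2 < e.
have [] := cK nat (@eventually) P _.

  move=> [r [s t]] _.
  have : \forall p \near ((r, r), (s, t)), D p.1.1 p.1.2 p.2.1 p.2.2 < e.
    apply: (cD ((r, r), (s, t)) [set y | y < e]); rewrite /= D0.
    apply/nbhs_ballP; exists e => //= y; rewrite /ball /= sub0r normrN.
    exact: le_lt_trans (ler_norm _).
  case=> -[A B] [/= [[A1 A2] /= [nA1 nA2] sA] nB] sAB.
  move: nA2 => /nbhs_ballP [d /= d0 dA2].
  have nA1' : nbhs r (A1 `&` ball r (d / 2)).
    by apply: filterI => //; apply: nbhsx_ballx; lra.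
  exists ((A1 `&` ball r (d / 2)) `*` B, [set N : nat | N.+1%:R^-1 < d / 2]) => /=.
    split=> /=; first by exists ((A1 `&` ball r (d / 2)), B).
    by apply: near_infty_natSinv_lt (PosNum (_ : 0 < d / 2)); lra.
  move=> [[r1 [s1 t1]] N] /= [[[Ar1 br1] Bst]] /= hN r' /= hr'.
  apply: (sAB ((r1, r'), (s1, t1))); split => //=; apply: (sA (r1, r')); split => //=.
  apply: dA2; rewrite /ball /=; move: br1; rewrite /ball /= => br1.
  have -> : r - r' = (r - r1) + (r1 - r') by ring.
  rewrite (le_lt_trans (ler_normD _ _)) // [ltRHS]splitr ltr_leD //.
  exact: le_trans hr' (ltW hN).
move=> N _ HN; exists N => r r' s t Ir Ir' Is It h.
have := HN N => /=; rewrite leqnn => /(_ erefl (r, (s, t))) /=.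
by apply.
Qed.

Notation vec := 'cV[RR]_3.

(** * Lines in R^3 *)

Definition dotv n (v w : 'cV[RR]_n) : RR := \sum_i v i 0 * w i 0.

Section Dot.
Variable n : nat.
Implicit Types v w : 'cV[RR]_n.

Lemma dotvC v w : dotv v w = dotv w v.
Proof. by apply: eq_bigr => i _; rewrite mulrC. Qed.
Lemma dotvDl v v' w : dotv (v + v') w = dotv v w + dotv v' w.
Proof. by rewrite -big_split; apply: eq_bigr => i _; rewrite mxE mulrDl. Qed.
Lemma dotvZl a v w : dotv (a *: v) w = a * dotv v w.
Proof. by rewrite mulr_sumr; apply: eq_bigr => i _; rewrite mxE mulrA. Qed.
Lemma dotvDr v w w' : dotv v (w + w') = dotv v w + dotv v w'.
Proof. by rewrite !(dotvC v) dotvDl. Qed.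
Lemma dotvZr a v w : dotv v (a *: w) = a * dotv v w.
Proof. by rewrite !(dotvC v) dotvZl. Qed.
Lemma dotvNl v w : dotv (- v) w = - dotv v w.
Proof. by rewrite -scaleN1r dotvZl mulN1r. Qed.
Lemma dotvNr v w : dotv v (- w) = - dotv v w.
Proof. by rewrite -scaleN1r dotvZr mulN1r. Qed.
Lemma dotv_ge0 v : 0 <= dotv v v.
Proof. by apply: sumr_ge0 => i _; rewrite -expr2 sqr_ge0. Qed.
Lemma dotv_eq0 v : dotv v v = 0 -> v = 0.
Proof.
move=> h; apply/matrixP => i j; rewrite ord1 mxE.
have /psumr_eq0P : \sum_i v i 0 * v i 0 = 0 by [].
by move=> /(_ _)/(_ i) h'; apply/eqP; rewrite -sqrf_eq0 expr2 h' // => k _; rewrite -expr2 sqr_ge0.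
Qed.
Lemma dotvE v w : v^T *m w = (dotv v w)%:M.
Proof.
by apply/matrixP => i j; rewrite !ord1 !mxE eqxx mulr1n; apply: eq_bigr => k _; rewrite mxE.
Qed.
Lemma dotv_mull (A : 'M[RR]_n) v w : dotv (A *m v) w = dotv v (A^T *m w).
Proof.
have h : (dotv (A *m v) w)%:M = (dotv v (A^T *m w))%:M :> 'M[RR]_1.
  by rewrite -!dotvE trmx_mul mulmxA.
by have := congr1 (fun M : 'M[RR]_1 => M 0 0) h; rewrite !mxE eqxx !mulr1n.
Qed.
Lemma mxtrace_lin v w : \tr (v *m w^T) = dotv w v.
Proof. by rewrite mxtrace_mulC dotvE mxtrace_scalar mulr1n. Qed.
Lemma lin_mul v w u : v *m w^T *m u = dotv w u *: v.
Proof. by rewrite -mulmxA dotvE mul_mx_scalar. Qed.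
End Dot.

(** The entrywise l1 norm: submultiplicative also for rectangular matrices ([n1M]), and, as an
    explicit finite sum, continuous for [mcts]. *)
Definition n1 m n (M : 'M[RR]_(m, n)) : RR := \sum_i \sum_j `|M i j|.

Section N1.
Lemma n1_ge0 m n (M : 'M[RR]_(m, n)) : 0 <= n1 M.
Proof. by do 2 apply: sumr_ge0 => ? _. Qed.
Lemma n1D m n (M N : 'M[RR]_(m, n)) : n1 (M + N) <= n1 M + n1 N.
Proof.
rewrite -big_split; apply: ler_sum => i _; rewrite -big_split.
by apply: ler_sum => j _; rewrite mxE ler_normD.
Qed.
Lemma n1N m n (M : 'M[RR]_(m, n)) : n1 (- M) = n1 M.
Proof. by apply: eq_bigr => i _; apply: eq_bigr => j _; rewrite mxE normrN. Qed.
Lemma n1Z m n (a : RR) (M : 'M[RR]_(m, n)) : n1 (a *: M) = `|a| * n1 M.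
Proof.
rewrite mulr_sumr; apply: eq_bigr => i _; rewrite mulr_sumr.
by apply: eq_bigr => j _; rewrite mxE normrM.
Qed.
Lemma n10 m n : n1 (0 : 'M[RR]_(m, n)) = 0.
Proof. by rewrite -(scale0r 0) n1Z normr0 mul0r. Qed.
Lemma le_n1 m n (M : 'M[RR]_(m, n)) i j : `|M i j| <= n1 M.
Proof.
rewrite /n1 (bigD1 i) //= (bigD1 j) //= -addrA lerDl addr_ge0 //.
  by apply: sumr_ge0.
by do 2 apply: sumr_ge0 => ? _.
Qed.
Lemma n1_eq0 m n (M : 'M[RR]_(m, n)) : n1 M <= 0 -> M = 0.
Proof.
move=> h; apply/matrixP => i j; rewrite mxE; apply/eqP; rewrite -normr_eq0.
by rewrite eq_le normr_ge0 andbT (le_trans (le_n1 M i j)).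
Qed.
Lemma n1M m n p (A : 'M[RR]_(m, n)) (B : 'M[RR]_(n, p)) : n1 (A *m B) <= n1 A * n1 B.
Proof.
apply: (@le_trans _ _ (\sum_i \sum_k \sum_j `|A i j| * `|B j k|)).
  apply: ler_sum => i _; apply: ler_sum => k _; rewrite mxE.
  by apply: le_trans (ler_norm_sum _ _ _) _; apply: ler_sum => j _; rewrite normrM.
rewrite mulr_suml; apply: ler_sum => i _; rewrite exchange_big /= mulr_suml.
apply: ler_sum => j _; rewrite -mulr_sumr ler_wpM2l //.
by rewrite [leRHS](bigD1 j) //= lerDl; do 2 apply: sumr_ge0 => ? _.
Qed.
Lemma n1_sum m n (I : Type) (r : seq I) (P : pred I) (F : I -> 'M[RR]_(m, n)) :
  n1 (\sum_(i <- r | P i) F i) <= \sum_(i <- r | P i) n1 (F i).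
Proof.
elim/big_rec2: _ => [|i x y _ h]; first by rewrite n10.
by apply: le_trans (n1D _ _) _; rewrite lerD2l.
Qed.
Lemma n1_tr m n (A : 'M[RR]_(m, n)) : n1 A^T = n1 A.
Proof.
by rewrite /n1 exchange_big; apply: eq_bigr => i _; apply: eq_bigr => j _; rewrite mxE.
Qed.
Lemma n1BC m n (A B : 'M[RR]_(m, n)) : n1 (A - B) = n1 (B - A).
Proof. by rewrite -n1N opprB. Qed.
End N1.

Lemma cts_n1 (T : topologicalType) m n (f : T -> 'M[RR]_(m, n)) : mcts f -> cts (fun t => n1 (f t)).
Proof.
by move=> cf; apply: cts_sum => i; apply: cts_sum => j; apply: cts_norm; exact: cf.
Qed.

Lemma cts_dotv (T : topologicalType) n (f g : T -> 'cV[RR]_n) :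
  mcts f -> mcts g -> cts (fun t => dotv (f t) (g t)).
Proof. by move=> cf cg; apply: cts_sum => i; apply: ctsM; [exact: cf|exact: cg]. Qed.

Definition lin (v : vec) : mx3 := v *m v^T.

Lemma lin_tr v : (lin v)^T = lin v.
Proof. by rewrite /lin trmx_mul trmxK. Qed.

Lemma linN v : lin (- v) = lin v.
Proof. by rewrite /lin linearN mulNmx mulmxN opprK. Qed.

Lemma linZ a v : lin (a *: v) = a ^+ 2 *: lin v.
Proof. by rewrite /lin linearZ -scalemxAl -scalemxAr scalerA expr2. Qed.

Lemma lin_act (M : mx3) v : M *m lin v *m M^T = lin (M *m v).
Proof. by rewrite /lin trmx_mul !mulmxA. Qed.

Lemma tr_lin v : \tr (lin v) = dotv v v.
Proof. exact: mxtrace_lin. Qed.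

Lemma mcts_lin (T : topologicalType) (f : T -> vec) : mcts f -> mcts (fun t => lin (f t)).
Proof. by move=> cf; apply: mctsM => //; exact: mcts_tr. Qed.

Lemma RP2_lin v : dotv v v = 1 -> RP2 (lin v).
Proof.
by move=> h; split; [exact: lin_tr|split; [|by rewrite tr_lin]];
  rewrite {1}/lin -!mulmxA (mulmxA v^T) dotvE h mul1mx.
Qed.

(* By Cauchy-Schwarz for the columns of P, the principal 2x2 minors are nonnegative;
   their sum vanishes because tr P = tr (P^2) = 1. *)
Lemma RP2P (P : mx3) : RP2 P -> exists2 v, dotv v v = 1 & P = lin v.
Proof.
move=> [PT [PP P1]].
have sym i j : P i j = P j i by rewrite -[in LHS]PT mxE.
have gram i j : P i j = \sum_k P k i * P k j.
  by rewrite -[in LHS]PP mxE; apply: eq_bigr => k _; rewrite sym.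
have cs i j c : \sum_k (P k i - c * P k j) ^+ 2 = P i i - c * P i j *+ 2 + c ^+ 2 * P j j.
  rewrite (gram i i) (gram i j) (gram j j) !mulr_sumr -sumrMnl -sumrB -big_split /=.
  by apply: eq_bigr => k _; ring.
have d0 i : 0 <= P i i by rewrite gram; apply: sumr_ge0 => k _; rewrite -expr2 sqr_ge0.
have [j jp] : exists j, 0 < P j j.
  case: (pickP (fun j => 0 < P j j)) => [j h|h]; first by exists j.
  move: P1; rewrite /mxtrace big1 => [/esym /eqP|i _]; first by rewrite oner_eq0.
  by apply/eqP; rewrite eq_le d0 leNgt h.
have minor i k : P i k ^+ 2 <= P i i * P k k.
  have [k0|k0] := eqVneq (P k k) 0.
    have: 0 <= P k k ^+ 2 * P i i by rewrite mulr_ge0 ?sqr_ge0.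
    have -> : P i k = 0.
      have: \sum_l P l k ^+ 2 = 0.
        by rewrite -[RHS]k0 [RHS]gram; apply: eq_bigr => l _; rewrite expr2.
      move/psumr_eq0P => /(_ _)/(_ i) h; apply/eqP; rewrite -sqrf_eq0 h // => l _.
      exact: sqr_ge0.
    by rewrite k0 expr0n mulr0.
  have := cs i k (P i k / P k k).
  have : 0 <= \sum_l (P l i - P i k / P k k * P l k) ^+ 2.
    by apply: sumr_ge0 => l _; exact: sqr_ge0.
  move=> h1 h2; rewrite h2 in h1.
  have kp : 0 < P k k by rewrite lt_def k0 d0.
  have : 0 <= (P i i - P i k / P k k * P i k *+ 2 + (P i k / P k k) ^+ 2 * P k k) * P k k.
    by rewrite mulr_ge0 // ltW.
  suff -> : (P i i - P i k / P k k * P i k *+ 2 + (P i k / P k k) ^+ 2 * P k k) * P k k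
     = P i i * P k k - P i k ^+ 2 by rewrite subr_ge0.
  by field; rewrite gt_eqF.
have minor0 i : P i j ^+ 2 = P i i * P j j.
  have h : \sum_i \sum_k (P i i * P k k - P i k ^+ 2) = 0.
    under eq_bigr do rewrite sumrB -mulr_sumr.
    rewrite sumrB -mulr_suml -/(mxtrace P) P1 mulr1.
    rewrite -[X in X - _]P1 /mxtrace -sumrB big1 // => k _.
    rewrite gram; apply/eqP; rewrite subr_eq0; apply/eqP; apply: eq_bigr => l _.
    by rewrite (sym k l) expr2.
  have /psumr_eq0P := h => /(_ _)/(_ i) h1.
  have /psumr_eq0P : \sum_k (P i i * P k k - P i k ^+ 2) = 0.
    by apply: h1 => // k _; apply: sumr_ge0 => l _; rewrite subr_ge0.
  move=> /(_ _)/(_ j) h2.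
  by apply/eqP; rewrite eq_sym -subr_eq0 h2 // => l _; rewrite subr_ge0.
have col k i : P k i = P i j / P j j * P k j.
  have := cs i j (P i j / P j j).
  have -> : P i i - P i j / P j j * P i j *+ 2 + (P i j / P j j) ^+ 2 * P j j = 0.
    have -> : P i i = P i j ^+ 2 / P j j by rewrite minor0 mulfK // gt_eqF.
    by field; rewrite gt_eqF.
  move=> /psumr_eq0P => /(_ _)/(_ k) h; apply/eqP; rewrite -subr_eq0 -sqrf_eq0 h // => l _.
  exact: sqr_ge0.
have sq : Num.sqrt (P j j) ^+ 2 = P j j by rewrite sqr_sqrtr // ltW.
have s0 : Num.sqrt (P j j) != 0 by rewrite gt_eqF // sqrtr_gt0.
pose v : vec := \col_i (P i j / Num.sqrt (P j j)).
have Pv : P = lin v.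
  apply/matrixP => k i; rewrite !mxE big_ord1 !mxE (col k i) -[in LHS]sq; field.
  exact: s0.
by exists v => //; rewrite -tr_lin -Pv.
Qed.

Lemma lin_inj v w : dotv v v = 1 -> lin v = lin w -> exists2 e : RR, v = e *: w & e ^+ 2 * dotv w w = 1.
Proof.
move=> v1 e; have ev : v = dotv w v *: w.
  by rewrite -lin_mul -/(lin w) -e /lin lin_mul v1 scale1r.
exists (dotv w v) => //; move: (dotv w v) ev v1 => c ->.
by rewrite dotvZl dotvZr mulrA -expr2.
Qed.

Definition pl (v : vec) : mx3 := (dotv v v)^-1 *: lin v.
(** The projective action of M on lines ([act_lin]), written without choosing a vector: conjugation
    gives a rank-one symmetric matrix and dividing by its trace makes it a projection. *)
Definition act (M P : mx3) : mx3 := (\tr (M *m P *m M^T))^-1 *: (M *m P *m M^T).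

Lemma act_lin M v : act M (lin v) = pl (M *m v).
Proof. by rewrite /act lin_act tr_lin. Qed.

Lemma dotv_gt0 n (v : 'cV[RR]_n) : v != 0 -> 0 < dotv v v.
Proof.
move=> v0; rewrite lt_def dotv_ge0 andbT; apply: contra v0 => /eqP h.
by rewrite (dotv_eq0 h).
Qed.

Lemma pl_unit v : dotv v v = 1 -> pl v = lin v.
Proof. by rewrite /pl => ->; rewrite invr1 scale1r. Qed.

Lemma plZ a v : a != 0 -> pl (a *: v) = pl v.
Proof.
move=> a0; rewrite /pl linZ dotvZl dotvZr scalerA; congr (_ *: _).
have [->|v0] := eqVneq (dotv v v) 0; first by rewrite !mulr0 invr0 mul0r.
by field; rewrite v0 a0.
Qed.

Lemma normalize (v : vec) : v != 0 -> exists2 a : RR, a > 0 & dotv (a *: v) (a *: v) = 1.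
Proof.
move=> v0; have dp := dotv_gt0 v0; exists (Num.sqrt (dotv v v))^-1.
  by rewrite invr_gt0 sqrtr_gt0.
rewrite dotvZl dotvZr mulrA -expr2 exprVn sqr_sqrtr ?ltW // mulVf // gt_eqF //.
Qed.

Lemma pl_lin v : v != 0 -> exists2 a : RR, a > 0 & dotv (a *: v) (a *: v) = 1 /\ pl v = lin (a *: v).
Proof.
move=> v0; have [a a0 a1] := normalize v0; exists a => //; split=> //.
by rewrite -pl_unit // plZ // gt_eqF.
Qed.

Lemma RP2_pl v : v != 0 -> RP2 (pl v).
Proof. by move=> /pl_lin [a _ [a1 ->]]; exact: RP2_lin. Qed.

Lemma pl_inj v w : v != 0 -> w != 0 -> pl v = pl w -> exists2 c : RR, c != 0 & v = c *: w.
Proof.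
move=> v0 w0; have [a a0 [a1 ->]] := pl_lin v0; have [b b0 [b1 ->]] := pl_lin w0.
move=> h; have [c e c2] := lin_inj a1 h; exists (a^-1 * c * b); last first.
  by rewrite -!scalerA -e scalerA mulVf ?scale1r // gt_eqF.
have c0 : c != 0.
  by apply/eqP => c0; move: c2; rewrite c0 expr0n mul0r => /eqP; rewrite eq_sym oner_eq0.
by rewrite !mulf_neq0 // ?invr_eq0 gt_eqF.
Qed.

Lemma unit_neq0 n (v : 'cV[RR]_n) : dotv v v = 1 -> v != 0.
Proof.
move=> h; apply/eqP => v0; move: h; rewrite v0 -(scale0r 0) dotvZl mul0r => /eqP.
by rewrite eq_sym oner_eq0.
Qed.

Lemma dotv_n1 n (v : 'cV[RR]_n) : dotv v v <= n1 v ^+ 2.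
Proof.
have e : n1 v = \sum_i `|v i 0| by apply: eq_bigr => i _; rewrite big_ord1.
rewrite e expr2 mulr_suml; apply: ler_sum => i _.
rewrite -[leLHS]ger0_norm -?expr2 ?sqr_ge0 // normrX expr2 ler_wpM2l //.
by rewrite (bigD1 i) //= lerDl sumr_ge0.
Qed.

Lemma n1_dotv (v : vec) a : 0 <= a -> dotv v v <= a ^+ 2 -> n1 v <= 3 * a.
Proof.
move=> a0 h; have e : n1 v = \sum_i `|v i 0| by apply: eq_bigr => i _; rewrite big_ord1.
have -> : 3 * a = \sum_(i < 3) a by rewrite sumr_const card_ord -[RHS]mulr_natl.
rewrite e; apply: ler_sum => i _.
rewrite -(@ler_pXn2r _ 2) // ?nnegrE // -normrX ger0_norm ?sqr_ge0 // (le_trans _ h) //.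
by rewrite /dotv (bigD1 i) //= expr2 lerDl sumr_ge0 // => k _; rewrite -expr2 sqr_ge0.
Qed.

Lemma unit_n1 (v : vec) : dotv v v = 1 -> 1 <= n1 v <= 3.
Proof.
move=> h; apply/andP; split.
  rewrite -(@ler_pXn2r _ 2) ?nnegrE ?n1_ge0 ?ler01 //.
  by rewrite expr1n -h dotv_n1.
by rewrite -[leRHS]mulr1; apply: n1_dotv; rewrite ?ler01 // h expr1n.
Qed.

(** * Isotopy extension *)

Section Push.
Variables (I : finType) (rho : RR).
Implicit Types (z : I -> mx3) (P : mx3).

Definition bump (Q P : mx3) : RR := Num.max 0 (1 - rho^-1 * n1 (P - Q)).
(** When the points are [rho]-separated, only the i-th bump survives at P = z i, so 1 + E sends a
    unit vector a of that line to a + (z' i - z i) a = z' i a, which lies on the line z' i.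
    Elsewhere 1 + E is a small perturbation of the identity. *)
Definition pushE z (z' : I -> mx3) P : mx3 := \sum_i bump (z i) P *: (z' i - z i).
Definition push z (z' : I -> mx3) P : mx3 := act (1 + pushE z z' P) P.

Lemma push_id z P : RP2 P -> push z z P = P.
Proof.
move=> hP; have -> : push z z P = act 1 P.
  by rewrite /push /pushE big1 ?addr0 // => i _; rewrite subrr scaler0.
have [v v1 ->] := RP2P hP; rewrite act_lin -pl_unit //; congr pl; exact: mul1mx.
Qed.

Hypotheses (rho0 : 0 < rho) (rho1 : rho <= 1).
Variables (z z' : I -> mx3) (eta : RR).
Hypotheses (etaE : \sum_i n1 (z' i - z i) <= eta) (eta_small : 60 * eta < rho).

Lemma bump_I Q P : 0 <= bump Q P <= 1.
Proof.
rewrite /bump le_max lexx /= ge_max ler01 /= gerBl mulr_ge0 ?n1_ge0 // invr_ge0 ltW //.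
Qed.

Lemma bump_lip Q P P' : `|bump Q P - bump Q P'| <= rho^-1 * n1 (P - P').
Proof.
have h : `|n1 (P - Q) - n1 (P' - Q)| <= n1 (P - P').
  have h1 : n1 (P - Q) <= n1 (P - P') + n1 (P' - Q).
    by rewrite (le_trans _ (n1D _ _)) // addrA subrK.
  have h2 : n1 (P' - Q) <= n1 (P - P') + n1 (P - Q).
    by rewrite (n1BC P) (le_trans _ (n1D _ _)) // addrA subrK.
  by rewrite ler_norml; lra.
have r0 : 0 < rho^-1 by rewrite invr_gt0.
have {}h : `|rho^-1 * n1 (P - Q) - rho^-1 * n1 (P' - Q)| <= rho^-1 * n1 (P - P').
  by rewrite -mulrBr normrM (gtr0_norm r0) ler_pM2l.
rewrite /bump; move: h; set a := rho^-1 * _; set b := rho^-1 * _; set c := rho^-1 * _.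
rewrite !ler_norml => /andP[h1 h2].
by case: (leP 0 (1 - a)) => ha; case: (leP 0 (1 - b)) => hb; lra.
Qed.

Lemma eta_ge0 : 0 <= eta.
Proof. by apply: le_trans etaE; apply: sumr_ge0 => i _; exact: n1_ge0. Qed.

Lemma pushE_le P : n1 (pushE z z' P) <= eta.
Proof.
apply: le_trans etaE; apply: le_trans (n1_sum _ _ _) _; apply: ler_sum => i _.
have /andP[h0 h1] := bump_I (z i) P.
by rewrite n1Z ger0_norm // ler_piMl ?n1_ge0.
Qed.

Lemma pushE_lip P P' : n1 (pushE z z' P - pushE z z' P') <= rho^-1 * n1 (P - P') * eta.
Proof.
rewrite /pushE -sumrB; apply: le_trans (n1_sum _ _ _) _.
have a0 : 0 <= rho^-1 * n1 (P - P') by rewrite mulr_ge0 ?n1_ge0 // invr_ge0 ltW.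
apply: le_trans (_ : _ <= rho^-1 * n1 (P - P') * \sum_i n1 (z' i - z i)) _; last first.
  by rewrite ler_wpM2l.
rewrite mulr_sumr; apply: ler_sum => i _.
by rewrite -scalerBl n1Z ler_wpM2r ?n1_ge0 // bump_lip.
Qed.

Lemma push_neq0 P v : dotv v v = 1 -> (1 + pushE z z' P) *m v != 0.
Proof.
move=> v1; have /andP[h1 h3] := unit_n1 v1.
apply/eqP; rewrite mulmxDl mul1mx => /eqP; rewrite addr_eq0 => /eqP h.
have : n1 v <= eta * 3.
  rewrite h n1N (le_trans (n1M _ _)) // ler_pM ?n1_ge0 //; exact: pushE_le.
by have a1 := rho1; have a2 := eta_small; move=> k; lra.
Qed.

Lemma RP2_push P : RP2 P -> RP2 (push z z' P).
Proof.
by move=> /RP2P [v v1 ->]; rewrite /push act_lin; apply: RP2_pl; exact: push_neq0.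
Qed.

(** A contraction estimate. With sign and order arranged so that (1 + E) v = c (1 + E') w and c >=
    1, the difference v - c w is a sum of three terms, each bounded by a fraction of its own norm D
    because E is small and Lipschitz. The fractions add up to less than 1, so D = 0. *)
Lemma push_inj P Q : RP2 P -> RP2 Q -> push z z' P = push z z' Q -> P = Q.
Proof.
move=> /RP2P [v v1 ->] /RP2P [w w1 ->]; rewrite /push !act_lin.
move=> /(pl_inj (push_neq0 _ v1) (push_neq0 _ w1)) [c c0].
wlog cp : w w1 c c0 / 0 < c.
  move=> H; have [cp|cn|c00] := ltgtP 0 c; first exact: H.
    move=> h; rewrite -(linN w); apply: (H (- w) _ (- c)) => //.
    - by rewrite dotvNl dotvNr opprK.
    - by rewrite oppr_eq0.
    - by rewrite oppr_gt0.
    - by rewrite linN h mulmxN scalerN scaleNr opprK.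
  by rewrite -c00 eqxx in c0.
move=> h0; move: h0 {c0}.
wlog c1 : v w v1 w1 c cp / 1 <= c.
  move=> H; have [c1|c1] := leP 1 c; first exact: H.
  move=> h; apply/esym; apply: (H w v w1 v1 c^-1); first by rewrite invr_gt0.
    by rewrite invf_ge1 // ltW.
  by rewrite h scalerA mulVf ?scale1r // gt_eqF.
set E := pushE z z' (lin v); set E' := pushE z z' (lin w) => h.
pose D := n1 (v - c *: w).
have D0 : 0 <= D := n1_ge0 _.
have e1 : v - c *: w = (c - 1) *: (E' *m w) + E' *m (w - v) + (E' - E) *m v.
  have -> : v = c *: ((1 + E') *m w) - E *m v.
    by rewrite -h mulmxDl mul1mx addrK.
  rewrite [in RHS](_ : c *: ((1 + E') *m w) - E *m v = v); last by rewrite -h mulmxDl mul1mx addrK.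
  rewrite !mulmxDl !mul1mx !mulmxDr !mulNmx !mulmxN !scalerBl !scale1r scalerDr.
  by apply/matrixP => i j; rewrite !mxE; ring.
have vw : dotv v w <= 1.
  have := dotv_ge0 (v - w); rewrite dotvDl !dotvDr !dotvNl !dotvNr v1 w1 (dotvC w v); lra.
have d1 : dotv (v - c *: w) (v - c *: w) = 1 + c ^+ 2 - 2 * c * dotv v w.
  rewrite dotvDl !dotvDr !dotvNl !dotvNr !dotvZl !dotvZr v1 w1 (dotvC w v); ring.
have d2 : dotv (v - w) (v - w) = 2 - 2 * dotv v w.
  rewrite dotvDl !dotvDr !dotvNl !dotvNr v1 w1 (dotvC w v); ring.
have dD : dotv (v - c *: w) (v - c *: w) <= D ^+ 2 := dotv_n1 _.
(* As the dot product of v and w is at most 1, |v - c w| >= c - 1, and for c >= 1 also |v - c w| >=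
   |v - w|. *)
have cD : c - 1 <= D.
  rewrite -(@ler_pXn2r _ 2) ?nnegrE ?subr_ge0 // (le_trans _ dD) // d1; nra.
have vwD : n1 (w - v) <= 3 * D.
  rewrite n1BC; apply: n1_dotv => //; apply: le_trans dD; rewrite d1 d2; nra.
have lD : n1 (lin w - lin v) <= 18 * D.
  have -> : lin w - lin v = (w - v) *m w^T + v *m (w - v)^T.
    by rewrite /lin linearB /= mulmxBl mulmxBr addrA subrK.
  have /andP[_ n3] := unit_n1 v1; have /andP[_ n3'] := unit_n1 w1.
  apply: le_trans (n1D _ _) _.
  have k1 : n1 ((w - v) *m w^T) <= 3 * D * 3.
    by apply: le_trans (n1M _ _) _; rewrite n1_tr ler_pM ?n1_ge0.
  have k2 : n1 (v *m (w - v)^T) <= 3 * (3 * D).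
    by apply: le_trans (n1M _ _) _; rewrite n1_tr ler_pM ?n1_ge0.
  lra.
have /andP[_ n3] := unit_n1 v1; have /andP[_ n3'] := unit_n1 w1.
have eta0 := eta_ge0; have a0 := rho0; have a1 := rho1; have a2 := eta_small.
have ED : n1 (E' - E) <= rho^-1 * (18 * D) * eta.
  apply: le_trans (pushE_lip _ _) _; rewrite ler_wpM2r // ler_wpM2l // invr_ge0 ltW //.
have ED' : n1 (E' - E) <= 3 / 10 * D.
  apply: le_trans ED _.
  have -> : rho^-1 * (18 * D) * eta = 18 * D * (eta / rho) by ring.
  have : eta / rho <= 1 / 60 by rewrite ler_pdivrMr //; lra.
  by move=> k; have := ler_wpM2l D0 k; lra.
have t1 : n1 ((c - 1) *: (E' *m w)) <= D * (eta * 3).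
  rewrite n1Z ger0_norm ?subr_ge0 // ler_pM ?subr_ge0 ?n1_ge0 //.
  by apply: le_trans (n1M _ _) _; rewrite ler_pM ?n1_ge0 // pushE_le.
have t2 : n1 (E' *m (w - v)) <= eta * (3 * D).
  by apply: le_trans (n1M _ _) _; rewrite ler_pM ?n1_ge0 // pushE_le.
have t3 : n1 ((E' - E) *m v) <= 3 / 10 * D * 3.
  by apply: le_trans (n1M _ _) _; rewrite ler_pM ?n1_ge0.
(* This is the origin of the constant 60: eta < rho / 60 bounds the last term, 54 eta / rho times D,
   by 9/10 D, and the first two, 6 eta times D, by less than 1/10 D when D > 0. *)
have DD : D <= D * (eta * 3) + eta * (3 * D) + 3 / 10 * D * 3.
  rewrite {1}/D e1; apply: le_trans (n1D _ _) _; apply: lerD => //.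
  by apply: le_trans (n1D _ _) _; apply: lerD.
have D00 : D <= 0 by nra.
have vw0 : n1 (w - v) <= 0 by lra.
by move/n1_eq0/eqP: vw0; rewrite subr_eq0 => /eqP ->.
Qed.

Hypotheses (zR : forall i, RP2 (z i)) (z'R : forall i, RP2 (z' i)).
Hypothesis sep : forall i j, i != j -> rho <= n1 (z i - z j).

Lemma pushE_base i : pushE z z' (z i) = z' i - z i.
Proof.
rewrite /pushE (bigD1 i) //= big1 ?addr0 => [|j ji].
  by rewrite /bump subrr n10 mulr0 subr0 max_r ?ler01 // scale1r.
rewrite /bump max_l ?scale0r // subr_le0 -(mulVf (lt0r_neq0 rho0)) ler_pM2l ?invr_gt0 //.
by apply: sep; rewrite eq_sym.
Qed.

Lemma push_base i : push z z' (z i) = z' i.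
Proof.
have [a a1 ea] := RP2P (zR i); have [b b1 eb] := RP2P (z'R i).
have nz := push_neq0 (z i) a1.
rewrite /push {2}ea act_lin.
have e : (1 + pushE z z' (z i)) *m a = dotv b a *: b.
  rewrite pushE_base mulmxDl mul1mx mulmxBl ea eb {1}/lin lin_mul {1}/lin lin_mul a1.
  by rewrite scale1r addrC subrK.
rewrite e plZ ?pl_unit ?eb //.
by apply/eqP => c0; move: nz; rewrite e c0 scale0r eqxx.
Qed.
End Push.

Lemma cube_pos (g : RR -> RR -> RR -> RR) :
  cts (fun p : RR * (RR * RR) => g p.1 p.2.1 p.2.2) -> (forall r s t, 0 < g r s t) ->
  exists2 e : RR, 0 < e & forall r s t, I01 r -> I01 s -> I01 t -> e <= g r s t.
Proof.
move=> cg g0.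
have cI : compact I01.
  have -> : I01 = `[0, 1]%classic by apply/seteqP; split=> x /=; rewrite in_itv.
  exact: segment_compact.
have cK : compact (I01 `*` (I01 `*` I01)) by do 2 apply: compact_setX => //.
move/compact_near_coveringP in cK.
pose P (N : nat) (x : RR * (RR * RR)) := N.+1%:R^-1 <= g x.1 x.2.1 x.2.2.
have [] := cK nat (@eventually) P _.
  move=> [r [s t]] _.
  pose d := g r s t / 2.
  have d0 : 0 < d by have := g0 r s t; rewrite /d; lra.
  exists ([set p | d < g p.1 p.2.1 p.2.2], [set N : nat | N.+1%:R^-1 < d]) => /=.
    split=> /=; last exact: (near_infty_natSinv_lt (PosNum d0)).
    apply: (cg (r, (s, t)) [set y | d < y]) => /=.
    apply/nbhs_ballP; exists d => //= y; rewrite /ball /= => h.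
    have := ler_norm (g r s t - y); rewrite /d in h *; lra.
  by move=> [x N] /= [h1 h2]; rewrite /P (le_trans (ltW h2)) // ltW.
move=> N _ HN; exists N.+1%:R^-1; first by rewrite invr_gt0.
move=> r s t Ir Is It.
have := HN N => /=; rewrite leqnn => /(_ erefl (r, (s, t))) /=.
by apply.
Qed.

Lemma cts_push (T : topologicalType) (I : finType) (rho : RR) (z z' : I -> T -> mx3) (P : T -> mx3) :
  0 < rho -> (forall i, mcts (z i)) -> (forall i, mcts (z' i)) -> mcts P ->
  (forall x, \tr ((1 + pushE rho (z^~ x) (z'^~ x) (P x)) *m P x *m
                  (1 + pushE rho (z^~ x) (z'^~ x) (P x))^T) != 0) ->
  mcts (fun x => push rho (z^~ x) (z'^~ x) (P x)).
Proof.
move=> rho0 cz cz' cP nz.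
have cM : mcts (fun x => 1 + pushE rho (z^~ x) (z'^~ x) (P x)).
  apply: mctsD; first exact: mcts_cst.
  apply: mcts_sum => i; apply: mctsZ; last exact: mctsB.
  apply: cts_max; first exact: cts_cst.
  apply: ctsB; first exact: cts_cst.
  by apply: ctsM; [exact: cts_cst|apply: cts_n1; exact: mctsB].
have cMM : mcts (fun x => (1 + pushE rho (z^~ x) (z'^~ x) (P x)) *m P x *m
                  (1 + pushE rho (z^~ x) (z'^~ x) (P x))^T).
  by apply: mctsM; [exact: mctsM|exact: mcts_tr].
by apply: mctsZ => //; apply: ctsV => //; exact: cts_trace.
Qed.

Lemma minmin_dist (x a b : RR) : `|Num.min x a - Num.min x b| <= `|a - b|.
Proof.
have h c d : Num.min x c - Num.min x d <= `|c - d|.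
  have := ler_norm (c - d); have := normr_ge0 (c - d).
  by case: (leP x c) => ?; case: (leP x d) => ? ? ?; lra.
by rewrite ler_norml h andbT lerNl opprB distrC h.
Qed.

Section Isotopy.
Variables (I : finType) (H : I -> RR -> RR -> RR -> mx3).
Hypothesis cH : forall i, mcts (fun p : RR * (RR * RR) => H i p.1 p.2.1 p.2.2).
Hypothesis RH : forall i r s t, RP2 (H i r s t).
Hypothesis dH : forall i j r s t, i != j -> H i r s t != H j r s t.
Hypothesis clH : forall i r s t, H i r s t = H i (cl r) (cl s) (cl t).

(** Isotopy time r is cut into steps of length 1/N, one push per step, while s and t are mere
    parameters. Capping the times at r turns the pushes after time r into pushes of a configuration
    to itself, which are identities on RP^2; this gives continuity in r. *)
Fixpoint iso (rho : RR) (N k : nat) r s t (P : mx3) : mx3 :=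
  if k is k'.+1 then
    push rho (fun i => H i (Num.min (cl r) (k'%:R / N%:R)) s t)
             (fun i => H i (Num.min (cl r) (k'.+1%:R / N%:R)) s t) (iso rho N k' r s t P)
  else P.

Lemma H_comp (T : topologicalType) (a b c : T -> RR) i :
  cts a -> cts b -> cts c -> mcts (fun x => H i (a x) (b x) (c x)).
Proof.
move=> ca cb cc.
apply: (mcts_precomp (f := fun p : RR * (RR * RR) => H i p.1 p.2.1 p.2.2)
  (g := fun x => (a x, (b x, c x)))) => //.
exact: pair_cts ca (pair_cts cb cc).
Qed.

Lemma isotopy_params : exists rho N, [/\ 0 < rho, rho <= 1,
  forall i j r s t, i != j -> rho <= n1 (H i r s t - H j r s t) &
  forall k r s t, 60 * \sum_i n1 (H i (Num.min (cl r) (k.+1%:R / N.+1%:R)) s t -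
                                  H i (Num.min (cl r) (k%:R / N.+1%:R)) s t) < rho].
Proof.
(* 1 / (1 + S) is continuous, at most 1 and below every mutual distance, so a positive lower bound
   for it on the cube serves as [rho]. The number of steps then comes from uniform continuity with
   tolerance rho / 60. *)
pose S r s t := \sum_(p : I * I | p.1 != p.2) (n1 (H p.1 r s t - H p.2 r s t))^-1.
have n0 i j r s t : i != j -> 0 < n1 (H i r s t - H j r s t).
  move=> ij; rewrite ltNge; apply/negP => /n1_eq0 /eqP; rewrite subr_eq0.
  by apply/negP; exact: dH.
have S0 r s t : 0 <= S r s t.
  by apply: sumr_ge0 => p pp; rewrite invr_ge0 ltW // n0.
have cS : cts (fun p : RR * (RR * RR) => S p.1 p.2.1 p.2.2).
  have -> : (fun p : RR * (RR * RR) => S p.1 p.2.1 p.2.2) = (fun x =>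
    \sum_(p : I * I) (if p.1 == p.2 then 0 else (n1 (H p.1 x.1 x.2.1 x.2.2 - H p.2 x.1 x.2.1 x.2.2))^-1)).
    by apply/funext => x; rewrite /S big_mkcond; apply: eq_bigr => p _; rewrite if_neg.
  apply: cts_sum => p; case: (boolP (p.1 == p.2)) => pp; first exact: cts_cst.
  apply: ctsV; first by apply: cts_n1; exact: mctsB.
  by move=> x; rewrite gt_eqF // n0.
have S1 r s t : 0 < 1 + S r s t by rewrite ltr_pwDl.
have cS1 : cts (fun p : RR * (RR * RR) => (1 + S p.1 p.2.1 p.2.2)^-1).
  apply: ctsV; first by apply: ctsD => //; exact: cts_cst.
  by move=> x; rewrite gt_eqF.
have Si r s t : 0 < (1 + S r s t)^-1 by rewrite invr_gt0.
have [rho rho0 hrho] := cube_pos cS1 Si.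
have c0 : continuous (fun p : (RR * RR) * (RR * RR) => (p.1.1, p.2)).
  apply: (pair_cts (f := fun p : (RR * RR) * (RR * RR) => p.1.1)); last by move=> p; exact: cvg_snd.
  exact: (cts_fst (cts_fst cts_id)).
have c1 : continuous (fun p : (RR * RR) * (RR * RR) => (p.1.2, p.2)).
  apply: (pair_cts (f := fun p : (RR * RR) * (RR * RR) => p.1.2)); last by move=> p; exact: cvg_snd.
  exact: (cts_fst (cts_snd cts_id)).
pose D r r' s t := \sum_i n1 (H i r s t - H i r' s t).
have cD : cts (fun p : (RR * RR) * (RR * RR) => D p.1.1 p.1.2 p.2.1 p.2.2).
  apply: cts_sum => i; apply: cts_n1; apply: mctsB.
    exact: (mcts_precomp c0 (@cH i)).
  exact: (mcts_precomp c1 (@cH i)).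
have D0 r s t : D r r s t = 0 by apply: big1 => i _; rewrite subrr n10.
have r60 : 0 < rho / 60 by rewrite divr_gt0.
have [N hN] := cube_uniform cD D0 r60.
have clI x : I01 (cl x) by exact: cl_I.
have Smono r s t : 0 <= S r s t := S0 r s t.
exists rho, N; split => //.
- by apply: le_trans (hrho (cl 0) (cl 0) (cl 0) (clI _) (clI _) (clI _)) _; rewrite invf_le1 ?lerDl ?ltr_pwDl.
- move=> i j r s t ij; rewrite clH (clH j).
  apply: le_trans (hrho (cl r) (cl s) (cl t) (clI _) (clI _) (clI _)) _.
  have p0 := n0 i j (cl r) (cl s) (cl t) ij.
  rewrite -[leRHS]invrK lef_pV2 ?posrE ?invr_gt0 ?ltr_pwDl //.
  rewrite /S (bigD1 (i, j)) //= addrCA lerDl addr_ge0 //.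
  by apply: sumr_ge0 => p /andP[pp _]; rewrite invr_ge0 ltW // n0.
move=> k r s t; rewrite mulrC -ltr_pdivlMr //.
have mI x (n : nat) : I01 (Num.min (cl x) (n%:R / N.+1%:R)).
  have /andP[x0 x1] := cl_I x.
  by rewrite /I01 /= le_min x0 divr_ge0 //= ge_min x1.
have := hN _ _ _ _ (mI r k.+1) (mI r k) (clI s) (clI t); rewrite /D.
have -> : \sum_i n1 (H i (Num.min (cl r) (k.+1%:R / N.+1%:R)) (cl s) (cl t) -
   H i (Num.min (cl r) (k%:R / N.+1%:R)) (cl s) (cl t)) =
   \sum_i n1 (H i (Num.min (cl r) (k.+1%:R / N.+1%:R)) s t -
   H i (Num.min (cl r) (k%:R / N.+1%:R)) s t).
  by apply: eq_bigr => i _; rewrite !(clH i _ s t) !(clH i _ (cl s)) !clK.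
apply; apply: le_trans (minmin_dist _ _ _) _.
rewrite -mulrBl -[k.+1]addn1 natrD [_ + 1]addrC addrK mul1r ger0_norm //.
Qed.

(** Composite of small pushes. The fourth clause, valid because pushes between equal configurations
    are identities, is what keeps end points fixed when the moving points come from a homotopy
    relative to its ends. *)
Lemma isotopy : exists Om : RR -> RR -> RR -> mx3 -> mx3,
  [/\ forall r s t P, RP2 P -> RP2 (Om r s t P),
      forall r s t P Q, RP2 P -> RP2 Q -> Om r s t P = Om r s t Q -> P = Q,
      forall i r s t, Om r s t (H i 0 s t) = H i r s t,
      forall r s t P, RP2 P -> (forall i r', H i r' s t = H i 0 s t) -> Om r s t P = P &
      (forall s t P, RP2 P -> Om 0 s t P = P) /\
      forall (T : topologicalType) (a b c : T -> RR) (P : T -> mx3),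
        cts a -> cts b -> cts c -> mcts P -> (forall x, RP2 (P x)) ->
        mcts (fun x => Om (a x) (b x) (c x) (P x))].
Proof.
have [rho [N [rho0 rho1 sep small]]] := isotopy_params.
have R k r s t P : RP2 P -> RP2 (iso rho N.+1 k r s t P).
  by elim: k => //= k IH hP; apply: (RP2_push rho0 rho1 (lexx _) (small k r s t)); exact: IH.
have mk k : 0 <= k -> Num.min (cl 0) k = 0 :> RR by rewrite cl0 => k0; rewrite min_l.
have mi k r s t P : RP2 P -> (forall i k', H i (Num.min (cl r) k') s t = H i 0 s t) ->
    iso rho N.+1 k r s t P = P.
  move=> hP h.
  have e k' : (fun i => H i (Num.min (cl r) k') s t) = (fun i => H i 0 s t).
    by apply/funext => i; exact: h.
  elim: k => [|k IH]; first by [].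
  by rewrite [LHS]/= IH !e push_id.
have mN r : Num.min (cl r) (N.+1%:R / N.+1%:R) = cl r.
  by rewrite divff ?pnatr_eq0 // min_l //; have /andP[] := cl_I r.
have inj k r s t P Q : RP2 P -> RP2 Q ->
    iso rho N.+1 k r s t P = iso rho N.+1 k r s t Q -> P = Q.
  move=> hP hQ; elim: k => //= k IH.
  move/(push_inj rho0 rho1 (lexx _) (small k r s t) (R _ _ _ _ _ hP) (R _ _ _ _ _ hQ)).
  exact: IH.
have base k i r s t :
    iso rho N.+1 k r s t (H i 0 s t) = H i (Num.min (cl r) (k%:R / N.+1%:R)) s t.
  elim: k => [|k IH].
    by rewrite mul0r min_r //; have /andP[] := cl_I r.
  rewrite [LHS]/= IH; apply: (push_base rho0 rho1 (lexx _) (small k r s t)) => //.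
  by move=> j j' jj; exact: sep.
have id0 k s t P : RP2 P -> iso rho N.+1 k 0 s t P = P.
  move=> hP; elim: k => [|k IH]; first by [].
  by rewrite [LHS]/= IH !mk ?divr_ge0 // push_id.
have cont k (T : topologicalType) (a b c : T -> RR) (P : T -> mx3) :
    cts a -> cts b -> cts c -> mcts P -> (forall x, RP2 (P x)) ->
    mcts (fun x => iso rho N.+1 k (a x) (b x) (c x) (P x)).
  move=> ca cb cc cP hP; elim: k => [|k IH]; first by [].
  have cmin n : cts (fun x : T => Num.min (cl (a x)) (n%:R / N.+1%:R)).
    by apply: cts_min; [exact: cts_cl|exact: cts_cst].
  apply: (cts_push (z := fun i x => H i (Num.min (cl (a x)) (k%:R / N.+1%:R)) (b x) (c x))
            (z' := fun i x => H i (Num.min (cl (a x)) (k.+1%:R / N.+1%:R)) (b x) (c x))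
            (P := fun x => iso rho N.+1 k (a x) (b x) (c x) (P x))).
  - exact: rho0.
  - by move=> i; exact: H_comp.
  - by move=> i; exact: H_comp.
  - exact: IH.
  move=> x; cbv beta; have [v v1 ->] := RP2P (R k (a x) (b x) (c x) _ (hP x)).
  rewrite lin_act tr_lin gt_eqF // dotv_gt0 //.
  exact: (push_neq0 rho0 rho1 (lexx _) (small k (a x) (b x) (c x))).
exists (iso rho N.+1 N.+1); split.
- by move=> r s t P; exact: R.
- exact: inj.
- by move=> i r s t; rewrite base mN [LHS]clH clK [RHS]clH.
- by move=> r s t P hP h; apply: mi => // i k'; exact: h.
- by split; [move=> s t P; exact: id0|exact: cont].
Qed.
End Isotopy.

(** * Lifting squares to the sphere and to spinors *)

(** Lifts on the square are built along the rays from the corner (0, 0). With a number of steps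
    uniform in (s, t), each step is a continuous formula in (s, t) and no gluing of local lifts
    occurs. *)
Definition ray T (f : RR -> RR -> T) (r s t : RR) : T := f (cl r * cl s) (cl r * cl t).

Lemma cl_lip a b : `|cl a - cl b| <= `|a - b|.
Proof.
have e (t : RR) : Num.max t 0 = - Num.min 0 (- t).
  by case: (leP t 0) => h; [rewrite min_l|rewrite min_r]; rewrite ?oppr0 ?opprK ?oppr_ge0 ?oppr_le0 // ltW.
rewrite /cl ![Num.min _ 1]minC (le_trans (minmin_dist _ _ _)) // !e -opprD normrN.
by rewrite (le_trans (minmin_dist _ _ _)) // -opprD normrN.
Qed.

(* Chain the points k/N.(s,t) of the ray from (0,0) to (s,t). *)
Lemma ray_uniform (T : Type) (d : T -> T -> RR) (f : RR -> RR -> T) (e : RR) :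
  cts (fun p : (RR * RR) * (RR * RR) => d (f p.1.1 p.1.2) (f p.2.1 p.2.2)) ->
  (forall x, d x x = 0) -> 0 < e ->
  exists N : nat, forall k s t,
    d (ray f (k%:R / N.+1%:R) s t) (ray f (k.+1%:R / N.+1%:R) s t) < e.
Proof.
move=> cd d0 e0.
have c1 : cts (fun p : (RR * RR) * (RR * RR) => cl p.1.1).
  by apply: cts_cl; exact: (cts_fst (cts_fst cts_id)).
have c2 : cts (fun p : (RR * RR) * (RR * RR) => cl p.1.2).
  by apply: cts_cl; exact: (cts_fst (cts_snd cts_id)).
have c3 : cts (fun p : (RR * RR) * (RR * RR) => cl p.2.1).
  by apply: cts_cl; exact: (cts_snd (cts_fst cts_id)).
have c4 : cts (fun p : (RR * RR) * (RR * RR) => cl p.2.2).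
  by apply: cts_cl; exact: (cts_snd (cts_snd cts_id)).
have cg : continuous (fun p : (RR * RR) * (RR * RR) =>
    ((cl p.1.1 * cl p.2.1, cl p.1.1 * cl p.2.2), (cl p.1.2 * cl p.2.1, cl p.1.2 * cl p.2.2))).
  exact: (pair_cts (pair_cts (ctsM c1 c3) (ctsM c1 c4)) (pair_cts (ctsM c2 c3) (ctsM c2 c4))).
have cD := cts_precomp cg cd.
have [N hN] := cube_uniform (D := fun r r' s t => d (ray f r s t) (ray f r' s t)) cD
  (fun r s t => d0 _) e0.
exists N => k s t.
have e1 r : ray f r s t = ray f (cl r) (cl s) (cl t) by rewrite /ray !clK.
rewrite e1 (e1 (k.+1%:R / _)); apply: hN; try exact: cl_I.
apply: le_trans (cl_lip _ _) _; rewrite distrC -mulrBl -[k.+1]addn1 natrD [_ + 1]addrC addrK.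
by rewrite mul1r ger0_norm.
Qed.

Lemma cts_ray (f : RR -> RR -> RR) r : cts2 f ->
  cts (fun p : RR * RR => ray f r p.1 p.2).
Proof.
move=> cf; apply: (cts_comp2 (F := f)) => //.
  by apply: ctsM; [exact: cts_cst|apply: cts_cl; exact: (cts_fst cts_id)].
by apply: ctsM; [exact: cts_cst|apply: cts_cl; exact: (cts_snd cts_id)].
Qed.

Lemma ray00 T (f : RR -> RR -> T) r : ray f r 0 0 = f 0 0.
Proof. by rewrite /ray cl0 !mulr0. Qed.
Lemma ray0 T (f : RR -> RR -> T) s t : ray f 0 s t = f 0 0.
Proof. by rewrite /ray cl0 !mul0r. Qed.
Lemma ray1 T (f : RR -> RR -> T) s t : ray f 1 s t = f (cl s) (cl t).
Proof. by rewrite /ray cl1 !mul1r. Qed.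
Lemma ray_cl T (f : RR -> RR -> T) r s t : ray f r (cl s) (cl t) = ray f r s t.
Proof. by rewrite /ray !clK. Qed.

(** Along a ray, each vector is the orthogonal projection of the preceding one onto the next line.
    It cannot vanish, since consecutive projections differ by less than 1 in [n1]; lengths are
    normalised only at the end. *)
Lemma sphere_lift (Q : RR -> RR -> mx3) (v0 : vec) :
  mcts2 Q -> (forall s t, RP2 (Q s t)) ->
  dotv v0 v0 = 1 -> Q 0 0 = lin v0 ->
  exists v : RR -> RR -> vec,
    [/\ mcts2 v, forall s t, dotv (v s t) (v s t) = 1,
        forall s t, Q (cl s) (cl t) = lin (v s t), v 0 0 = v0 &
        forall s t, v (cl s) (cl t) = v s t].
Proof.
move=> cQ hQ v01 e0.
pose d (P P' : mx3) := n1 (P - P').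
have cd : cts (fun p : (RR * RR) * (RR * RR) => d (Q p.1.1 p.1.2) (Q p.2.1 p.2.2)).
  apply: cts_n1; apply: mctsB => i j.
    exact: (cts_fst (cQ i j)).
  exact: (cts_snd (f := fun p : RR * RR => Q p.1 p.2 i j) (cQ i j)).
have [N hN] := ray_uniform cd (fun P => ltac:(by rewrite /d subrr n10)) ltr01.
pose P k s t := ray Q (k%:R / N.+1%:R) s t.
have hP k s t : RP2 (P k s t) by exact: hQ.
pose W := fix W k s t : vec := if k is k'.+1 then P k s t *m W k' s t else v0.
have W0 k s t : W k s t != 0 /\ P k s t *m W k s t = W k s t.
  elim: k => [|k [IH0 IH]].
    split; first exact: unit_neq0.
    by rewrite /= /P mul0r ray0 e0 lin_mul v01 scale1r.
  split; last first.
    by rewrite /= mulmxA; have [_ [-> _]] := hP k.+1 s t.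
  apply/eqP => /= h.
  have e : W k s t = (P k s t - P k.+1 s t) *m W k s t.
    by rewrite mulmxBl IH h subr0.
  have p : 0 < n1 (W k s t).
    by rewrite ltNge; apply/negP => /n1_eq0 h0; rewrite h0 eqxx in IH0.
  have := n1M (P k s t - P k.+1 s t) (W k s t); rewrite -e.
  apply/negP; rewrite -ltNge gtr_pMl //; exact: hN.
have cW k : mcts2 (W k).
  elim: k => [|k IH]; first exact: mcts_cst.
  by apply: mctsM => // i j; apply: (cts_ray (f := fun x y => Q x y i j)); exact: cQ.
have W00 k : W k 0 0 = v0.
  by elim: k => //= k ->; rewrite /P ray00 e0 lin_mul v01 scale1r.
have Wcl k s t : W k (cl s) (cl t) = W k s t.
  by elim: k => //= k ->; rewrite /P ray_cl.
pose n s t := (Num.sqrt (dotv (W N.+1 s t) (W N.+1 s t)))^-1.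
have np s t : 0 < dotv (W N.+1 s t) (W N.+1 s t) by apply: dotv_gt0; have [] := W0 N.+1 s t.
have v1 s t : dotv (n s t *: W N.+1 s t) (n s t *: W N.+1 s t) = 1.
  rewrite dotvZl dotvZr mulrA -expr2 exprVn sqr_sqrtr ?ltW ?mulVf ?gt_eqF //; exact: np.
exists (fun s t => n s t *: W N.+1 s t); split => //.
- apply: mctsZ => //; apply: ctsV; first by apply: cts_sqrt; exact: cts_dotv.
  by move=> x; rewrite gt_eqF // sqrtr_gt0.
- move=> s t; have [_ e] := W0 N.+1 s t; have [p p1 ep] := RP2P (hQ (cl s) (cl t)).
  have eP : P N.+1 s t = lin p by rewrite /P divff ?pnatr_eq0 // ray1.
  rewrite ep; have := v1 s t; rewrite -{1 2 3}e eP lin_mul.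
  set c := dotv p _; rewrite scalerA => h; rewrite linZ.
  by move: h; rewrite dotvZl dotvZr p1 mulr1 -expr2 => ->; rewrite scale1r.
- by rewrite /n W00 v01 sqrtr1 invr1 scale1r.
- by move=> s t; rewrite /n Wcl.
Qed.

Lemma atan_spec (c s : RR) : 0 < c -> c ^+ 2 + s ^+ 2 = 1 ->
  cos (atan (s / c)) = c /\ sin (atan (s / c)) = s.
Proof.
move=> c0 h.
have hc : cos (atan (s / c)) = c.
  rewrite cos_atan; have -> : 1 + (s / c) ^+ 2 = (c^-1) ^+ 2.
    have -> : 1 + (s / c) ^+ 2 = (c ^+ 2 + s ^+ 2) / c ^+ 2 by field; rewrite gt_eqF.
    by rewrite h mul1r exprVn.
  by rewrite sqrtr_sqr ger0_norm ?invr_ge0 ?ltW // invrK.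
split=> //; have := atanK (s / c); rewrite /tan hc => e.
by apply: (@mulIf _ c^-1) => //; rewrite invr_eq0 gt_eqF.
Qed.

(** The angle is a sum of increments atan (S / C), where C and S are cosine and sine of the angle
    between consecutive points of the ray. The squared chord 2 - 2 C is less than 1, hence C > 0 and
    atan gives the true increment. *)
Lemma angle_lift (a b : RR -> RR -> RR) (h0 : RR) :
  cts2 a -> cts2 b ->
  (forall s t, a s t ^+ 2 + b s t ^+ 2 = 1) -> a 0 0 = cos h0 -> b 0 0 = sin h0 ->
  exists h : RR -> RR -> RR,
    [/\ cts2 h, forall s t, a (cl s) (cl t) = cos (h s t),
        forall s t, b (cl s) (cl t) = sin (h s t), h 0 0 = h0 &
        forall s t, h (cl s) (cl t) = h s t].
Proof.
move=> ca cb ab a0 b0.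
pose d (x y : RR * RR) := (x.1 - y.1) ^+ 2 + (x.2 - y.2) ^+ 2.
have cd : cts (fun p : (RR * RR) * (RR * RR) =>
    d (a p.1.1 p.1.2, b p.1.1 p.1.2) (a p.2.1 p.2.2, b p.2.1 p.2.2)).
  apply: ctsD; apply: ctsX; apply: ctsB.
  - exact: (cts_fst ca).
  - exact: (cts_snd (f := fun p => a p.1 p.2) ca).
  - exact: (cts_fst cb).
  - exact: (cts_snd (f := fun p => b p.1 p.2) cb).
have [N hN] := ray_uniform (f := fun s t => (a s t, b s t)) cd
  (fun P => ltac:(by rewrite /d !subrr expr0n addr0)) ltr01.
pose A k s t := ray a (k%:R / N.+1%:R) s t.
pose B k s t := ray b (k%:R / N.+1%:R) s t.
have AB k s t : A k s t ^+ 2 + B k s t ^+ 2 = 1 by exact: ab.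
pose C k s t := A k s t * A k.+1 s t + B k s t * B k.+1 s t.
pose S k s t := A k s t * B k.+1 s t - B k s t * A k.+1 s t.
have Cp k s t : 0 < C k s t.
  have h : (A k s t - A k.+1 s t) ^+ 2 + (B k s t - B k.+1 s t) ^+ 2 < 1 := hN k s t.
  have e1 := AB k s t; have e2 := AB k.+1 s t.
  have e : (A k s t - A k.+1 s t) ^+ 2 + (B k s t - B k.+1 s t) ^+ 2 =
    (A k s t ^+ 2 + B k s t ^+ 2) + (A k.+1 s t ^+ 2 + B k.+1 s t ^+ 2) - 2 * C k s t.
    by rewrite /C; ring.
  by rewrite e e1 e2 in h; lra.
have CS k s t : C k s t ^+ 2 + S k s t ^+ 2 = 1.
  have -> : C k s t ^+ 2 + S k s t ^+ 2 = (A k s t ^+ 2 + B k s t ^+ 2) *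
     (A k.+1 s t ^+ 2 + B k.+1 s t ^+ 2) by rewrite /C /S; ring.
  by rewrite !AB mulr1.
pose H := fix H k s t : RR := if k is k'.+1 then H k' s t + atan (S k' s t / C k' s t) else h0.
have HP k s t : cos (H k s t) = A k s t /\ sin (H k s t) = B k s t.
  elim: k => [|k [IH1 IH2]]; first by rewrite /A /B mul0r !ray0.
  have [h1 h2] := atan_spec (Cp k s t) (CS k s t).
  rewrite /= trigo.cosD trigo.sinD h1 h2 IH1 IH2; have := AB k s t; rewrite /C /S => e; split.
    rewrite -[RHS]mul1r -e; ring.
  rewrite -[RHS]mul1r -e; ring.
have cA k : cts2 (A k) by exact: cts_ray.
have cB k : cts2 (B k) by exact: cts_ray.
have cH k : cts2 (H k).
  elim: k => [|k IH]; first exact: cts_cst.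
  apply: ctsD => //; apply: cts_atan; apply: ctsM.
    by apply: ctsB; exact: ctsM.
  apply: ctsV; last by move=> x; rewrite gt_eqF.
  by apply: ctsD; exact: ctsM.
exists (H N.+1); split => //.
- by move=> s t; have [-> _] := HP N.+1 s t; rewrite /A divff ?pnatr_eq0 // ray1.
- by move=> s t; have [_ ->] := HP N.+1 s t; rewrite /B divff ?pnatr_eq0 // ray1.
- elim: (N.+1) => //= k ->; rewrite /S /C /A /B !ray00.
  by have -> : a 0 0 * b 0 0 - b 0 0 * a 0 0 = 0 by [ring]; rewrite mul0r atan0 addr0.
- by move=> s t; elim: (N.+1) => //= k ->; rewrite /S /C /A /B !ray_cl.
Qed.

(** * Complex phases, spinors and the Hopf map *)

Notation CC := (RR[i]).

Definition cis (x : RR) : CC := (cos x +i* sin x)%C.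
Arguments cis : simpl never.
Definition nsq (z : CC) : RR := complex.Re z ^+ 2 + complex.Im z ^+ 2.

Lemma conjM (z w : CC) : (z * w)^*%C = z^*%C * w^*%C.
Proof. exact: rmorphM. Qed.

Lemma cisD x y : cis (x + y) = cis x * cis y.
Proof.
rewrite /cis trigo.cosD trigo.sinD; apply/eqP; rewrite eq_complex /= eqxx /=.
by apply/eqP; ring.
Qed.
Lemma cis0 : cis 0 = 1.
Proof. by rewrite /cis trigo.cos0 trigo.sin0. Qed.
Lemma nsq_cis x : nsq (cis x) = 1.
Proof. exact: cos2Dsin2. Qed.
Lemma cisMn x n : cis (x *+ n) = cis x ^+ n.
Proof. by elim: n => [|n IH]; rewrite ?mulr0n ?cis0 // mulrS exprS cisD IH. Qed.
Lemma conj_cis x : (cis x)^*%C = cis (- x).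
Proof. by rewrite /cis trigo.cosN trigo.sinN. Qed.

Lemma mul_conj (z : CC) : z * z^*%C = (nsq z)%:C%C.
Proof.
by case: z => a b; apply/eqP; rewrite eq_complex /= /nsq /=; apply/andP; split; apply/eqP; ring.
Qed.
Lemma nsqM z w : nsq (z * w) = nsq z * nsq w.
Proof. by case: z => a b; case: w => c d; rewrite /nsq /=; ring. Qed.
Lemma nsqX z n : nsq (z ^+ n) = nsq z ^+ n.
Proof.
elim: n => [|n IH]; last by rewrite !exprS nsqM IH.
by rewrite !expr0 /nsq /= expr0n expr1n addr0.
Qed.
Lemma nsq_ge0 z : 0 <= nsq z.
Proof. by rewrite addr_ge0 ?sqr_ge0. Qed.
Lemma nsq_eq0 z : (nsq z == 0) = (z == 0).
Proof. by case: z => a b; rewrite /nsq paddr_eq0 ?sqr_ge0 // !sqrf_eq0 eq_complex. Qed.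
Lemma nsq0 : nsq 0 = 0. Proof. by apply/eqP; rewrite nsq_eq0. Qed.
Lemma nsq_gt0 z : z != 0 -> 0 < nsq z.
Proof. by move=> h; rewrite lt_def nsq_ge0 nsq_eq0 h. Qed.
Lemma unit_conj z : nsq z = 1 -> z * z^*%C = 1.
Proof. by rewrite mul_conj => ->. Qed.

Lemma cis_root q l : (0 < q)%N -> cis (pi *+ (l + l) / q%:R) ^+ q = 1.
Proof.
move=> q0; rewrite -cisMn -(mulr_natr (_ / _)) divfK ?pnatr_eq0 -?lt0n // addnn -mul2n mulrnA cisMn.
by rewrite /cis cos2pi sin2pi -[(1 +i* 0)%C]/(1 : CC) expr1n.
Qed.

Lemma cis_ex z : nsq z = 1 -> exists x, z = cis x.
Proof.
case: z => a b; rewrite /nsq /= => h.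
have ha : -1 <= a <= 1 by have := sqr_ge0 b; rewrite -ler_norml => h2; rewrite -(@ler_pXn2r _ 2) ?nnegrE // expr1n real_normK ?num_real //; lra.
have c : cos (acos a) = a by rewrite acosK // in_itv.
have s : sin (acos a) ^+ 2 = b ^+ 2 by rewrite sin2cos2 c; lra.
have [s1|s1] := eqVneq (sin (acos a)) b; first by exists (acos a); rewrite /cis c s1.
exists (- acos a); rewrite /cis trigo.cosN trigo.sinN c; congr Complex.
by move/eqP: s; rewrite eqf_sqr (negPf s1) /= => /eqP ->; rewrite opprK.
Qed.

(** Half the remainder of x modulo 2 pi is some y in [0, pi) with cos (2 y) = 1, so sin y = 0; and
    sin is positive on (0, pi). *)
Lemma cis_eq1 x : cis x = 1 -> exists k : int, x = k%:~R * (pi *+ 2).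
Proof.
case=> hc _; have p0 : 0 < pi :> RR := pi_gt0 _.
pose k := Num.floor (x / (pi *+ 2)); exists k.
have pp : 0 < pi *+ 2 :> RR by rewrite pmulrn_lgt0.
have := floor_itv (x / (pi *+ 2)); rewrite -/k => /andP[].
rewrite ler_pdivlMr // ltr_pdivrMr // intrD mulrDl mul1r => k1 k2.
pose y := (x - k%:~R * (pi *+ 2)) / 2.
have y0 : 0 <= y by rewrite /y; lra.
have y1 : y < pi by rewrite /y; move: k2; rewrite mulr2n; lra.
have cy : cos (y *+ 2) = 1.
  have -> : y *+ 2 = x - k%:~R * (pi *+ 2) by rewrite /y mulr2n; lra.
  have e n z : cos (z + n%:R * (pi *+ 2)) = cos z :> RR.
    elim: n => [|n IH]; first by rewrite mul0r addr0.
    by rewrite -addn1 natrD mulrDl mul1r addrA cosD2pi.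
  have {}e (n : int) z : cos (z + n%:~R * (pi *+ 2)) = cos z :> RR.
    case: n => n; first exact: e.
    by rewrite NegzE mulrNz mulNr -pmulrn -[LHS](e n.+1) subrK.
  by rewrite -mulNr -mulrNz e.
have sy : sin y = 0.
  move: cy; rewrite cos_mulr2n cos2sin2 => h; apply/eqP; rewrite -sqrf_eq0.
  by apply/eqP; move: h; rewrite mulr2n; lra.
have [y00|yp] := eqVneq y 0; first by move: y00; rewrite /y; lra.
have : 0 < sin y by apply: sin_gt0_pi; rewrite lt_def yp y0.
by rewrite sy ltxx.
Qed.

Definition spinor : Type := (CC * CC)%type.
Implicit Types u : spinor.

Definition unit_spinor u := nsq u.1 + nsq u.2 = 1.
Definition hopf u : vec := \col_i
  nth 0 [:: 2 * complex.Re (u.1 * u.2^*%C); 2 * complex.Im (u.1 * u.2^*%C); nsq u.2 - nsq u.1] i.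

Definition X3 (v : vec) := v 0 0.
Definition Y3 (v : vec) := v (lift 0 0) 0.
Definition Z3 (v : vec) := v (lift 0 (lift 0 0)) 0.

Lemma vecP (v w : vec) : X3 v = X3 w -> Y3 v = Y3 w -> Z3 v = Z3 w -> v = w.
Proof.
move=> hx hy hz; apply/matrixP => i j; rewrite (ord1 j).
case: i => -[|[|[|//]]] hi.
- by have -> : Ordinal hi = 0 by exact: val_inj.
- by have -> : Ordinal hi = lift 0 0 by exact: val_inj.
- by have -> : Ordinal hi = lift 0 (lift 0 0) by exact: val_inj.
Qed.

Lemma dotv3 (v w : vec) : dotv v w = X3 v * X3 w + Y3 v * Y3 w + Z3 v * Z3 w.
Proof. by rewrite /dotv !big_ord_recl big_ord0 addr0 addrA. Qed.

Lemma X3h u : X3 (hopf u) = 2 * complex.Re (u.1 * u.2^*%C). Proof. by rewrite /X3 mxE. Qed.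
Lemma Y3h u : Y3 (hopf u) = 2 * complex.Im (u.1 * u.2^*%C). Proof. by rewrite /Y3 mxE. Qed.
Lemma Z3h u : Z3 (hopf u) = nsq u.2 - nsq u.1. Proof. by rewrite /Z3 mxE. Qed.

Lemma hopf_unit u : unit_spinor u -> dotv (hopf u) (hopf u) = 1.
Proof.
move=> h; rewrite dotv3 X3h Y3h Z3h.
transitivity ((nsq u.1 + nsq u.2) ^+ 2); last by rewrite h expr1n.
by case: u {h} => [[a b] [c d]]; rewrite /nsq /=; ring.
Qed.

Definition xy (v : vec) : CC := (X3 v +i* Y3 v)%C.

Lemma xy_hopf u : xy (hopf u) = 2 * (u.1 * u.2^*%C).
Proof.
rewrite /xy X3h Y3h; apply/eqP; rewrite eq_complex.
by case: (u.1 * _) => a b /=; apply/andP; split; apply/eqP; ring.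
Qed.

(* The component of v orthogonal to hopf u, as a complex number in the frame of the tangent
   plane given by the phase of u. *)
Definition Tfun (u : spinor) (v : vec) : CC :=
  u.1 ^+ 2 * (xy v)^*%C + 2 * u.1 * u.2 * (Z3 v)%:C%C - u.2 ^+ 2 * xy v.

(** Pythagoras for the tangential and normal components of v. For unit data, [Tfun] vanishes only if
    the dot product is 1 or -1, that is, if the two lines coincide. *)
Lemma nsq_Tfun u v : nsq (Tfun u v) + dotv (hopf u) v ^+ 2 = (nsq u.1 + nsq u.2) ^+ 2 * dotv v v.
Proof.
rewrite /Tfun !dotv3 X3h Y3h Z3h /xy; move: (X3 v) (Y3 v) (Z3 v) => x y z.
by case: u => [[a b] [c d]]; rewrite /nsq !expr2 /=; ring.
Qed.

Lemma Tfun_neq0 u v : unit_spinor u -> dotv v v = 1 -> lin (hopf u) <> lin v -> Tfun u v != 0.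
Proof.
move=> hu hv hl; apply/eqP => T0; apply: hl.
have := nsq_Tfun u v; rewrite T0 nsq0 hu hv expr1n mulr1 add0r => /eqP.
have h1 := hopf_unit hu.
have eqv (a b : vec) : dotv a a = 1 -> dotv b b = 1 -> dotv a b = 1 -> a = b.
  move=> ha hb hab; apply/eqP; rewrite -subr_eq0; apply/eqP; apply: dotv_eq0.
  by rewrite dotvDl !dotvDr !dotvNl !dotvNr ha hb (dotvC b) hab; lra.
rewrite -(expr1n _ 2) eqf_sqr => /orP[] /eqP h; first by rewrite (eqv _ _ h1 hv h).
by rewrite -(linN v) (eqv (hopf u) (- v)) // ?dotvNl ?dotvNr ?h ?opprK.
Qed.

(** Chosen for its behaviour under [twist k w]: if |k| = 1 and k^2 w = 1, then k w is the conjugate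
    of k, so both terms are multiplied by k. It thus detects k itself, where [Tfun] only sees k^2
    w. *)
Definition Ffun (u : spinor) : CC := u.2^*%C - u.1.
(** Homogeneous of degree q in the phase of u. Requiring a positive value therefore leaves a q-th
    root of unity in each Hopf fibre: away from the zeros, a q-fold covering. *)
Definition Pq (q : nat) (u : spinor) : CC := u.2 ^+ q - u.1 ^+ q.

(* If u.1 is the conjugate of u.2, then Pq q u is purely imaginary. *)
Lemma Ffun_neq0 q u : 0 < Pq q u -> Ffun u != 0.
Proof.
move=> h; apply/eqP => /eqP; rewrite subr_eq0 => /eqP e.
move: h; rewrite /Pq -e; case: u {e} => u1 u2 /=.
have -> : (u2^*%C) ^+ q = (u2 ^+ q)^*%C by rewrite rmorphXn.
by rewrite ltcE; case: (u2 ^+ q) => a b /=; rewrite subrr ltxx andbF.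
Qed.

Definition Rz (a : RR) : mx3 := \matrix_(i, j) nth 0 (nth [::]
  [:: [:: cos a; - sin a; 0]; [:: sin a; cos a; 0]; [:: 0; 0; 1]] i) j.

Lemma mulRz (a : RR) v : [/\ X3 (Rz a *m v) = cos a * X3 v - sin a * Y3 v,
   Y3 (Rz a *m v) = sin a * X3 v + cos a * Y3 v & Z3 (Rz a *m v) = Z3 v].
Proof.
by split; rewrite /X3 /Y3 /Z3 mxE !big_ord_recl big_ord0 !mxE /=; ring.
Qed.

Lemma xy_Rz a v : xy (Rz a *m v) = cis a * xy v.
Proof. by have [hx hy _] := mulRz a v; rewrite /xy hx hy; apply/eqP; rewrite eq_complex /= !eqxx /= addrC. Qed.

Lemma RzD a b : Rz a *m Rz b = Rz (a + b).
Proof.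
apply/matrixP => i j; rewrite mxE !big_ord_recl big_ord0 !mxE trigo.cosD trigo.sinD.
by case: i => -[|[|[|//]]] hi; case: j => -[|[|[|//]]] hj /=; ring.
Qed.
Lemma Rz0 : Rz 0 = 1%:M.
Proof.
apply/matrixP => i j; rewrite !mxE trigo.cos0 trigo.sin0 oppr0.
by case: i => -[|[|[|//]]] hi; case: j => -[|[|[|//]]] hj.
Qed.
Lemma RzT a : (Rz a)^T = Rz (- a).
Proof.
apply/matrixP => i j; rewrite !mxE trigo.cosN trigo.sinN opprK.
by case: i => -[|[|[|//]]] hi; case: j => -[|[|[|//]]] hj.
Qed.

Lemma Rz_turns n : Rz (pi *+ 2 *+ n) = 1%:M.
Proof.
elim: n => [|n IH]; first by rewrite mulr0n Rz0.
rewrite mulrSr -RzD IH mul1mx; apply/matrixP => i j; rewrite !mxE.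
by case: i => -[|[|[|//]]] hi; case: j => -[|[|[|//]]] hj; rewrite /= ?cos2pi ?sin2pi ?oppr0.
Qed.

(** For |k| = 1 and w = e^(-ia) this covers the rotation by a about the z-axis, since u1 times the
    conjugate of u2 is multiplied by e^(ia); k is the free phase of the Hopf fibre. If w is a q-th
    root of unity, [Pq] only feels k^q. *)
Definition twist (k w : CC) u : spinor := (k * u.1, k * w * u.2).

Lemma hopf_twist k a u : nsq k = 1 -> hopf (twist k (cis (- a)) u) = Rz a *m hopf u.
Proof.
move=> hk; have [hx hy hz] := mulRz a (hopf u).
have e : xy (hopf (twist k (cis (- a)) u)) = xy (Rz a *m hopf u).
  rewrite xy_Rz !xy_hopf /= /= !conjM conj_cis opprK.
  have -> : 2 * (k * u.1 * (k^*%C * cis a * (u.2)^*%C)) =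
    (k * k^*%C) * (cis a * (2 * (u.1 * u.2^*%C))) by ring.
  by rewrite unit_conj // mul1r.
move: e => [e1 e2]; apply: vecP => //.
by rewrite hz !Z3h /= !nsqM hk nsq_cis !mul1r.
Qed.

Lemma unit_twist k w u : nsq k = 1 -> nsq w = 1 -> unit_spinor u -> unit_spinor (twist k w u).
Proof. by move=> hk hw; rewrite /unit_spinor /= !nsqM hk hw !mul1r. Qed.

Lemma Tfun_twist k a u v : Tfun (twist k (cis (- a)) u) (Rz a *m v) = k ^+ 2 * cis (- a) * Tfun u v.
Proof.
have [_ _ hz] := mulRz a v.
rewrite /Tfun xy_Rz hz conjM conj_cis [(twist _ _ _).1]/= [(twist _ _ _).2]/=.
have e : cis a * cis (- a) = 1 by rewrite -cisD subrr cis0.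
have -> : (k * cis (- a) * u.2) ^+ 2 * (cis a * xy v) = (cis a * cis (- a)) * (k ^+ 2 * cis (- a) * (u.2 ^+ 2 * xy v)) by ring.
by rewrite e; ring.
Qed.

Lemma Ffun_twist k w u : nsq k = 1 -> k ^+ 2 * w = 1 -> Ffun (twist k w u) = k * Ffun u.
Proof.
move=> hk hw; rewrite /Ffun /= !conjM.
have -> : k^*%C * w^*%C = k.
  have : (k ^+ 2 * w)^*%C = 1 by rewrite hw conjc1.
  rewrite expr2 !conjM => h.
  have -> : k^*%C * w^*%C = k * k^*%C * (k^*%C * w^*%C) by rewrite unit_conj // mul1r.
  by rewrite -[RHS]mulr1 -h; ring.
by rewrite mulrBr.
Qed.

(** The Hopf image and the norm determine all products of a component of u with the conjugate of a
    component. Hence u is its Hermitian product k with w, times w. *)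
Lemma hopf_inj u (w : spinor) : unit_spinor u -> unit_spinor w -> hopf u = hopf w ->
  exists2 k, nsq k = 1 & u = (k * w.1, k * w.2).
Proof.
move=> hu hw e.
have e3 : nsq u.2 = nsq w.2 /\ nsq u.1 = nsq w.1.
  have : Z3 (hopf u) = Z3 (hopf w) by rewrite e.
  rewrite !Z3h; move: hu hw; rewrite /unit_spinor; lra.
have e12 : u.1 * u.2^*%C = w.1 * w.2^*%C.
  have : xy (hopf u) = xy (hopf w) by rewrite e.
  by rewrite !xy_hopf => h; apply: (@mulfI _ 2) h; rewrite pnatr_eq0.
have e21 : u.2 * u.1^*%C = w.2 * w.1^*%C.
  have := congr1 conjc e12; rewrite !conjM !conjcK => h.
  by rewrite mulrC h mulrC.
have e11 : u.1 * u.1^*%C = w.1 * w.1^*%C by rewrite !mul_conj e3.2.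
have e22 : u.2 * u.2^*%C = w.2 * w.2^*%C by rewrite !mul_conj e3.1.
pose k := u.1 * w.1^*%C + u.2 * w.2^*%C.
have one (z : spinor) : unit_spinor z -> z.1 * z.1^*%C + z.2 * z.2^*%C = 1.
  by move=> hz; rewrite !mul_conj -rmorphD hz.
have k1 : k * w.1 = u.1.
  have -> : k * w.1 = u.1 * (w.1 * w.1^*%C) + u.2 * (w.1 * w.2^*%C) by rewrite /k; ring.
  rewrite -e11 -e12 -[RHS]mulr1 -(one u hu); ring.
have k2 : k * w.2 = u.2.
  have -> : k * w.2 = u.1 * (w.2 * w.1^*%C) + u.2 * (w.2 * w.2^*%C) by rewrite /k; ring.
  rewrite -e21 -e22 -[RHS]mulr1 -(one u hu); ring.
exists k; last by rewrite k1 k2; case: (u).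
by move: hu; rewrite /unit_spinor -k1 -k2 !nsqM -mulrDr hw mulr1.
Qed.

Lemma Pq_scale q k u : Pq q (k * u.1, k * u.2) = k ^+ q * Pq q u.
Proof. by rewrite /Pq /= !exprMn mulrBr. Qed.

Lemma Pq_twist q k w u : w ^+ q = 1 -> Pq q (twist k w u) = k ^+ q * Pq q u.
Proof. by move=> h; rewrite /Pq /= !exprMn h mulr1 mulrBr. Qed.

(** Equal q-th powers give |u1| = |u2|, so 2 |u2|^2 = 1; and replacing u1^q by u2^q turns the q-th
    power of 2 u1 conj(u2) into that of 2 |u2|^2. *)
Lemma Pq_eq0 q u : (0 < q)%N -> unit_spinor u -> Pq q u = 0 ->
  Z3 (hopf u) = 0 /\ xy (hopf u) ^+ q = 1.
Proof.
move=> q0 hu /eqP; rewrite subr_eq0 => /eqP e.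
have en : nsq u.2 = nsq u.1.
  by apply/eqP; rewrite -(@eqrXn2 _ q) ?nsq_ge0 // -!nsqX e.
split; first by rewrite Z3h en subrr.
rewrite xy_hopf !exprMn -e -exprMn mul_conj.
have h2 : 2 * nsq u.2 = 1 by move: hu; rewrite /unit_spinor en; lra.
have -> : (nsq u.2)%:C%C = 2^-1 :> CC.
  have -> : nsq u.2 = 2^-1 by lra.
  by rewrite fmorphV rmorph_nat.
by rewrite -exprMn mulfV ?expr1n // pnatr_eq0.
Qed.

Definition ccts (T : topologicalType) (f : T -> CC) : Prop :=
  cts (fun t => complex.Re (f t)) /\ cts (fun t => complex.Im (f t)).

Local Notation ccts2 f := (ccts (fun p : RR * RR => f p.1 p.2)).

Section Ccts.
Variable T : topologicalType.
Implicit Types f g : T -> CC.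

Lemma ccts_cst (z : CC) : ccts (fun _ : T => z).
Proof. by split; exact: cts_cst. Qed.
Lemma ReD (z w : CC) : complex.Re (z + w) = complex.Re z + complex.Re w.
Proof. by case: z => a b; case: w. Qed.
Lemma ImD (z w : CC) : complex.Im (z + w) = complex.Im z + complex.Im w.
Proof. by case: z => a b; case: w. Qed.
Lemma ReM (z w : CC) : complex.Re (z * w) = complex.Re z * complex.Re w - complex.Im z * complex.Im w.
Proof. by case: z => a b; case: w. Qed.
Lemma ImM (z w : CC) : complex.Im (z * w) = complex.Re z * complex.Im w + complex.Im z * complex.Re w.
Proof. by case: z => a b; case: w. Qed.
Lemma ReN (z : CC) : complex.Re (- z) = - complex.Re z. Proof. by case: z. Qed.
Lemma ImN (z : CC) : complex.Im (- z) = - complex.Im z. Proof. by case: z. Qed.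
Lemma ReJ (z : CC) : complex.Re z^*%C = complex.Re z. Proof. by case: z. Qed.
Lemma ImJ (z : CC) : complex.Im z^*%C = - complex.Im z. Proof. by case: z. Qed.

Lemma cctsD f g : ccts f -> ccts g -> ccts (fun t => f t + g t).
Proof.
move=> [f1 f2] [g1 g2]; split.
  by under eq_fun do rewrite ReD; exact: ctsD.
by under eq_fun do rewrite ImD; exact: ctsD.
Qed.
Lemma cctsN f : ccts f -> ccts (fun t => - f t).
Proof.
move=> [f1 f2]; split.
  by under eq_fun do rewrite ReN; exact: ctsN.
by under eq_fun do rewrite ImN; exact: ctsN.
Qed.
Lemma cctsB f g : ccts f -> ccts g -> ccts (fun t => f t - g t).
Proof. by move=> cf cg; apply: cctsD => //; exact: cctsN. Qed.
Lemma cctsM f g : ccts f -> ccts g -> ccts (fun t => f t * g t).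
Proof.
move=> [f1 f2] [g1 g2]; split.
  by under eq_fun do rewrite ReM; apply: ctsB; exact: ctsM.
by under eq_fun do rewrite ImM; apply: ctsD; exact: ctsM.
Qed.
Lemma cctsJ f : ccts f -> ccts (fun t => (f t)^*%C).
Proof.
move=> [f1 f2]; split.
  by under eq_fun do rewrite ReJ.
by under eq_fun do rewrite ImJ; exact: ctsN.
Qed.
Lemma cctsX f n : ccts f -> ccts (fun t => f t ^+ n).
Proof.
move=> cf; elim: n => [|n IH]; first exact: ccts_cst.
by under eq_fun do rewrite exprS; exact: cctsM.
Qed.
Lemma ccts_mk (a b : T -> RR) : cts a -> cts b -> ccts (fun t => (a t +i* b t)%C).
Proof. by []. Qed.
Lemma ccts_cis (a : T -> RR) : cts a -> ccts (fun t => cis (a t)).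
Proof. by move=> ca; apply: ccts_mk; [exact: cts_cos|exact: cts_sin]. Qed.
Lemma cts_nsq f : ccts f -> cts (fun t => nsq (f t)).
Proof. by move=> [f1 f2]; apply: ctsD; exact: ctsX. Qed.
Lemma mcts_hopf (u : T -> spinor) : ccts (fun t => (u t).1) -> ccts (fun t => (u t).2) ->
  mcts (fun t => hopf (u t)).
Proof.
move=> c1 c2 i j; under eq_fun do rewrite mxE.
have [k1 k2] := cctsM c1 (cctsJ c2).
case: i => -[|[|[|//]]] hi /=.
- by apply: ctsM => //; exact: cts_cst.
- by apply: ctsM => //; exact: cts_cst.
- by apply: ctsB; exact: cts_nsq.
Qed.
Lemma ccts_xy (v : T -> vec) : mcts v -> ccts (fun t => xy (v t)).
Proof. by move=> cv; apply: ccts_mk; exact: cv. Qed.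
End Ccts.

Lemma ccts_precomp (T U : topologicalType) (g : U -> T) (f : T -> CC) :
  continuous g -> ccts f -> ccts (fun t => f (g t)).
Proof.
move=> cg [c1 c2]; split.
  exact: (cts_precomp (f := fun t => complex.Re (f t)) cg c1).
exact: (cts_precomp (f := fun t => complex.Im (f t)) cg c2).
Qed.

Lemma cis_nsq (z : CC) : z != 0 -> exists2 h, z = (Num.sqrt (nsq z))%:C%C * cis h & 0 < Num.sqrt (nsq z).
Proof.
move=> z0; have p : 0 < Num.sqrt (nsq z) by rewrite sqrtr_gt0 nsq_gt0.
have [h e] : exists h, z * ((Num.sqrt (nsq z))^-1)%:C%C = cis h.
  apply: cis_ex; rewrite nsqM {2}/nsq /= expr0n addr0 exprVn sqr_sqrtr ?nsq_ge0 //.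
  by rewrite divff // nsq_eq0.
exists h => //; rewrite -e mulrCA -rmorphM /= divff ?gt_eqF // mulr1 //.
Qed.

Lemma arg_lift (f : RR -> RR -> CC) (h0 r0 : RR) :
  ccts2 f -> (forall s t, f s t != 0) ->
  (forall s t, f (cl s) (cl t) = f s t) ->
  0 < r0 -> f 0 0 = r0%:C%C * cis h0 ->
  exists h : RR -> RR -> RR,
    [/\ cts2 h,
        forall s t, f s t = (Num.sqrt (nsq (f s t)))%:C%C * cis (h s t), h 0 0 = h0 &
        forall s t, h (cl s) (cl t) = h s t].
Proof.
move=> [c1 c2] f0 fcl r0p e0.
pose n s t := (Num.sqrt (nsq (f s t)))^-1.
have np s t : 0 < n s t by rewrite invr_gt0 sqrtr_gt0 nsq_gt0.
have cn : cts2 n.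
  apply: ctsV; first by apply: cts_sqrt; apply: cts_nsq.
  by move=> x; rewrite gt_eqF // sqrtr_gt0 nsq_gt0.
have n1E s t : n s t ^+ 2 * nsq (f s t) = 1.
  by rewrite exprVn sqr_sqrtr ?nsq_ge0 // mulVf // nsq_eq0.
have ab s t : (n s t * complex.Re (f s t)) ^+ 2 + (n s t * complex.Im (f s t)) ^+ 2 = 1.
  by rewrite -(n1E s t) /nsq; ring.
have rn : r0 * n 0 0 = 1.
  rewrite /n e0 nsqM nsq_cis mulr1 {1}/nsq /= expr0n addr0 sqrtr_sqr ger0_norm ?ltW //.
  by rewrite divff // gt_eqF.
have [] := @angle_lift (fun s t => n s t * complex.Re (f s t)) (fun s t => n s t * complex.Im (f s t)) h0
  (ctsM cn c1) (ctsM cn c2) ab.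
- by rewrite e0 /= mul0r subr0 mulrCA mulrA rn mul1r.
- by rewrite e0 /= mul0r addr0 mulrCA mulrA rn mul1r.
move=> h [ch hc hs h00 hcl]; exists h; split => // s t.
have ncl : n (cl s) (cl t) = n s t by rewrite /n fcl.
have := hc s t; have := hs s t; rewrite ncl fcl /cis => <- <-.
have e : Num.sqrt (nsq (f s t)) * n s t = 1.
  by rewrite /n divff // gt_eqF // sqrtr_gt0 nsq_gt0.
apply/eqP; rewrite eq_complex /= !mul0r subr0 addr0.
by rewrite (mulrA _ (n s t) (complex.Re _)) (mulrA _ (n s t) (complex.Im _)) e !mul1r !eqxx.
Qed.

(* Up to a positive factor, the spinor over v for which u.2 - u.1 is positive. *)
Definition gauge (v : vec) : spinor :=
  (((X3 v - 1 + Z3 v) +i* Y3 v)%C, ((1 - X3 v + Z3 v) +i* Y3 v)%C).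

Lemma gauge_spec v : dotv v v = 1 -> X3 v != 1 ->
  let n := Num.sqrt (4 * (1 - X3 v)) in
  [/\ 0 < n, unit_spinor ((n^-1)%:C%C * (gauge v).1, (n^-1)%:C%C * (gauge v).2) &
      hopf ((n^-1)%:C%C * (gauge v).1, (n^-1)%:C%C * (gauge v).2) = v].
Proof.
rewrite dotv3 => hv hx n.
have xlt : X3 v < 1.
  rewrite lt_neqAle hx /= leNgt; apply/negP => h.
  have h1 := sqr_ge0 (Y3 v); have h2 := sqr_ge0 (Z3 v); rewrite !expr2 in h1 h2.
  have : X3 v * X3 v <= 1 by lra.
  by apply/negP; rewrite -ltNge; nra.
have d0 : 0 < 4 * (1 - X3 v) by lra.
have np : 0 < n by rewrite sqrtr_gt0.
have n2 : n ^+ 2 = 4 * (1 - X3 v) by rewrite sqr_sqrtr // ltW.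
have n2V : (n^-1) ^+ 2 = (4 * (1 - X3 v))^-1 by rewrite exprVn n2.
have nsqc (a : RR) : nsq a%:C%C = a ^+ 2 by rewrite /nsq /= expr0n addr0.
have hyz : Y3 v * Y3 v + Z3 v * Z3 v = 1 - X3 v * X3 v by lra.
split=> //.
  rewrite /unit_spinor /= !nsqM nsqc -mulrDr n2V.
  have -> : nsq (gauge v).1 + nsq (gauge v).2 = 4 * (1 - X3 v).
    rewrite /nsq /=; transitivity (2 * (1 - X3 v) ^+ 2 + 2 * (Y3 v * Y3 v + Z3 v * Z3 v)); first by ring.
    by rewrite hyz; ring.
  by rewrite mulVf // gt_eqF.
have e12 : xy (hopf ((n^-1)%:C%C * (gauge v).1, (n^-1)%:C%C * (gauge v).2)) = xy v.
  rewrite xy_hopf; cbn [fst snd]; rewrite conjM conjc_real.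
  have -> : 2 * ((n^-1)%:C%C * (gauge v).1 * ((n^-1)%:C%C * ((gauge v).2)^*%C)) =
    ((n^-1) ^+ 2)%:C%C * (2 * ((gauge v).1 * ((gauge v).2)^*%C)) :> CC.
    by rewrite expr2 rmorphM /=; ring.
  have -> : 2 * ((gauge v).1 * ((gauge v).2)^*%C) = (4 * (1 - X3 v))%:C%C * xy v.
    rewrite mulr2n mulrDl mul1r; apply/eqP; rewrite eq_complex /=; apply/andP; split; apply/eqP; last by ring.
    transitivity (- 2 * (1 - X3 v) ^+ 2 + 2 * (Y3 v * Y3 v + Z3 v * Z3 v)); first by ring.
    by rewrite hyz; ring.
  by rewrite mulrA -rmorphM /= n2V mulVf ?gt_eqF // mul1r.
case: e12 => ex ey; apply: vecP => //.
rewrite Z3h /= !nsqM nsqc -mulrBr n2V.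
have -> : nsq (gauge v).2 - nsq (gauge v).1 = (4 * (1 - X3 v)) * Z3 v by rewrite /nsq /=; ring.
by rewrite mulrA mulVf ?gt_eqF // mul1r.
Qed.

Lemma unit_scale k u : nsq k = 1 -> unit_spinor u -> unit_spinor (k * u.1, k * u.2).
Proof. by move=> hk; rewrite /unit_spinor /= !nsqM hk !mul1r. Qed.

(** The normalised gauge w is a continuous spinor lift with [Pq q w] nonzero. If h is a continuous
    argument of [Pq q w], multiplying w by e^(-ih/q) makes [Pq] positive. *)
Lemma spinor_lift q (v : RR -> RR -> vec) (u0 : spinor) :
  (0 < q)%N -> mcts2 v -> (forall s t, dotv (v s t) (v s t) = 1) ->
  (forall s t, v (cl s) (cl t) = v s t) ->
  (forall s t, ~ (Z3 (v s t) = 0 /\ xy (v s t) ^+ q = 1)) ->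
  unit_spinor u0 -> hopf u0 = v 0 0 -> 0 < Pq q u0 ->
  exists u : RR -> RR -> spinor,
  [/\ ccts (fun p : RR * RR => (u p.1 p.2).1), ccts (fun p : RR * RR => (u p.1 p.2).2),
      forall s t, [/\ unit_spinor (u s t), hopf (u s t) = v s t & 0 < Pq q (u s t)],
      u 0 0 = u0 & forall s t, u (cl s) (cl t) = u s t].
Proof.
move=> q0 cv v1 vcl vav u01 e0 P0.
(* The gauge breaks down only at X3 = 1, and this vector is itself excluded, 1 being a q-th root of
   unity. *)
have x1 s t : X3 (v s t) != 1.
  apply/eqP => hx; apply: (vav s t).
  have := v1 s t; rewrite dotv3 hx mulr1 => h.
  have hy : Y3 (v s t) = 0.
    apply/eqP; rewrite -sqrf_eq0; have := sqr_ge0 (Y3 (v s t)); have := sqr_ge0 (Z3 (v s t)).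
    by rewrite !expr2 => h1 h2; apply/eqP; lra.
  have hz : Z3 (v s t) = 0.
    apply/eqP; rewrite -sqrf_eq0; have := sqr_ge0 (Y3 (v s t)); have := sqr_ge0 (Z3 (v s t)).
    by rewrite !expr2 => h1 h2; apply/eqP; lra.
  by split=> //; rewrite /xy hx hy -[(1 +i* 0)%C]/(1 : CC) expr1n.
pose n s t := Num.sqrt (4 * (1 - X3 (v s t))).
pose w s t : spinor := (((n s t)^-1)%:C%C * (gauge (v s t)).1, ((n s t)^-1)%:C%C * (gauge (v s t)).2).
have W s t : [/\ 0 < n s t, unit_spinor (w s t) & hopf (w s t) = v s t] by exact: gauge_spec.
have cX : cts (fun p : RR * RR => X3 (v p.1 p.2)) by exact: cv.
have cY : cts (fun p : RR * RR => Y3 (v p.1 p.2)) by exact: cv.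
have cZ : cts (fun p : RR * RR => Z3 (v p.1 p.2)) by exact: cv.
have cn : ccts (fun p : RR * RR => ((n p.1 p.2)^-1)%:C%C).
  apply: ccts_mk; last exact: cts_cst.
  apply: ctsV; last by move=> x; have [/lt0r_neq0] := W x.1 x.2.
  by apply: cts_sqrt; apply: ctsM; [exact: cts_cst|apply: ctsB => //; exact: cts_cst].
have cw1 : ccts (fun p : RR * RR => (w p.1 p.2).1).
  apply: cctsM => //; apply: ccts_mk => //.
  by apply: ctsD => //; apply: ctsB => //; exact: cts_cst.
have cw2 : ccts (fun p : RR * RR => (w p.1 p.2).2).
  apply: cctsM => //; apply: ccts_mk => //.
  by apply: ctsD => //; apply: ctsB => //; exact: cts_cst.
have wcl s t : w (cl s) (cl t) = w s t by rewrite /w /n vcl.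
have wP s t : Pq q (w s t) != 0.
  have [_ w1 hw] := W s t; apply/eqP => h; apply: (vav s t); rewrite -hw.
  exact: Pq_eq0 q0 w1 h.
have cP : ccts (fun p : RR * RR => Pq q (w p.1 p.2)) by apply: cctsB; exact: cctsX.
have [_ w01 hw0] := W 0 0.
have [k k1 ek] := hopf_inj u01 w01 (etrans e0 (esym hw0)).
have [b kb] := cis_ex k1.
(* Since u0 = e^(ib) w (0, 0) and [Pq q u0] is positive, - q b is an argument at the corner;
   starting h there makes the lift start at u0. *)
have Pw0 : Pq q (w 0 0) = (Num.sqrt (nsq (Pq q (w 0 0))))%:C%C * cis (- (b *+ q)).
  have e : Pq q u0 = cis (b *+ q) * Pq q (w 0 0).
    by rewrite {1}ek kb Pq_scale cisMn.
  have r0 : exists r : RR, Pq q u0 = r%:C%C.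
    move: P0; rewrite ltcE /= => /andP[/eqP + _]; case: (Pq q u0) => x y /= ->; by exists x.
  have [r er] := r0; have rp : 0 < r by move: P0; rewrite er ltcR.
  have ew : Pq q (w 0 0) = r%:C%C * cis (- (b *+ q)).
    by rewrite -er e mulrAC -cisD subrr cis0 mul1r.
  rewrite {2}ew nsqM nsq_cis mulr1 [X in Num.sqrt X](_ : _ = r ^+ 2); last first.
    by rewrite /nsq /= expr0n addr0.
  by rewrite sqrtr_sqr gtr0_norm.
have sp : 0 < Num.sqrt (nsq (Pq q (w 0 0))) by rewrite sqrtr_gt0 nsq_gt0.
have Pcl s t : Pq q (w (cl s) (cl t)) = Pq q (w s t) by rewrite wcl.
have [h [ch hP h0 hcl]] := arg_lift cP wP Pcl sp Pw0.
have qn0 : q%:R != 0 :> RR by rewrite pnatr_eq0 -lt0n.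
pose c s t := cis (- (h s t / q%:R)).
have cc : ccts2 c.
  by apply: ccts_cis; apply: ctsN; apply: ctsM => //; exact: cts_cst.
have cq s t : c s t ^+ q = cis (- h s t).
  by rewrite -cisMn mulNrn -(mulr_natr (h s t / q%:R)) divfK.
have c1 s t : nsq (c s t) = 1 by exact: nsq_cis.
exists (fun s t => (c s t * (w s t).1, c s t * (w s t).2)); split.
- exact: cctsM.
- exact: cctsM.
- move=> s t; have [_ w1 hw] := W s t; split.
  + exact: unit_scale.
  + rewrite -hw -[RHS]mul1mx -Rz0 -(hopf_twist 0 _ (c1 s t)) oppr0 cis0.
    by rewrite /twist mulr1.
  rewrite Pq_scale cq hP mulrCA -cisD addNr cis0 mulr1 ltcR sqrtr_gt0 nsq_gt0 //.
- rewrite /c h0 mulNr opprK -(mulr_natr b) mulfK // -kb; exact: esym.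
- by move=> s t; rewrite /c hcl wcl.
Qed.

(** Otherwise the intermediate value theorem yields a half-integer value. All uniqueness statements
    for lifts are reduced to this. *)
Lemma cts_int_const (f : RR -> RR) : cts f -> (forall t, exists k : int, f t = k%:~R) ->
  forall t t', f t = f t'.
Proof.
move=> cf fint.
have step a b : a < b -> f a <> f b -> False.
  move=> ab fab.
  have cw : {within `[a, b], continuous f} by apply: continuous_subspaceT => x; exact: cf.
  have [k ka] := fint a; have [l lb] := fint b.
  pose m := Num.min k l.
  have kl : k != l by apply/eqP => e; apply: fab; rewrite ka lb e.
  have [c _ hc] : exists2 c, c \in `[a, b] & f c = m%:~R + 2^-1.
    apply: (IVT (ltW ab) cw); rewrite ka lb /m.
    have [h|h] := ltP k l.
      have h1 : k%:~R + 1 <= l%:~R :> RR by rewrite -[1]/(1%:~R) -intrD ler_int; lia.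
      by rewrite min_l ?max_r; lra.
    have h' : l < k by rewrite lt_def kl.
    have h1 : l%:~R + 1 <= k%:~R :> RR by rewrite -[1]/(1%:~R) -intrD ler_int; lia.
    by rewrite min_r ?max_l; lra.
  have [n hn] := fint c.
  have e : (2 * n)%:~R = (2 * m + 1)%:~R :> RR.
    by rewrite !intrD !intrM -hn hc; lra.
  have : 2 * n = 2 * m + 1 by apply/eqP; rewrite -(eqr_int RR) e.
  lia.
move=> t t'; apply: contrapT => h; have [tt|tt|tt] := ltgtP t t'.
- exact: (step _ _ tt h).
- by apply: (step _ _ tt) => e; apply: h.
- by apply: h; rewrite tt.
Qed.

Lemma neqN11 : (-1 : RR) <> 1.
Proof. by move=> h; lra. Qed.

(** * Lifts of a pair of moving lines and their uniqueness *)

Definition Ed : Type := (spinor * vec * RR)%type.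

Definition ects (T : topologicalType) (e : T -> Ed) : Prop :=
  [/\ ccts (fun t => (e t).1.1.1), ccts (fun t => (e t).1.1.2), mcts (fun t => (e t).1.2) &
      cts (fun t => (e t).2)].

Section Lifts.
Variables (q : nat) (Phi : spinor -> vec -> CC).

(* A fibre of the covering: a spinor over a sphere lift of the line y1 on which the
   q-th power difference is positive, a sphere lift of y2, and an argument of Phi. *)
Definition over (y1 y2 : mx3) (e : Ed) : Prop :=
  [/\ unit_spinor e.1.1, 0 < Pq q e.1.1, y1 = lin (hopf e.1.1),
      dotv e.1.2 e.1.2 = 1 /\ y2 = lin e.1.2 &
      exists2 r : RR, 0 < r & Phi e.1.1 e.1.2 = r%:C%C * cis e.2].

Definition lifts (T : topologicalType) (y1 y2 : T -> mx3) (e : T -> Ed) : Prop :=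
  ects e /\ forall t, over (y1 t) (y2 t) (e t).

(** What a continuous argument of Phi along a lift requires. For [Tfun], nonvanishing comes from the
    two lines being distinct; for [Ffun], from the positivity of [Pq]. *)
Definition admissible : Prop :=
  (forall (T : topologicalType) (u : T -> spinor) (v : T -> vec),
     ccts (fun t => (u t).1) -> ccts (fun t => (u t).2) -> mcts v -> ccts (fun t => Phi (u t) (v t))) /\
  (forall u v, unit_spinor u -> 0 < Pq q u -> dotv v v = 1 -> lin (hopf u) <> lin v -> Phi u v != 0).

Lemma lin_sign (v w : vec) : dotv v v = 1 -> dotv w w = 1 -> lin v = lin w ->
  (v = w /\ dotv v w = 1) \/ (v = - w /\ dotv v w = -1).
Proof.
move=> hv hw /(lin_inj hv) [c ->]; rewrite hw mulr1 => /eqP.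
rewrite sqrf_eq1 => /orP[] /eqP ->; [left|right];
  by rewrite ?scaleN1r ?scale1r ?dotvNl hw.
Qed.

(** Two unit vectors on one line have dot product 1 or -1, which is an integer and so cannot change
    continuously. *)
Lemma sphere_uniq (v w : RR -> vec) : mcts v -> mcts w ->
  (forall t, dotv (v t) (v t) = 1) -> (forall t, dotv (w t) (w t) = 1) ->
  (forall t, lin (v t) = lin (w t)) -> forall t0 t, v t0 = w t0 -> v t = w t.
Proof.
move=> cv cw hv hw e t0 t e0.
have cd : cts (fun t => dotv (v t) (w t)) by exact: cts_dotv.
have hint x : exists k : int, dotv (v x) (w x) = k%:~R.
  by have [[_ ->]|[_ ->]] := lin_sign (hv x) (hw x) (e x); [exists 1|exists (-1)].
have h := cts_int_const cd hint t t0; rewrite e0 hw in h.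
have [[]|[_ h']] // := lin_sign (hv t) (hw t) (e t).
by case: neqN11; rewrite -h' h.
Qed.

Lemma cis_inj_int (a b : RR) : cis a = cis b -> exists k : int, (a - b) / (pi *+ 2) = k%:~R.
Proof.
move=> e; have : cis (a - b) = 1 by rewrite cisD e -cisD subrr cis0.
move=> /cis_eq1 [k ->]; exists k; rewrite mulfK //.
by rewrite mulrn_eq0 /= gt_eqF // pi_gt0.
Qed.

Lemma real_cis_inj (r r' a b : RR) : 0 < r -> 0 < r' -> r%:C%C * cis a = r'%:C%C * cis b ->
  r = r' /\ cis a = cis b.
Proof.
move=> rp rp' e.
have e1 : r = r'.
  have := congr1 nsq e; rewrite !nsqM !nsq_cis !mulr1 /nsq /= !expr0n !addr0 => /eqP.
  by rewrite eqrXn2 ?ltW // => /eqP.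
split=> //; move: e; rewrite e1 => /mulfI; apply.
by rewrite eq_complex /= negb_and gt_eqF.
Qed.

(** Both spinors lie in one Hopf fibre and differ by a phase k; positivity of both [Pq] forces k^q =
    1. A continuous angle of k, times q, is then an integral multiple of 2 pi and therefore
    constant. *)
Lemma spinor_uniq (u w : RR -> spinor) : (0 < q)%N ->
  ccts (fun t => (u t).1) -> ccts (fun t => (u t).2) ->
  ccts (fun t => (w t).1) -> ccts (fun t => (w t).2) ->
  (forall t, unit_spinor (u t)) -> (forall t, unit_spinor (w t)) ->
  (forall t, 0 < Pq q (u t)) -> (forall t, 0 < Pq q (w t)) ->
  (forall t, hopf (u t) = hopf (w t)) ->
  forall t0 t, I01 t0 -> I01 t -> u t0 = w t0 -> u t = w t.
Proof.
move=> q0 cu1 cu2 cw1 cw2 hu hw pu pw e t0 t It0 It e0.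
pose k t := (u t).1 * ((w t).1)^*%C + (u t).2 * ((w t).2)^*%C.
have kP x : [/\ nsq (k x) = 1, u x = (k x * (w x).1, k x * (w x).2) & k x ^+ q = 1].
  have [z z1 ez] := hopf_inj (hu x) (hw x) (e x).
  have kz : k x = z.
    rewrite /k ez /= -!mulrA -mulrDr !mul_conj -rmorphD /=.
    by have -> := hw x; rewrite mulr1.
  rewrite kz; split => //.
  have := pu x; rewrite ez Pq_scale; have := pw x.
  set p := Pq q (w x) => pp; rewrite pmulr_lgt0 // => zq.
  have zz : nsq (z ^+ q) = 1 by rewrite nsqX z1 expr1n.
  move: zq zz; rewrite ltcE; case: (z ^+ q) => a b /= /andP[/eqP -> a0].
  rewrite /nsq /= expr0n addr0 => /eqP; rewrite sqrp_eq1 ?ltW // => /eqP -> //.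
have ck : ccts k by apply: cctsD; apply: cctsM => //; exact: cctsJ.
have [c1 c2] := ck.
have ab (s x : RR) : complex.Re (k x) ^+ 2 + complex.Im (k x) ^+ 2 = 1 by have [] := kP x.
have [b0 eb0] := cis_ex (let: And3 h _ _ := kP 0 in h).
have [] := @angle_lift (fun s x => complex.Re (k x)) (fun s x => complex.Im (k x)) b0
  (cts_snd c1) (cts_snd c2) ab; rewrite ?eb0 //.
move=> b [cb hc hs _ _].
have kb x : I01 x -> k x = cis (b 0 x).
  move=> Ix; have := hc 0 x; have := hs 0 x; rewrite cl_id // /cis => <- <-.
  by case: (k x).
have cb0 : cts (fun x => b 0 (cl x) *+ q / (pi *+ 2)).
  apply: ctsM; last exact: cts_cst.
  have -> : (fun x => b 0 (cl x) *+ q) = (fun x => b 0 (cl x) * q%:R).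
    by apply/funext => x; rewrite mulr_natr.
  apply: ctsM; last exact: cts_cst.
  by apply: (cts_comp2 (F := b)) => //; [exact: cts_cst|apply: cts_cl; exact: cts_id].
have bint x : exists j : int, b 0 (cl x) *+ q / (pi *+ 2) = j%:~R.
  rewrite -[b 0 (cl x) *+ q]subr0; apply: cis_inj_int.
  rewrite cisMn -kb; last exact: cl_I.
  by rewrite cis0; have [_ _ ->] := kP (cl x).
have := cts_int_const cb0 bint t t0; rewrite !cl_id // => /mulIf h.
have {}h : b 0 t = b 0 t0.
  have := h _; rewrite invr_eq0 mulrn_eq0 /= gt_eqF ?pi_gt0 // => /(_ isT).
  by move=> /eqP; rewrite eqr_pMn2r // => /eqP.
have kt : k t = k t0 by rewrite !kb // h.
have k0 : k t0 = 1.
  by rewrite /k e0 !mul_conj -rmorphD /=; have -> := hw t0.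
have [_ -> _] := kP t; rewrite kt k0 !mul1r; by case: (w t).
Qed.

(** The ambiguities of a lift are signs of the two vectors, a q-th root of unity for the spinor and
    a multiple of 2 pi for the argument: all discrete. *)
Lemma lifts_uniq (y1 y2 : RR -> mx3) (e e' : RR -> Ed) : (0 < q)%N -> lifts y1 y2 e -> lifts y1 y2 e' ->
  forall t0 t, I01 t0 -> I01 t -> e t0 = e' t0 -> e t = e' t.
Proof.
move=> q0 [[c1 c2 c3 c4] h] [[c1' c2' c3' c4'] h'] t0 t It0 It e0.
have ev x : (e x).1.2 = (e' x).1.2.
  apply: (sphere_uniq c3 c3') (congr1 (fun z : Ed => z.1.2) e0).
  - by move=> y; have [_ _ _ []] := h y.
  - by move=> y; have [_ _ _ []] := h' y.
  by move=> y; have [_ _ _ [_ <-]] := h y; have [_ _ _ [_ <-]] := h' y.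
have eh x : hopf (e x).1.1 = hopf (e' x).1.1.
  apply: (sphere_uniq (mcts_hopf c1 c2) (mcts_hopf c1' c2')) (congr1 (fun z : Ed => hopf z.1.1) e0).
  - by move=> y; have [k _ _ _ _] := h y; exact: hopf_unit.
  - by move=> y; have [k _ _ _ _] := h' y; exact: hopf_unit.
  by move=> y; have [_ _ <- _ _] := h y; have [_ _ <- _ _] := h' y.
have eu x : I01 x -> (e x).1.1 = (e' x).1.1.
  move=> Ix; apply: (spinor_uniq (u := fun x => (e x).1.1) (w := fun x => (e' x).1.1) q0
    c1 c2 c1' c2' _ _ _ _ eh It0 Ix (congr1 (fun z : Ed => z.1.1) e0)).
  - by move=> y; have [] := h y.
  - by move=> y; have [] := h' y.
  - by move=> y; have [] := h y.
  - by move=> y; have [] := h' y.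
have eH : (e t).2 = (e' t).2.
  have cd : cts (fun x => ((e (cl x)).2 - (e' (cl x)).2) / (pi *+ 2)).
    apply: ctsM; last exact: cts_cst.
    have ccl : continuous (cl : RR -> RR) by apply: cts_cl; exact: cts_id.
    apply: ctsB; first exact: (cts_precomp ccl c4).
    exact: (cts_precomp ccl c4').
  have dint x : exists k : int, ((e (cl x)).2 - (e' (cl x)).2) / (pi *+ 2) = k%:~R.
    apply: cis_inj_int.
    have [_ _ _ _ [r rp er]] := h (cl x); have [_ _ _ _ [r' rp' er']] := h' (cl x).
    have [] // := @real_cis_inj r r' (e (cl x)).2 (e' (cl x)).2 rp rp'.
    by rewrite -er -er' ev eu //; exact: cl_I.
  have := cts_int_const cd dint t t0; rewrite !cl_id // e0 subrr mul0r => /eqP.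
  by rewrite mulf_eq0 invr_eq0 mulrn_eq0 /= (gt_eqF (pi_gt0 _)) orbF subr_eq0 => /eqP.
have {}eu := eu t It; have {}ev := ev t.
by move: eu ev eH; case: (e t) => [[? ?] ?]; case: (e' t) => [[? ?] ?] /= -> -> ->.
Qed.

(** The avoidance hypothesis concerns the sphere lift and not the line: for odd q, each base line
    carries one branch vector and one harmless antipode. [loop_closed] relies on this distinction
    when its first point reaches a base line. *)
Lemma lift_square (Q1 Q2 : RR -> RR -> mx3) (e0 : Ed) :
  (0 < q)%N -> admissible ->
  mcts2 Q1 -> mcts2 Q2 ->
  (forall s t, RP2 (Q1 s t)) -> (forall s t, RP2 (Q2 s t)) ->
  (forall s t, Q1 (cl s) (cl t) = Q1 s t) -> (forall s t, Q2 (cl s) (cl t) = Q2 s t) ->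
  (forall s t, Q1 s t <> Q2 s t) ->
  (forall v : RR -> RR -> vec, mcts2 v ->
     (forall s t, dotv (v s t) (v s t) = 1) -> (forall s t, Q1 s t = lin (v s t)) ->
     v 0 0 = hopf e0.1.1 -> forall s t, ~ (Z3 (v s t) = 0 /\ xy (v s t) ^+ q = 1)) ->
  over (Q1 0 0) (Q2 0 0) e0 ->
  exists e : RR -> RR -> Ed,
    lifts (fun p : RR * RR => Q1 p.1 p.2) (fun p : RR * RR => Q2 p.1 p.2) (fun p => e p.1 p.2) /\
    e 0 0 = e0.
Proof.
move=> q0 [cPhi Phi0] cQ1 cQ2 R1 R2 cl1 cl2 ne av [u01 P0 y10 [v01 y20] [r0 r0p er0]].
have [v1 [cv1 v1u v1Q v10 v1cl]] := sphere_lift cQ1 R1 (hopf_unit u01) y10.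
have [v2 [cv2 v2u v2Q v20 v2cl]] := sphere_lift cQ2 R2 v01 y20.
have v1Q' s t : Q1 s t = lin (v1 s t) by rewrite -cl1 v1Q.
have v2Q' s t : Q2 s t = lin (v2 s t) by rewrite -cl2 v2Q.
have [u [cu1 cu2 uP u00 ucl]] := spinor_lift q0 cv1 v1u v1cl (av v1 cv1 v1u v1Q' v10) u01 (esym v10) P0.
have Pn s t : Phi (u s t) (v2 s t) != 0.
  have [h1 h2 h3] := uP s t; apply: Phi0 => //; rewrite h2 -v1Q' -v2Q'; exact: ne.
have cP : ccts (fun p : RR * RR => Phi (u p.1 p.2) (v2 p.1 p.2)).
  exact: (cPhi _ (fun p : RR * RR => u p.1 p.2) (fun p : RR * RR => v2 p.1 p.2)).
have Pcl s t : Phi (u (cl s) (cl t)) (v2 (cl s) (cl t)) = Phi (u s t) (v2 s t) by rewrite ucl v2cl.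
have e00 : Phi (u 0 0) (v2 0 0) = r0%:C%C * cis e0.2 by rewrite u00 v20.
have [h [ch hP h0 hcl]] := arg_lift cP Pn Pcl r0p e00.
exists (fun s t => (u s t, v2 s t, h s t)); split; last first.
  by rewrite u00 v20 h0; case: (e0) => [[]].
split=> // -[s t]; have [h1 h2 h3] := uP s t; split => //=; first by rewrite h2.
by exists (Num.sqrt (nsq (Phi (u s t) (v2 s t)))); rewrite ?sqrtr_gt0 ?nsq_gt0 //; exact: hP.
Qed.

End Lifts.

(** * Base lines on the equator and rotating frames *)

Definition dir (a : RR) : vec := \col_i nth 0 [:: cos a; sin a; 0] i.

Lemma dirE a : [/\ X3 (dir a) = cos a, Y3 (dir a) = sin a & Z3 (dir a) = 0].
Proof. by split; rewrite /X3 /Y3 /Z3 mxE. Qed.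

Lemma xy_dir a : xy (dir a) = cis a.
Proof. by have [hx hy _] := dirE a; rewrite /xy hx hy. Qed.

Lemma dir_unit a : dotv (dir a) (dir a) = 1.
Proof. by have [hx hy hz] := dirE a; rewrite dotv3 hx hy hz mulr0 addr0 -!expr2 cos2Dsin2. Qed.

Lemma Rz_dir a b : Rz a *m dir b = dir (a + b).
Proof.
have [hx hy hz] := mulRz a (dir b); have [dx dy dz] := dirE b; have [ex ey ez] := dirE (a + b).
apply: vecP.
- by rewrite hx dx dy ex trigo.cosD; ring.
- by rewrite hy dx dy ey trigo.sinD; ring.
- by rewrite hz dz ez.
Qed.

Lemma dirDpi a : dir (a + pi) = - dir a.
Proof.
have [hx hy hz] := dirE (a + pi); have [dx dy dz] := dirE a.
have Xn (v : vec) : [/\ X3 (- v) = - X3 v, Y3 (- v) = - Y3 v & Z3 (- v) = - Z3 v].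
  by split; rewrite /X3 /Y3 /Z3 mxE.
have [nx ny nz] := Xn (dir a).
by apply: vecP; rewrite ?hx ?hy ?hz ?nx ?ny ?nz ?dx ?dy ?dz ?oppr0 // ?cosDpi ?sinDpi.
Qed.

Lemma dirDpin a n : lin (dir (a + pi *+ n)) = lin (dir a).
Proof. by elim: n => [|n IH]; rewrite ?mulr0n ?addr0 // mulrSr addrA dirDpi linN. Qed.

(* The n-th of the q equally spaced lines of the equator, up to n mod q. *)
Definition zb (q n : nat) : mx3 := lin (dir (pi *+ n / q%:R)).

Lemma zb_mod q n : (0 < q)%N -> zb q (n %% q) = zb q n.
Proof.
move=> q0; rewrite [in RHS](divn_eq n q) /zb.
have -> : pi *+ (n %/ q * q + n %% q) / q%:R = pi *+ (n %% q) / q%:R + pi *+ (n %/ q) :> RR.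
  rewrite -!(mulr_natr pi) natrD natrM; field.
  by rewrite pnatr_eq0 -lt0n.
by rewrite dirDpin.
Qed.

Lemma zb_char q (v : vec) : (0 < q)%N -> dotv v v = 1 -> Z3 v = 0 -> xy v ^+ q = 1 ->
  exists i : 'I_q, lin v = zb q i.
Proof.
move=> q0 v1 hz hq.
have n1 : nsq (xy v) = 1.
  by move: v1; rewrite dotv3 hz mulr0 addr0 /nsq /= !expr2.
have [a ea] := cis_ex n1.
have va : v = dir a.
  have [dx dy dz] := dirE a; have := xy_dir a; rewrite -ea => -[ex ey].
  by apply: vecP; rewrite ?ex ?ey ?dz.
have qn0 : q%:R != 0 :> RR by rewrite pnatr_eq0 -lt0n.
have [k ek] : exists k : int, a *+ q = k%:~R * (pi *+ 2).
  by apply: cis_eq1; rewrite cisMn -ea.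
have {}ek : a = k%:~R * (pi *+ 2) / q%:R by rewrite -ek -(mulr_natr a) mulfK.
pose n := `|(k %% q)%Z|%N.
have kq : k = (k %/ q)%Z * q + n.
  by rewrite {1}(divz_eq k q) /n gez0_abs // modz_ge0 // -lt0n.
have lineD (b : RR) (l : int) : lin (dir (b + l%:~R * (pi *+ 2))) = lin (dir b).
  have e c m : lin (dir (c + m%:R * (pi *+ 2))) = lin (dir c).
    by rewrite mulr_natl -mulrnA dirDpin.
  by case: l => m; [exact: e|rewrite NegzE mulrNz mulNr -pmulrn -[LHS](e _ m.+1) subrK].
(* The vector has angle 2 pi k / q, while base lines are spaced by pi / q: hence the index 2 k
   modulo q. *)
have ok : (n * 2 %% q < q)%N by rewrite ltn_mod.
exists (Ordinal ok); rewrite /= zb_mod // /zb va ek.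
have -> : k%:~R * (pi *+ 2) / q%:R = pi *+ (n * 2) / q%:R + (k %/ q)%Z%:~R * (pi *+ 2) :> RR.
  have -> : k%:~R = (k %/ q)%Z%:~R * q%:R + n%:R :> RR by rewrite {1}kq intrD intrM -!pmulrn.
  rewrite mulrnA -(mulr_natr pi n) -(mulr_natr (pi * n%:R) 2) -(mulr_natr pi 2).
  move: ((k %/ q)%Z%:~R) (n%:R : RR) (q%:R : RR) qn0 (pi : RR) => x y z z0 w.
  by field.
exact: lineD.
Qed.

Definition rotP (a : RR) (P : mx3) : mx3 := Rz a *m P *m (Rz a)^T.

Lemma rotP_lin a v : rotP a (lin v) = lin (Rz a *m v).
Proof. exact: lin_act. Qed.
Lemma rotPD a b P : rotP a (rotP b P) = rotP (a + b) P.
Proof. by rewrite /rotP -RzD trmx_mul !mulmxA. Qed.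
Lemma rotP0 P : rotP 0 P = P.
Proof. by rewrite /rotP Rz0 trmx1 mul1mx mulmx1. Qed.
Lemma rotPK a P : rotP (- a) (rotP a P) = P.
Proof. by rewrite rotPD addNr rotP0. Qed.
Lemma rotPKV a P : rotP a (rotP (- a) P) = P.
Proof. by rewrite rotPD subrr rotP0. Qed.
Lemma rotP_inj a P Q : rotP a P = rotP a Q -> P = Q.
Proof. by move=> h; rewrite -(rotPK a P) h rotPK. Qed.

Lemma Rz_dotv a v w : dotv (Rz a *m v) (Rz a *m w) = dotv v w.
Proof. by rewrite dotv_mull mulmxA RzT RzD addNr Rz0 mul1mx. Qed.

Lemma RP2_rotP a P : RP2 P -> RP2 (rotP a P).
Proof. by move=> /RP2P [v v1 ->]; rewrite rotP_lin; apply: RP2_lin; rewrite Rz_dotv. Qed.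

Lemma mcts_Rz (T : topologicalType) (a : T -> RR) : cts a -> mcts (fun t => Rz (a t)).
Proof.
move=> ca i j; under eq_fun do rewrite mxE.
case: i => -[|[|[|//]]] hi; case: j => -[|[|[|//]]] hj /=; try exact: cts_cst.
- exact: cts_cos.
- by apply: ctsN; exact: cts_sin.
- exact: cts_sin.
- exact: cts_cos.
Qed.

Lemma mcts_rotP (T : topologicalType) (a : T -> RR) (P : T -> mx3) :
  cts a -> mcts P -> mcts (fun t => rotP (a t) (P t)).
Proof.
by move=> ca cP; apply: mctsM; [apply: mctsM => //; exact: mcts_Rz|apply: mcts_tr; exact: mcts_Rz].
Qed.

Lemma zb_rot q n k : rotP (pi *+ k / q%:R) (zb q n) = zb q (k + n).
Proof. by rewrite /zb rotP_lin Rz_dir mulrnDr mulrDl. Qed.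

Lemma X3D (v w : vec) : X3 (v + w) = X3 v + X3 w. Proof. by rewrite /X3 mxE. Qed.
Lemma Y3D (v w : vec) : Y3 (v + w) = Y3 v + Y3 w. Proof. by rewrite /Y3 mxE. Qed.
Lemma Z3D (v w : vec) : Z3 (v + w) = Z3 v + Z3 w. Proof. by rewrite /Z3 mxE. Qed.
Lemma X3Z a (v : vec) : X3 (a *: v) = a * X3 v. Proof. by rewrite /X3 mxE. Qed.
Lemma Y3Z a (v : vec) : Y3 (a *: v) = a * Y3 v. Proof. by rewrite /Y3 mxE. Qed.
Lemma Z3Z a (v : vec) : Z3 (a *: v) = a * Z3 v. Proof. by rewrite /Z3 mxE. Qed.
Definition lin3E := (X3D, Y3D, Z3D, X3Z, Y3Z, Z3Z).

Definition seg (v w : vec) (r : RR) : vec := (1 - r) *: v + r *: w.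

Lemma sin_piq q : (2 <= q)%N -> 0 < sin (pi / q%:R) :> RR.
Proof.
move=> q2; have p0 : 0 < pi :> RR := pi_gt0 _.
have q1 : 1 < q%:R :> RR by rewrite ltr1n.
by apply: sin_gt0_pi; rewrite divr_gt0 ?ltr_pdivrMr ?ltr_pMr // (lt_trans ltr01).
Qed.

(* Moving v to dir(pi/q) and w to one of +-dir 0 along segments, the two lines stay
   distinct for at least one choice of the sign. *)
Lemma sign_choice q (v w : vec) : (2 <= q)%N -> Z3 v != 0 -> Z3 w != 0 ->
  (forall c, v <> c *: w) ->
  exists2 e : RR, e ^+ 2 = 1 & forall r c, 0 <= r <= 1 -> c != 0 ->
    seg v (dir (pi / q%:R)) r <> c *: seg w (e *: dir 0) r.
Proof.
move=> q2 zv zw hvw; have s0 := sin_piq q2; set s := sin (pi / q%:R) in s0.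
have [bx by_ bz] := dirE (pi / q%:R); have [dx dy dz] := dirE 0.
rewrite cos0 in dx; rewrite sin0 in dy.
have key e r c : 0 <= r <= 1 -> c != 0 -> seg v (dir (pi / q%:R)) r = c *: seg w (e *: dir 0) r ->
   [/\ c = Z3 v / Z3 w, r < 1, (1 - r) * (Y3 v - c * Y3 w) = - (r * s) &
       (1 - r) * (X3 v - c * X3 w) = r * (c * e - cos (pi / q%:R))].
  move=> /andP[r0 r1] c0 h.
  have hx := congr1 X3 h; have hy := congr1 Y3 h; have hz := congr1 Z3 h.
  rewrite /seg !lin3E bx by_ bz dx dy dz -/s !mulr0 !addr0 in hx hy hz.
  have r1' : r < 1.
    rewrite lt_neqAle r1 andbT; apply/eqP => re; move: hy; rewrite re subrr mul0r add0r mul1r mul0r mulr0.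
    by move=> se; rewrite se ltxx in s0.
  split=> //.
  - have k : 1 - r != 0 by rewrite subr_eq0 gt_eqF.
    by apply: (mulfI k); rewrite mulrA hz; field; rewrite zw.
  - by rewrite mulrBr; lra.
  - by rewrite mulrBr; lra.
(* A collision determines c by the third coordinate and r by the second, neither of which involves
   the sign. If both signs failed, the first coordinate would give 2 r c = 0, so r = 0 and v = c
   w. *)
have [[r [c [h1 h2 h3]]]|H1] := pselect (exists r c, [/\ 0 <= r <= 1, c != 0 &
    seg v (dir (pi / q%:R)) r = c *: seg w (1 *: dir 0) r]); last first.
  exists 1; first by rewrite expr1n.
  by move=> r c hr hc h; apply: H1; exists r, c.
exists (-1); first by rewrite sqrrN expr1n.
move=> r' c' h1' h2' h3'.
have [ce r1 hy hx] := key _ _ _ h1 h2 h3.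
have [ce' r1' hy' hx'] := key _ _ _ h1' h2' h3'.
have {ce'} cc : c' = c by rewrite ce ce'.
rewrite cc in hy' hx'.
have a0 : 0 < 1 - r by lra.
have a0' : 0 < 1 - r' by lra.
have err : r = r'.
  have : ((1 - r) * r' - (1 - r') * r) * s = 0.
    have -> : ((1 - r) * r' - (1 - r') * r) * s = - ((1 - r) * (- (r' * s))) + (1 - r') * (- (r * s)) by ring.
    by rewrite -hy -hy'; ring.
  move/eqP; rewrite mulf_eq0 (gt_eqF s0) orbF => /eqP; lra.
rewrite -err in hx'.
have r00 : r = 0.
  have : r * (2 * c) = 0 by rewrite mulr1 in hx; lra.
  by move/eqP; rewrite !mulf_eq0 (negPf h2) pnatr_eq0 !orbF => /eqP.
apply: (hvw c); rewrite r00 in hx hy.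
apply: vecP; rewrite !lin3E; [lra|lra|].
by rewrite ce divfK.
Qed.

Local Notation strands K := ('I_K -> RR -> mx3).

(** [gpath] and [ghom] are the counterparts of [kpath] and [homotopic] for functions on the whole
    line that factor through the clamp. *)
Definition gpath K (E : strands K) : Prop :=
  [/\ forall i, mcts (E i), forall t, in_conf (fun i => E i t) & forall i t, E i (cl t) = E i t].

Definition ghom K (E E' : strands K) : Prop :=
  exists H : 'I_K -> RR -> RR -> mx3,
  [/\ forall i, mcts2 (H i),
      forall s t, in_conf (fun i => H i s t),
      forall i s t, H i (cl s) (cl t) = H i s t,
      forall i t, H i 0 t = E i t /\ H i 1 t = E' i t &
      forall i s, H i s 0 = E i 0 /\ H i s 1 = E i 1].

(** * Lifts along homotopic braids seen in rotating frames *)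

Section FrameChange.
Variables (q K : nat) (Phi : spinor -> vec -> CC) (b : 'I_q -> 'I_K) (j1 j2 : 'I_K).
Hypotheses (q2 : (2 <= q)%N) (bI : injective b) (j12 : j1 != j2)
  (j1b : forall i, b i != j1) (j2b : forall i, b i != j2) (adm : admissible q Phi).

Let q0 : (0 < q)%N. Proof. exact: leq_trans q2. Qed.

Lemma lifts_comp (T U : topologicalType) (g : U -> T) (y1 y2 : T -> mx3) (e : T -> Ed) :
  continuous g -> lifts q Phi y1 y2 e ->
  lifts q Phi (fun x => y1 (g x)) (fun x => y2 (g x)) (fun x => e (g x)).
Proof.
move=> cg [[c1 c2 c3 c4] h]; split; last by move=> x; exact: h.
split.
- exact: (ccts_precomp (f := fun t => (e t).1.1.1) cg c1).
- exact: (ccts_precomp (f := fun t => (e t).1.1.2) cg c2).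
- exact: (mcts_precomp (f := fun t => (e t).1.2) cg c3).
- exact: (cts_precomp (f := fun t => (e t).2) cg c4).
Qed.

Lemma lifts_ext (T : topologicalType) (y1 y2 y1' y2' : T -> mx3) (e : T -> Ed) :
  y1 =1 y1' -> y2 =1 y2' -> lifts q Phi y1 y2 e -> lifts q Phi y1' y2' e.
Proof. by move=> h1 h2 [ce h]; split=> // t; rewrite -h1 -h2. Qed.

Lemma lifts_cst (P1 P2 : mx3) (e0 : Ed) : over q Phi P1 P2 e0 ->
  lifts q Phi (fun _ : RR => P1) (fun _ => P2) (fun _ => e0).
Proof.
move=> h; split=> //; split; [exact: ccts_cst|exact: ccts_cst|exact: mcts_cst|exact: cts_cst].
Qed.

Lemma lift_stays (P1 P2 : mx3) (e : RR -> Ed) t t' : I01 t -> I01 t' ->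
  lifts q Phi (fun _ : RR => P1) (fun _ => P2) e -> e t = e t'.
Proof.
move=> It It' le; apply: (lifts_uniq q0 le (lifts_cst _) It' It) => //.
by have [_ /(_ t')] := le.
Qed.

Lemma base_avoid (v : vec) : dotv v v = 1 -> (forall i : 'I_q, lin v <> zb q i) ->
  ~ (Z3 v = 0 /\ xy v ^+ q = 1).
Proof. by move=> v1 h [hz hq]; have [i /h] := zb_char q0 v1 hz hq. Qed.

Let I0 : I01 0. Proof. by rewrite /I01 /= lexx ler01. Qed.
Let I1 : I01 1. Proof. by rewrite /I01 /= lexx ler01. Qed.

Lemma seg_neq0 v w r : 0 <= r <= 1 -> Z3 v != 0 -> dotv w w = 1 -> Z3 w = 0 -> seg v w r != 0.
Proof.
move=> /andP[r0 r1] zv w1 zw; apply/eqP => h.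
have [e|ne] := eqVneq r 1.
  by move: h; rewrite /seg e subrr scale0r add0r scale1r; apply/eqP; exact: unit_neq0.
have := congr1 Z3 h; rewrite /seg !lin3E zw mulr0 addr0 {2}/Z3 mxE => /eqP.
by rewrite mulf_eq0 (negPf zv) orbF subr_eq0 eq_sym (negPf ne).
Qed.

Lemma seg_noteq v w r i : 0 <= r < 1 -> Z3 v != 0 -> Z3 w = 0 -> pl (seg v w r) <> zb q i.
Proof.
move=> /andP[r0 r1] zv zw; set x := seg v w r => h.
have zx : Z3 x != 0.
  by rewrite /x /seg !lin3E zw mulr0 addr0 mulf_neq0 // subr_eq0 gt_eqF.
have x0 : x != 0.
  by apply/eqP => e; move: zx; rewrite e /Z3 mxE eqxx.
move: h; rewrite /zb -pl_unit ?dir_unit // => /(pl_inj x0 (unit_neq0 (dir_unit _))) [c _ e].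
by move: zx; rewrite e Z3Z; have [_ _ ->] := dirE (pi *+ i / q%:R); rewrite mulr0 eqxx.
Qed.

Lemma mcts_pl (T : topologicalType) (f : T -> vec) : mcts f -> (forall t, f t != 0) ->
  mcts (fun t => pl (f t)).
Proof.
move=> cf f0; apply: mctsZ; last exact: mcts_lin.
by apply: ctsV; [exact: cts_dotv|move=> t; rewrite gt_eqF // dotv_gt0].
Qed.

Lemma mcts_seg (T : topologicalType) v w (r : T -> RR) : cts r -> mcts (fun t => seg v w (r t)).
Proof.
move=> cr; apply: mctsD; (apply: mctsZ; last exact: mcts_cst) => //.
by apply: ctsB => //; exact: cts_cst.
Qed.

(* A loop of self-injections of RP2 fixing the base lines lifts to closed loops: move the
   two points to fixed lines outside the branch locus. *)
Lemma loop_closed (psi : RR -> mx3 -> mx3) (x1 x2 : mx3) (e : RR -> Ed) :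
  (forall t P, RP2 P -> RP2 (psi t P)) ->
  (forall t P Q, RP2 P -> RP2 Q -> psi t P = psi t Q -> P = Q) ->
  (forall t (i : 'I_q), psi t (zb q i) = zb q i) ->
  (forall P, RP2 P -> psi 0 P = P) -> (forall P, RP2 P -> psi 1 P = P) ->
  (forall t P, psi (cl t) P = psi t P) ->
  (forall (T : topologicalType) (a : T -> RR) (P : T -> mx3), cts a -> mcts P ->
     (forall x, RP2 (P x)) -> mcts (fun x => psi (a x) (P x))) ->
  RP2 x1 -> RP2 x2 -> x1 <> x2 ->
  Z3 (hopf (e 0).1.1) != 0 -> Z3 (e 0).1.2 != 0 ->
  lifts q Phi (psi^~ x1) (psi^~ x2) e -> e 1 = e 0.
Proof.
move=> R inj fixb psi0 psi1 psicl cpsi hx1 hx2 x12 z1 z2 le.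
have [u1 P0 y1 [v2u y2] _] := le.2 0.
rewrite psi0 // in y1; rewrite psi0 // in y2.
set v1 := hopf (e 0).1.1 in z1 y1; set v2 := (e 0).1.2 in z2 v2u y2.
have v1u : dotv v1 v1 = 1 := hopf_unit u1.
have ncol c : v1 <> c *: v2.
  move=> h; apply: x12; rewrite y1 y2 h linZ.
  by move: v1u; rewrite h dotvZl dotvZr v2u mulr1 -expr2 => ->; rewrite scale1r.
have [s s2 hs] := sign_choice q2 z1 z2 ncol.
(* These vectors span the base lines of indices 1 and 0, which [psi] fixes. The first, at angle pi /
   q, has q-th power -1 and is no branch vector. *)
pose be := dir (pi / q%:R); pose w := s *: dir 0.
have be1 : dotv be be = 1 := dir_unit _.
have w1 : dotv w w = 1 by rewrite dotvZl dotvZr mulrA -expr2 s2 dir_unit mulr1.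
have bez : Z3 be = 0 by have [] := dirE (pi / q%:R).
have wz : Z3 w = 0 by rewrite /w Z3Z; have [_ _ ->] := dirE 0; rewrite mulr0.
pose n1 r := seg v1 be (cl r); pose n2 r := seg v2 w (cl r).
have n10 r : n1 r != 0 by apply: seg_neq0 => //; exact: cl_I.
have n20 r : n2 r != 0 by apply: seg_neq0 => //; exact: cl_I.
pose X1 r := pl (n1 r); pose X2 r := pl (n2 r).
have X12 r : X1 r <> X2 r.
  move=> /(pl_inj (n10 r) (n20 r)) [c c0]; exact: hs (cl_I r) c0.
have RX1 r : RP2 (X1 r) by exact: RP2_pl.
have RX2 r : RP2 (X2 r) by exact: RP2_pl.
have cX1 : mcts X1 by apply: mcts_pl => //; apply: mcts_seg; apply: cts_cl; exact: cts_id.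
have cX2 : mcts X2 by apply: mcts_pl => //; apply: mcts_seg; apply: cts_cl; exact: cts_id.
have cp1 : cts (fun p : RR * RR => p.1) := cts_fst cts_id.
have cp2 : cts (fun p : RR * RR => p.2) := cts_snd cts_id.
pose Q1 r t := psi t (X1 r); pose Q2 r t := psi t (X2 r).
have cQ1 : mcts2 Q1.
  by apply: cpsi => //; exact: (mcts_comp1 cX1 cp1).
have cQ2 : mcts2 Q2.
  by apply: cpsi => //; exact: (mcts_comp1 cX2 cp1).
have X1cl r : X1 (cl r) = X1 r by rewrite /X1 /n1 clK.
have X2cl r : X2 (cl r) = X2 r by rewrite /X2 /n2 clK.
have X10 : X1 0 = x1 by rewrite /X1 /n1 /seg cl0 subr0 scale1r scale0r addr0 pl_unit.
have X20 : X2 0 = x2 by rewrite /X2 /n2 /seg cl0 subr0 scale1r scale0r addr0 pl_unit.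
have q1 : (1 < q)%N := q2.
have zb1 : zb q 1 = lin be by rewrite /zb mulr1n.
have fix1 t : psi t (lin be) = lin be by rewrite -zb1; exact: (fixb t (Ordinal q1)).
have fix2 t : psi t (lin w) = lin w.
  have -> : lin w = zb q 0 by rewrite /w linZ s2 scale1r /zb mulr0n mul0r.
  exact: (fixb t (Ordinal q0)).
have X11 : X1 1 = lin be.
  by rewrite /X1 /n1 /seg cl1 subrr scale1r scale0r add0r pl_unit.
have X21 : X2 1 = lin w.
  by rewrite /X2 /n2 /seg cl1 subrr scale1r scale0r add0r pl_unit.
have av (v : RR -> RR -> vec) : mcts2 v ->
    (forall r t, dotv (v r t) (v r t) = 1) -> (forall r t, Q1 r t = lin (v r t)) ->
    v 0 0 = hopf (e 0).1.1 -> forall r t, ~ (Z3 (v r t) = 0 /\ xy (v r t) ^+ q = 1).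
  move=> cv vu vQ v00 r t.
  (* For r < 1 the first point is off the equator, and [psi] keeps it off the base lines. At r = 1
     it sits on a base line, so its vector is followed from the start along t = 0: it is [be], not
     the antipode. *)
  have [cr|cr] := eqVneq (cl r) 1; last first.
    apply: base_avoid => // i; rewrite -vQ /Q1 -(fixb t i) => /inj h.
    have := h (RX1 r); rewrite /zb => /(_ (RP2_lin (dir_unit _))).
    rewrite /X1 /n1; apply: seg_noteq => //.
    by have /andP[c0 c1] := cl_I r; rewrite c0 lt_neqAle cr c1.
  pose a r := (Num.sqrt (dotv (n1 r) (n1 r)))^-1.
  have ap r' : 0 < a r' by rewrite invr_gt0 sqrtr_gt0 dotv_gt0.
  have au r' : dotv (a r' *: n1 r') (a r' *: n1 r') = 1.
    rewrite dotvZl dotvZr mulrA -expr2 exprVn sqr_sqrtr ?mulVf ?dotv_ge0 //.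
    by rewrite gt_eqF // dotv_gt0.
  have ca : mcts (fun r => a r *: n1 r).
    have cn1 : mcts n1 by apply: mcts_seg; apply: cts_cl; exact: cts_id.
    apply: mctsZ => //; apply: ctsV; first by apply: cts_sqrt; exact: cts_dotv.
    by move=> x; rewrite gt_eqF // sqrtr_gt0 dotv_gt0.
  have cv0 : mcts (fun r => v r 0).
    by apply: (mcts_comp2 (F := v)) => //; [exact: cts_id|exact: cts_cst].
  have he x : lin (v x 0) = lin (a x *: n1 x).
    by rewrite -vQ /Q1 psi0 // -(pl_unit (au x)) plZ // gt_eqF //; exact: ap.
  have st : v 0 0 = a 0 *: n1 0.
    by rewrite v00 /a /n1 cl0 /seg subr0 scale1r scale0r addr0 v1u sqrtr1 invr1 scale1r.
  have e3 : v r 0 = be.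
    rewrite (sphere_uniq cv0 ca (vu^~ 0) au he _ st) /a /n1 cr /seg subrr scale0r scale1r add0r.
    by rewrite be1 sqrtr1 invr1 scale1r.
  have cvt : mcts (fun t => v r t).
    by apply: (mcts_comp2 (F := v)) => //; [exact: cts_cst|exact: cts_id].
  have X1r : X1 r = lin be by rewrite -X1cl cr X11.
  have e2 : v r t = v r 0.
    have hl x : lin (v r x) = lin (v r 0) by rewrite -!vQ /Q1 X1r !fix1.
    exact: (@sphere_uniq (v r) (fun=> v r 0) cvt (@mcts_cst _ _ _ _) (vu r) (fun=> vu r 0) hl 0 t).
  rewrite e2 e3 => -[_]; rewrite /be xy_dir -cisMn -(mulr_natr (pi / _)) divfK; last first.
    by rewrite pnatr_eq0 -lt0n.
  by rewrite /cis cospi sinpi => -[] /neqN11.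
have RQ1 r t : RP2 (Q1 r t) by exact: R.
have RQ2 r t : RP2 (Q2 r t) by exact: R.
have Qcl1 r t : Q1 (cl r) (cl t) = Q1 r t by rewrite /Q1 psicl X1cl.
have Qcl2 r t : Q2 (cl r) (cl t) = Q2 r t by rewrite /Q2 psicl X2cl.
have Q12 r t : Q1 r t <> Q2 r t by move=> /(inj _ _ _ (RX1 r) (RX2 r)); exact: X12.
have o0 : over q Phi (Q1 0 0) (Q2 0 0) (e 0).
  by rewrite /Q1 /Q2 X10 X20; exact: (le.2 0).
have [E [lE E0]] := lift_square q0 adm cQ1 cQ2 RQ1 RQ2 Qcl1 Qcl2 Q12 av o0.
have gr (t : RR) : continuous (fun r : RR => (r, t)) by apply: (pair_cts (f := fun r : RR => r) (g := fun _ : RR => t)); [exact: cts_id|exact: cts_cst].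
have gt (r : RR) : continuous (fun t : RR => (r, t)) by apply: (pair_cts (f := fun _ : RR => r) (g := fun t : RR => t)); [exact: cts_cst|exact: cts_id].
have l0 : lifts q Phi (psi^~ x1) (psi^~ x2) (fun t => E 0 t).
  by apply: lifts_ext (lifts_comp (gt 0) lE) => t /=; rewrite /Q1 /Q2 ?X10 ?X20.
have l1 : lifts q Phi (fun=> lin be) (fun=> lin w) (fun t => E 1 t).
  by apply: lifts_ext (lifts_comp (gt 1) lE) => t /=; rewrite /Q1 /Q2 ?X11 ?X21 ?fix1 ?fix2.
have lb : lifts q Phi X1 X2 (fun r => E r 0).
  by apply: lifts_ext (lifts_comp (gr 0) lE) => t /=; rewrite /Q1 /Q2 psi0.
have lt : lifts q Phi X1 X2 (fun r => E r 1).
  by apply: lifts_ext (lifts_comp (gr 1) lE) => t /=; rewrite /Q1 /Q2 psi1.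
(* On the edge r = 1 both lines stand still, so the lift is constant. The edges t = 0 and t = 1 lie
   over the same pair of paths, and uniqueness carries the equality back to r = 0. *)
have a1 : E 1 0 = E 1 1 := lift_stays I0 I1 l1.
have a2 : E 0 0 = E 0 1 := lifts_uniq q0 lb lt I1 I0 a1.
by rewrite (lifts_uniq q0 le l0 I0 I1 (esym E0)) -a2 E0.
Qed.

End FrameChange.

Section FrameChange2.
Variables (q K : nat) (Phi : spinor -> vec -> CC) (b : 'I_q -> 'I_K) (j1 j2 : 'I_K).

Definition exact_rot (E : strands K) (L : RR -> RR) : Prop :=
  [/\ cts L, L 0 = 0, forall t, L (cl t) = L t &
      forall (i : 'I_q) t, E (b i) t = rotP (L t) (zb q i)].

Definition inframe (E : strands K) (L : RR -> RR) (j : 'I_K) (t : RR) : mx3 :=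
  rotP (- L t) (E j t).

(* The square swept by the homotopy is first pushed back into the rotating frame of E; what
   is left over is a loop of homeomorphisms fixing the base lines. *)
Lemma frame_change (E E' : strands K) (L L' : RR -> RR) (e e' : RR -> Ed) :
  (2 <= q)%N -> injective b -> j1 != j2 -> (forall i, b i != j1) -> (forall i, b i != j2) ->
  admissible q Phi ->
  gpath E -> gpath E' -> ghom E E' -> exact_rot E L -> exact_rot E' L' -> Rz (L 1) = Rz (L' 1) ->
  lifts q Phi (inframe E L j1) (inframe E L j2) e ->
  lifts q Phi (inframe E' L' j1) (inframe E' L' j2) e' ->
  e 0 = e' 0 -> Z3 (hopf (e 0).1.1) != 0 -> Z3 (e 0).1.2 != 0 -> e 1 = e' 1.
Proof.
move=> q2 bI j12 j1b j2b adm [cE confE clE] [cE' confE' clE'] [H [cH confH clH HE HE0]].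
move=> [cL L0 Lcl xE] [cL' L'0 L'cl xE'] L1 le le' ee z1 z2.
have q0 : (0 < q)%N by exact: leq_trans q2.
have I0 : I01 0 by rewrite /I01 /= lexx ler01.
have I1 : I01 1 by rewrite /I01 /= lexx ler01.
have RH i s t : RP2 (H i s t) by have [] := confH s t.
have nH i j s t : i != j -> H i s t <> H j s t.
  by move=> ij /(proj2 (confH s t)); apply/eqP.
have H1 i t : H i 1 t = E' i t by have [] := HE i t.
have H0 i t : H i 0 t = E i t by have [] := HE i t.
(* Isotopy time r runs the homotopy backwards from stage s to stage 0, so the resulting injection W
   s t takes the base strands at stage s back to those of E. *)
pose B (i : 'I_q) r s t := H (b i) (cl s * (1 - cl r)) t.
have cB i : mcts (fun p : RR * (RR * RR) => B i p.1 p.2.1 p.2.2).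
  apply: (mcts_comp2 (F := H (b i))) => //.
    apply: ctsM; first by apply: cts_cl; exact: (cts_snd (cts_fst cts_id)).
    by apply: ctsB; [exact: cts_cst|apply: cts_cl; exact: (cts_fst cts_id)].
  exact: (cts_snd (cts_snd cts_id)).
have RB i r s t : RP2 (B i r s t) by exact: RH.
have dB i j r s t : i != j -> B i r s t != B j r s t.
  by move=> ij; apply/eqP; apply: nH; apply: contra ij => /eqP /bI ->.
have clB i r s t : B i r s t = B i (cl r) (cl s) (cl t).
  rewrite /B !clK -[LHS]clH -[RHS]clH clK //.
have [Om [RO injO baseO idO [_ contO]]] := isotopy cB RB dB clB.
pose W s t P := Om 1 (cl s) (cl t) P.
have Wb s t i : W s t (H (b i) s t) = E (b i) t.
  have := baseO i 1 (cl s) (cl t); rewrite /B cl0 cl1 subr0 mulr1 subrr mulr0 clK clH.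
  by rewrite /W => ->; rewrite H0 clE.
have W0 t P : RP2 P -> W 0 t P = P.
  by move=> hP; apply: idO => // i r; rewrite /B cl0 cl0 !mul0r.
have Wt0 s P : RP2 P -> W s 0 P = P.
  by move=> hP; apply: idO => // i r; rewrite /B cl0 !(proj1 (HE0 _ _)).
have Wt1 s P : RP2 P -> W s 1 P = P.
  by move=> hP; apply: idO => // i r; rewrite /B cl1 !(proj2 (HE0 _ _)).
have RW s t P : RP2 P -> RP2 (W s t P) by exact: RO.
have injW s t P Q : RP2 P -> RP2 Q -> W s t P = W s t Q -> P = Q by exact: injO.
have cW (T : topologicalType) (s t : T -> RR) (P : T -> mx3) : cts s -> cts t -> mcts P ->
    (forall x, RP2 (P x)) -> mcts (fun x => W (s x) (t x) (P x)).
  by move=> cs ct cP hP; apply: contO => //; [exact: cts_cst|exact: cts_cl|exact: cts_cl].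
have Wcl s t P : W (cl s) (cl t) P = W s t P by rewrite /W !clK.
have cp1 : cts (fun p : RR * RR => p.1) := cts_fst cts_id.
have cp2 : cts (fun p : RR * RR => p.2) := cts_snd cts_id.
(* first square: the homotopy in the frame of E *)
pose Q1 j s t := rotP (- L t) (W s t (H j s t)).
have cQ1 j : mcts2 (Q1 j).
  apply: mcts_rotP; first by apply: ctsN; exact: (cts_snd cL).
  by apply: cW => // x; exact: RH.
have RQ1 j s t : RP2 (Q1 j s t) by apply: RP2_rotP; apply: RW; exact: RH.
have clQ1 j s t : Q1 j (cl s) (cl t) = Q1 j s t by rewrite /Q1 Lcl Wcl clH.
have neQ1 s t : Q1 j1 s t <> Q1 j2 s t.
  by move=> /rotP_inj /(injW _ _ _ _ (RH _ _ _) (RH _ _ _)); exact: nH.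
have bQ1 j s t (i : 'I_q) : b i != j -> Q1 j s t <> zb q i.
  move=> ij; rewrite /Q1 => h.
  have : W s t (H j s t) = W s t (H (b i) s t) by rewrite Wb xE -h rotPKV.
  by move=> /(injW _ _ _ _ (RH _ _ _) (RH _ _ _)) /esym; exact: nH.
have av1 (v : RR -> RR -> vec) : mcts2 v ->
    (forall r t, dotv (v r t) (v r t) = 1) -> (forall r t, Q1 j1 r t = lin (v r t)) ->
    v 0 0 = hopf (e 0).1.1 -> forall r t, ~ (Z3 (v r t) = 0 /\ xy (v r t) ^+ q = 1).
  by move=> _ vu vQ _ r t; apply: (base_avoid q2) => // i; rewrite -vQ; exact: bQ1.
have Q10 j t : Q1 j 0 t = inframe E L j t by rewrite /Q1 W0 ?H0 //; rewrite -H0; exact: RH.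
have o1 : over q Phi (Q1 j1 0 0) (Q1 j2 0 0) (e 0) by rewrite !Q10; exact: (le.2 0).
have [F [lF F0]] := lift_square q0 adm (cQ1 j1) (cQ1 j2) (RQ1 j1) (RQ1 j2) (clQ1 j1) (clQ1 j2) neQ1 av1 o1.
have gr (t : RR) : continuous (fun r : RR => (r, t)).
  by apply: (pair_cts (f := fun r : RR => r) (g := fun _ : RR => t)); [exact: cts_id|exact: cts_cst].
have gt (r : RR) : continuous (fun t : RR => (r, t)).
  by apply: (pair_cts (f := fun _ : RR => r) (g := fun t : RR => t)); [exact: cts_cst|exact: cts_id].
have gd : continuous (fun t : RR => (t, t)).
  by apply: (pair_cts (f := fun t : RR => t) (g := fun t : RR => t)); exact: cts_id.
have lF0 : lifts q Phi (inframe E L j1) (inframe E L j2) (fun t => F 0 t).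
  by apply: lifts_ext (lifts_comp (gt 0) lF) => t /=; exact: Q10.
have F01 : F 0 1 = e 1 := lifts_uniq q0 lF0 le I0 I1 F0.
have F10 : F 1 0 = e 0.
  rewrite -F0; apply: (lift_stays (e := fun s => F s 0) q2 I1 I0 (P1 := E j1 0) (P2 := E j2 0)).
  by apply: lifts_ext (lifts_comp (gr 0) lF) => s /=;
    rewrite /Q1 L0 oppr0 rotP0 Wt0; [exact: (proj1 (HE0 _ _))|exact: RH|exact: (proj1 (HE0 _ _))|exact: RH].
have F11 : F 1 1 = e 1.
  rewrite -F01; apply: (lift_stays (e := fun s => F s 1) q2 I1 I0
     (P1 := rotP (- L 1) (E j1 1)) (P2 := rotP (- L 1) (E j2 1))).
  by apply: lifts_ext (lifts_comp (gr 1) lF) => s /=; rewrite /Q1 Wt1 ?(proj2 (HE0 _ _)) //; rewrite -(proj2 (HE0 _ s)); exact: RH.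
(* second square: the leftover loop psi acting on the strands of E' *)
pose psi t P := rotP (- L t) (W 1 t (rotP (L' t) P)).
have Rpsi t P : RP2 P -> RP2 (psi t P) by move=> hP; apply: RP2_rotP; apply: RW; exact: RP2_rotP.
have injpsi t P Q : RP2 P -> RP2 Q -> psi t P = psi t Q -> P = Q.
  move=> hP hQ /rotP_inj /(injW _ _ _ _ (RP2_rotP _ hP) (RP2_rotP _ hQ)); exact: rotP_inj.
have fixpsi t (i : 'I_q) : psi t (zb q i) = zb q i.
  by rewrite /psi -xE' -H1 Wb xE rotPK.
have psi0 P : RP2 P -> psi 0 P = P.
  by move=> hP; rewrite /psi L0 L'0 oppr0 !rotP0 Wt0.
have psi1 P : RP2 P -> psi 1 P = P.
  move=> hP; rewrite /psi Wt1 ?RP2_rotP //; last exact: RP2_rotP.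
  by rewrite {2}/rotP -L1 -/(rotP (L 1) P) rotPK.
have psicl t P : psi (cl t) P = psi t P by rewrite /psi Lcl L'cl /W !clK.
have cpsi (T : topologicalType) (a : T -> RR) (P : T -> mx3) : cts a -> mcts P ->
     (forall x, RP2 (P x)) -> mcts (fun x => psi (a x) (P x)).
  move=> ca cP hP; apply: mcts_rotP; first by apply: ctsN; exact: (cts_comp cL ca).
  apply: cW => //; first exact: cts_cst.
    by apply: mcts_rotP => //; exact: (cts_comp cL' ca).
  by move=> x; exact: RP2_rotP.
have RE' j t : RP2 (inframe E' L' j t) by apply: RP2_rotP; rewrite -H1; exact: RH.
pose Q2 j s t := psi s (inframe E' L' j t).
have cif j : mcts (inframe E' L' j) by apply: mcts_rotP => //; exact: ctsN.
have cQ2 j : mcts2 (Q2 j).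
  by apply: cpsi => //; exact: (mcts_comp1 (cif j) cp2).
have RQ2 j s t : RP2 (Q2 j s t) by exact: Rpsi.
have clQ2 j s t : Q2 j (cl s) (cl t) = Q2 j s t by rewrite /Q2 psicl /inframe L'cl clE'.
have neQ2 s t : Q2 j1 s t <> Q2 j2 s t.
  by move=> /(injpsi _ _ _ (RE' _ _) (RE' _ _)) /rotP_inj; rewrite -!H1; exact: nH.
have Rzb (i : 'I_q) : RP2 (zb q i) by apply: RP2_lin; exact: dir_unit.
have av2 (v : RR -> RR -> vec) : mcts2 v ->
    (forall r t, dotv (v r t) (v r t) = 1) -> (forall r t, Q2 j1 r t = lin (v r t)) ->
    v 0 0 = hopf (e 0).1.1 -> forall r t, ~ (Z3 (v r t) = 0 /\ xy (v r t) ^+ q = 1).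
  move=> _ vu vQ _ r t; apply: (base_avoid q2) => // i; rewrite -vQ /Q2 -(fixpsi r i).
  move=> /(injpsi _ _ _ (RE' _ _) (Rzb i)) h.
  have : E' j1 t = E' (b i) t by rewrite xE' -h /inframe rotPKV.
  by rewrite -!H1 => /esym; exact: nH.
have o2 : over q Phi (Q2 j1 0 0) (Q2 j2 0 0) (e 0).
  by rewrite /Q2 !psi0 // ee; exact: (le'.2 0).
have [G [lG G0]] := lift_square q0 adm (cQ2 j1) (cQ2 j2) (RQ2 j1) (RQ2 j2) (clQ2 j1) (clQ2 j2) neQ2 av2 o2.
(* The diagonal of the second square is the edge s = 1 of the first, which links G 1 1 to e 1. The
   other route to G 1 1 follows the loop at t = 0, closed by [loop_closed], and then the frame paths
   of E'. *)
have Q12 j t : Q2 j t t = Q1 j 1 t by rewrite /Q2 /psi /inframe rotPKV /Q1 H1.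
have lGd : lifts q Phi (Q1 j1 1) (Q1 j2 1) (fun t => G t t).
  by apply: lifts_ext (lifts_comp gd lG) => t /=; exact: Q12.
have lF1 : lifts q Phi (Q1 j1 1) (Q1 j2 1) (fun t => F 1 t).
  exact: (lifts_comp (gt 1) lF).
have G11 : G 1 1 = e 1.
  by rewrite -F11; apply: (lifts_uniq q0 lGd lF1 I0 I1); rewrite G0 F10.
have lGa : lifts q Phi (psi^~ (inframe E' L' j1 0)) (psi^~ (inframe E' L' j2 0)) (fun s => G s 0).
  exact: (lifts_comp (gr 0) lG).
have G10 : G 1 0 = e 0.
  rewrite -G0; apply: (loop_closed q2 adm Rpsi injpsi fixpsi psi0 psi1 psicl cpsi _ _ _ _ _ lGa) => //.
  - by move=> /rotP_inj; rewrite -!H1; exact: nH.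
  - by rewrite G0.
  - by rewrite G0.
have lG1 : lifts q Phi (inframe E' L' j1) (inframe E' L' j2) (fun t => G 1 t).
  by apply: lifts_ext (lifts_comp (gt 1) lG) => t /=; rewrite /Q2 psi1.
by rewrite -G11; apply: (lifts_uniq q0 lG1 le' I0 I1); rewrite G10.
Qed.

End FrameChange2.

(** * Products of braids *)

Definition catc T (f g : RR -> T) (t : RR) : T :=
  if t <= 2^-1 then f (cl (2 * t)) else g (cl (2 * t - 1)).

Lemma cl_ge1 t : 1 <= t -> cl t = 1.
Proof. by move=> h; rewrite /cl max_l ?min_r // (le_trans ler01). Qed.
Lemma cl_le0 t : t <= 0 -> cl t = 0.
Proof. by move=> h; rewrite /cl max_r // min_l // ler01. Qed.

Lemma catc0 T (f g : RR -> T) : catc f g 0 = f 0.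
Proof. by rewrite /catc mulr0 cl0 invr_ge0 ler0n. Qed.

Lemma catc1 T (f g : RR -> T) : catc f g 1 = g 1.
Proof.
rewrite /catc ifF; last by apply/negbTE; rewrite -ltNge; lra.
by have -> : 2 * 1 - 1 = 1 :> RR by [lra]; rewrite cl1.
Qed.

Lemma catc_cl T (f g : RR -> T) t : catc f g (cl t) = catc f g t.
Proof.
have [h0|h0] := leP t 0.
  rewrite (cl_le0 h0) catc0 /catc ifT ?cl_le0 //; lra.
have [h1|h1] := leP 1 t.
  rewrite (cl_ge1 h1) catc1 /catc ifF ?(@cl_ge1 (2 * t - 1)) //; first by lra.
  by apply/negbTE; rewrite -ltNge; lra.
by rewrite cl_id // !ltW.
Qed.

Lemma cts_catc2 (T : topologicalType) (f g : T -> RR -> RR) (a : T -> RR) :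
  cts (fun p : T * RR => f p.1 p.2) -> cts (fun p : T * RR => g p.1 p.2) ->
  (forall x, f x 1 = g x 0) -> cts a -> cts (fun x => catc (f x) (g x) (a x)).
Proof.
move=> cf cg fg ca.
(* On each half one of the two clamped summands is constantly f x 1. A concatenation is thus a sum
   of continuous functions, without a pasting argument. *)
have -> : (fun x => catc (f x) (g x) (a x)) =
    (fun x => f x (cl (2 * a x)) + g x (cl (2 * a x - 1)) - f x 1).
  apply/funext => x; rewrite /catc; case: ifPn => h.
    by rewrite (@cl_le0 (2 * a x - 1)) ?fg ?addrK //; lra.
  by rewrite -ltNge in h; rewrite (@cl_ge1 (2 * a x)) ?[f x 1 + _]addrC ?addrK //; lra.
have c2 : cts (fun x => 2 * a x) by apply: ctsM => //; exact: cts_cst.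
have comp (h : T -> RR -> RR) (y : T -> RR) : cts (fun p : T * RR => h p.1 p.2) -> cts y ->
    cts (fun x => h x (y x)).
  move=> ch cy; apply: (cts_precomp (f := fun p : T * RR => h p.1 p.2) (g := fun x => (x, y x))) => //.
  by apply: (pair_cts (f := fun x : T => x)) => // x; exact: cvg_id.
apply: ctsB; last by apply: comp => //; exact: cts_cst.
apply: ctsD; apply: comp => //; apply: cts_cl => //.
by apply: ctsB => //; exact: cts_cst.
Qed.

Lemma cts_catc (f g : RR -> RR) : cts f -> cts g -> f 1 = g 0 -> cts (catc f g).
Proof.
move=> cf cg fg; apply: (cts_catc2 (f := fun _ : RR => f) (g := fun _ => g) (a := id)) => //.
- exact: (cts_snd cf).
- exact: (cts_snd cg).
- exact: cts_id.
Qed.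

Lemma app_catc S T (F : S -> T) (f g : RR -> S) t : F (catc f g t) = catc (F \o f) (F \o g) t.
Proof. by rewrite /catc; case: ifP. Qed.

Lemma catcE S T (F : S -> T) (f g : RR -> S) :
  (fun t => F (catc f g t)) = catc (fun t => F (f t)) (fun t => F (g t)).
Proof. by apply/funext => t; exact: app_catc. Qed.

Lemma mcts_catc m n (f g : RR -> 'M[RR]_(m, n)) : mcts f -> mcts g -> f 1 = g 0 -> mcts (catc f g).
Proof.
move=> cf cg fg i j.
rewrite (catcE (fun M : 'M[RR]_(m, n) => M i j)).
by apply: cts_catc; [exact: cf|exact: cg|rewrite fg].
Qed.

Lemma mcts_catc2 (T : topologicalType) m n (f g : T -> RR -> 'M[RR]_(m, n)) (a : T -> RR) :
  mcts (fun p : T * RR => f p.1 p.2) -> mcts (fun p : T * RR => g p.1 p.2) ->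
  (forall x, f x 1 = g x 0) -> cts a -> mcts (fun x => catc (f x) (g x) (a x)).
Proof.
move=> cf cg fg ca i j.
have -> : (fun x => catc (f x) (g x) (a x) i j) =
   (fun x => catc (fun t => f x t i j) (fun t => g x t i j) (a x)).
  by apply/funext => t; rewrite (app_catc (fun M : 'M[RR]_(m, n) => M i j)).
apply: (cts_catc2 (f := fun x t => f x t i j) (g := fun x t => g x t i j)).
- exact: cf.
- exact: cg.
- by move=> x; rewrite fg.
- exact: ca.
Qed.

Lemma ccts_catc (f g : RR -> CC) : ccts f -> ccts g -> f 1 = g 0 -> ccts (catc f g).
Proof.
move=> [c1 c2] [d1 d2] fg; split.
  by rewrite (catcE (@complex.Re _)); apply: cts_catc => //; rewrite fg.
by rewrite (catcE (@complex.Im _)); apply: cts_catc => //; rewrite fg.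
Qed.

Section Ghom.
Variable K : nat.
Implicit Types E F G : strands K.

Definition gmul E (sg : {perm 'I_K}) F : strands K := fun i => catc (E i) (F (sg i)).

Lemma gpath_gmul E (sg : {perm 'I_K}) F : gpath E -> gpath F -> (forall i, E i 1 = F (sg i) 0) -> gpath (gmul E sg F).
Proof.
move=> [cE confE clE] [cF confF clF] h; split.
- by move=> i; apply: mcts_catc.
- move=> t; rewrite /gmul /catc; case: (t <= 2^-1); first exact: confE.
  have [R inj] := confF (cl (2 * t - 1)); split=> [i|i j /inj /perm_inj //]; exact: R.
- by move=> i t; rewrite /gmul catc_cl.
Qed.

Lemma ghom_sym E F : ghom E F -> ghom F E.
Proof.
move=> [H [cH confH clH HE HE0]]; exists (fun i s t => H i (1 - cl s) t); split.
- move=> i; apply: (mcts_comp2 (F := H i)) => //; last exact: (cts_snd cts_id).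
  by apply: ctsB; [exact: cts_cst|apply: cts_cl; exact: (cts_fst cts_id)].
- by move=> s t; exact: confH.
- by move=> i s t; rewrite clK -[LHS]clH -[RHS]clH clK.
- by move=> i t; rewrite cl0 cl1 subr0 subrr; have [-> ->] := HE i t.
move=> i s; rewrite !(proj1 (HE0 _ _)) !(proj2 (HE0 _ _)).
have [_ <-] := HE i 0; have [_ <-] := HE i 1.
by rewrite (proj1 (HE0 _ _)) (proj2 (HE0 _ _)).
Qed.

Lemma ghom_trans F E G : ghom E F -> ghom F G -> ghom E G.
Proof.
move=> [H [cH confH clH HE HE0]] [H' [cH' confH' clH' HE' HE0']].
have sw i (J : 'I_K -> RR -> RR -> mx3) : mcts2 (J i) ->
    mcts (fun p : (RR * RR) * RR => J i p.2 p.1.2).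
  by move=> cJ; apply: (mcts_comp2 (F := J i)) => //; [exact: (cts_snd cts_id)|exact: (cts_fst (cts_snd cts_id))].
have F0 i : F i 0 = E i 0 /\ F i 1 = E i 1.
  by have [_ <-] := HE i 0; have [_ <-] := HE i 1; rewrite (proj1 (HE0 _ _)) (proj2 (HE0 _ _)).
exists (fun i s t => catc (H i ^~ t) (H' i ^~ t) s); split.
- move=> i; apply: (mcts_catc2 (f := fun (p : RR * RR) s => H i s p.2)
     (g := fun (p : RR * RR) s => H' i s p.2) (a := fst)).
  + exact: sw.
  + exact: sw.
  + by move=> [s t] /=; have [_ ->] := HE i t; have [-> _] := HE' i t.
  exact: (cts_fst cts_id).
- by move=> s t; rewrite /catc; case: (s <= 2^-1); [exact: confH|exact: confH'].
- move=> i s t; rewrite catc_cl /catc; case: ifP => _.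
    by rewrite -[LHS]clH -[RHS]clH !clK.
  by rewrite -[LHS]clH' -[RHS]clH' !clK.
- by move=> i t; rewrite catc0 catc1; have [-> _] := HE i t; have [_ ->] := HE' i t.
move=> i s; split; rewrite /catc; case: ifP => _.
- exact: (proj1 (HE0 _ _)).
- by rewrite (proj1 (HE0' _ _)); have [] := F0 i.
- exact: (proj2 (HE0 _ _)).
- by rewrite (proj2 (HE0' _ _)); have [] := F0 i.
Qed.

Lemma ghom_gmul E E' F F' (sg : {perm 'I_K}) : (forall i, E i 1 = F (sg i) 0) ->
  ghom E E' -> ghom F F' -> ghom (gmul E sg F) (gmul E' sg F').
Proof.
move=> EF [H [cH confH clH HE HE0]] [H' [cH' confH' clH' HE' HE0']].
have sw i (J : 'I_K -> RR -> RR -> mx3) : mcts2 (J i) ->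
    mcts (fun p : (RR * RR) * RR => J i p.1.1 p.2).
  by move=> cJ; apply: (mcts_comp2 (F := J i)) => //; [exact: (cts_fst (cts_fst cts_id))|exact: (cts_snd cts_id)].
exists (fun i s => catc (H i s) (H' (sg i) s)); split.
- move=> i; apply: (mcts_catc2 (f := fun (p : RR * RR) t => H i p.1 t)
     (g := fun (p : RR * RR) t => H' (sg i) p.1 t) (a := snd)).
  + exact: sw.
  + exact: sw.
  + by move=> [s t] /=; rewrite (proj2 (HE0 _ _)) (proj1 (HE0' _ _)).
  exact: (cts_snd cts_id).
- move=> s t; rewrite /catc; case: (t <= 2^-1); first exact: confH.
  have [R inj] := confH' s (cl (2 * t - 1)).
  by split=> [i|i j /inj /perm_inj //]; exact: R.
- move=> i s t; rewrite catc_cl /catc; case: ifP => _.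
    by rewrite -[LHS]clH -[RHS]clH !clK.
  by rewrite -[LHS]clH' -[RHS]clH' !clK.
- move=> i t; rewrite /gmul /catc; case: ifP => _; first exact: HE.
  exact: HE'.
by move=> i s; rewrite /gmul !catc0 !catc1 (proj1 (HE0 _ _)) (proj2 (HE0' _ _)).
Qed.

Lemma ghom_ends E F i : ghom E F -> F i 0 = E i 0 /\ F i 1 = E i 1.
Proof.
move=> [H [_ _ _ HE HE0]].
by have [_ <-] := HE i 0; have [_ <-] := HE i 1; rewrite (proj1 (HE0 _ _)) (proj2 (HE0 _ _)).
Qed.

End Ghom.

(* Isotopy extension for the homotopy of the base strands, carrying the other strands along. *)
Lemma exact_rep q K (b : 'I_q -> 'I_K) (G : strands K) (L : RR -> RR) :
  injective b -> gpath G -> cts L -> L 0 = 0 -> (forall t, L (cl t) = L t) ->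
  ghom (fun i => G (b i)) (fun i t => rotP (L t) (zb q i)) ->
  exists E, [/\ gpath E, ghom G E & exact_rot b E L].
Proof.
move=> bI [cG confG clG] cL L0 Lcl [H [cH confH clH HE HE0]].
pose B (i : 'I_q) (r s t : RR) := H i r t.
have cB i : mcts (fun p : RR * (RR * RR) => B i p.1 p.2.1 p.2.2).
  by apply: (mcts_comp2 (F := H i)) => //; [exact: (cts_fst cts_id)|exact: (cts_snd (cts_snd cts_id))].
have RB i r s t : RP2 (B i r s t) by exact: (proj1 (confH r t) i).
have dB i j r s t : i != j -> B i r s t != B j r s t.
  by move=> ij; apply/eqP => h; move/eqP: ij; apply; exact: (proj2 (confH r t)) h.
have clB i r s t : B i r s t = B i (cl r) (cl s) (cl t) by rewrite /B clH.
have [Om [RO injO baseO idO [id0 contO]]] := isotopy cB RB dB clB.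
have RG i t : RP2 (G i t) by have [] := confG t.
pose J i s t := Om (cl s) 0 (cl t) (G i t).
have cJ i : mcts2 (J i).
  apply: contO; [apply: cts_cl; exact: (cts_fst cts_id)|exact: cts_cst|apply: cts_cl; exact: (cts_snd cts_id)| |by move=> x; exact: RG].
  exact: (mcts_precomp (g := fun p : RR * RR => p.2) (cts_snd cts_id) (@cG i)).
have confJ s t : in_conf (fun i => J i s t).
  split=> [i|i j /(injO _ _ _ _ _ (RG _ _) (RG _ _))]; first exact: RO.
  exact: (proj2 (confG t)).
have clJ i s t : J i (cl s) (cl t) = J i s t by rewrite /J !clK clG.
exists (fun i => J i 1); split.
- split=> //; last by move=> i t; rewrite -[RHS]clJ cl1.
  by move=> i; apply: (mcts_comp2 (F := J i)) => //; [exact: cts_cst|exact: cts_id].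
- exists J; split=> //.
    by move=> i t; split=> //; rewrite /J cl0 id0.
  move=> i s; rewrite /J; split.
    rewrite !idO // => k r; rewrite /B cl0 !(proj1 (HE0 _ _)) //.
  rewrite !idO // => k r; rewrite /B cl1 !(proj2 (HE0 _ _)) //.
- split=> // i t; rewrite /J cl1.
  have := baseO i 1 0 (cl t); rewrite /B => h.
  by have [e1 e2] := HE i (cl t); rewrite e1 e2 clG Lcl in h.
Qed.

(** * Monodromy of two fixed strands *)

Definition ang (q e : nat) (t : RR) : RR := pi *+ e / q%:R * cl t.

Lemma cts_ang q e : cts (ang q e).
Proof. by apply: ctsM; [exact: cts_cst|apply: cts_cl; exact: cts_id]. Qed.

(** What is retained of the section: [G e] stands for the image of the rotation by pi e / q,
    multiplicative only up to homotopy. The period 4 q is the number of steps in the angle 4 pi. *)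
Record braid_seq (q K : nat) (b : 'I_q -> 'I_K) (z : 'I_K -> mx3)
    (G : nat -> strands K) (tau : {perm 'I_K}) : Prop := BraidSeq {
  bs_q : (2 <= q)%N;
  bs_inj : injective b;
  bs_path : forall e, gpath (G e);
  bs_0 : forall e i, G e i 0 = z i;
  bs_1 : forall e i, G e i 1 = z ((tau ^+ e)%g i);
  bs_base : forall i, z (b i) = zb q i;
  bs_mul : forall e f, ghom (G (e + f)%N) (gmul (G e) (tau ^+ e)%g (G f));
  bs_rot : forall e, ghom (fun i => G e (b i)) (fun i t => rotP (ang q e t) (zb q i));
  bs_per : forall e, ghom (G (4 * q * e)%N) (G 0%N) }.

Section Seq.
Variables (q K : nat) (b : 'I_q -> 'I_K) (z : 'I_K -> mx3)
    (G : nat -> strands K) (tau : {perm 'I_K}).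
Hypothesis BS : braid_seq b z G tau.

Let q2 : (2 <= q)%N := bs_q BS.
Let q0 : (0 < q)%N. Proof. exact: leq_trans q2. Qed.

Lemma z_inj : injective z.
Proof.
have [_ /(_ 0) [_ h] _] := bs_path BS 0.
by move=> i j e; apply: h; rewrite !(bs_0 BS).
Qed.

Lemma tau_base e i : exists2 i', (tau ^+ e)%g (b i) = b i' & zb q i' = rotP (pi *+ e / q%:R) (zb q i).
Proof.
have ok : ((e + i) %% q < q)%N by rewrite ltn_mod.
exists (Ordinal ok); last by rewrite zb_rot /= zb_mod.
apply: z_inj; rewrite -(bs_1 BS) (bs_base BS) /= zb_mod // -zb_rot.
have [_ h] := ghom_ends i (bs_rot BS e).
by rewrite -h /ang cl1 mulr1.
Qed.

Lemma gpath_cat e (E E' : strands K) : gpath E -> gpath E' -> (forall i, E i 1 = z ((tau ^+ e)%g i)) ->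
  (forall i, E' i 0 = z i) -> gpath (gmul E (tau ^+ e)%g E').
Proof. by move=> p p' h h'; apply: gpath_gmul => // i; rewrite h h'. Qed.

(** The second factor is entered through tau^e, which renumbers the base lines exactly as a rotation
    by L 1 does ([tau_base]); hence the angles add. *)
Lemma exact_gmul e (E E' : strands K) (L L' : RR -> RR) : exact_rot b E L -> exact_rot b E' L' -> L 1 = pi *+ e / q%:R ->
  exact_rot b (gmul E (tau ^+ e)%g E') (catc L (fun t => L 1 + L' t)).
Proof.
move=> [cL L0 Lcl xE] [cL' L'0 L'cl xE'] L1; split.
- apply: cts_catc => //; first by apply: ctsD => //; exact: cts_cst.
  by rewrite L'0 addr0.
- by rewrite catc0.
- by move=> t; rewrite catc_cl.
move=> i t; rewrite /gmul /catc; case: ifP => _; first exact: xE.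
have [i' -> h] := tau_base e i.
by rewrite xE' h rotPD L1 addrC.
Qed.

Lemma inframe_gmul e (E E' : strands K) (L L' : RR -> RR) j t : (tau ^+ e)%g j = j ->
  inframe (gmul E (tau ^+ e)%g E') (catc L (fun t => L 1 + L' t)) j t =
  catc (inframe E L j) (fun t => rotP (- L 1) (inframe E' L' j t)) t.
Proof.
move=> h; rewrite /inframe /gmul h /catc; case: ifP => _ //.
by rewrite rotPD opprD.
Qed.

Lemma inframe_avoid (E : strands K) (L : RR -> RR) j t i : gpath E -> exact_rot b E L -> b i != j -> inframe E L j t <> zb q i.
Proof.
move=> [_ conf _] [_ _ _ xE] ij h.
have : E j t = E (b i) t by rewrite xE -h /inframe rotPKV.
by move/(proj2 (conf t)) => e; rewrite e eqxx in ij.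
Qed.

Lemma mcts_inframe (E : strands K) (L : RR -> RR) j : gpath E -> exact_rot b E L -> mcts (inframe E L j).
Proof. by move=> [cE _ _] [cL _ _ _]; apply: mcts_rotP => //; exact: ctsN. Qed.

Lemma RP2_inframe (E : strands K) (L : RR -> RR) j t : gpath E -> RP2 (inframe E L j t).
Proof. by move=> [_ conf _]; apply: RP2_rotP; exact: (proj1 (conf t)). Qed.

Lemma inframe_cl (E : strands K) (L : RR -> RR) j t : gpath E -> exact_rot b E L -> inframe E L j (cl t) = inframe E L j t.
Proof. by move=> [_ _ clE] [_ _ Lcl _]; rewrite /inframe Lcl clE. Qed.

Lemma path_lift (y : RR -> mx3) (v0 : vec) : mcts y -> (forall t, RP2 (y t)) ->
  (forall t, y (cl t) = y t) -> dotv v0 v0 = 1 -> y 0 = lin v0 ->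
  exists v : RR -> vec, [/\ mcts v, forall t, dotv (v t) (v t) = 1, forall t, y t = lin (v t),
     v 0 = v0 & forall t, v (cl t) = v t].
Proof.
move=> cy hy cly v01 y0.
have cQ : mcts (fun p : RR * RR => (fun _ t => y t) p.1 p.2).
  exact: (mcts_precomp (g := fun p : RR * RR => p.2) (cts_snd cts_id) cy).
have [v [cv vu vQ v00 vcl]] := sphere_lift cQ (fun _ t => hy t) v01 y0.
exists (v 0); split=> //.
- by apply: (mcts_comp2 (F := v)) => //; [exact: cts_cst|exact: cts_id].
- by move=> t; rewrite -vQ cly.
- by move=> t; rewrite -[RHS]vcl cl0.
Qed.

Lemma exact_seq e : exists E L, [/\ gpath E, ghom (G e) E, exact_rot b E L & L 1 = pi *+ e / q%:R].
Proof.
have [] := @exact_rep q K b (G e) (ang q e) (bs_inj BS) (bs_path BS e) (@cts_ang q e) _ _ (bs_rot BS e).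
- by rewrite /ang cl0 mulr0.
- by move=> t; rewrite /ang clK.
by move=> E [pE hE xE]; exists E, (ang q e); split=> //; rewrite /ang cl1 mulr1.
Qed.

Lemma hom_0 e (E : strands K) i : ghom (G e) E -> E i 0 = z i.
Proof. by move=> /(ghom_ends i) [-> _]; rewrite (bs_0 BS). Qed.
Lemma hom_1 e (E : strands K) i : ghom (G e) E -> E i 1 = z ((tau ^+ e)%g i).
Proof. by move=> /(ghom_ends i) [_ ->]; rewrite (bs_1 BS). Qed.

Lemma hom_gmul e f (E F : strands K) : ghom (G e) E -> ghom (G f) F ->
  ghom (G (e + f)%N) (gmul E (tau ^+ e)%g F).
Proof.
move=> hE hF; apply: ghom_trans (bs_mul BS e f) _; apply: ghom_gmul => // i.
by rewrite (bs_1 BS) (bs_0 BS).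
Qed.

(* Doubling the exponent makes the sphere lifts of the two fixed strands return to
   themselves, not to their antipodes. *)
Lemma double_lift l j (v0 : vec) (E : strands K) (L : RR -> RR) : (tau ^+ l)%g j = j -> gpath E -> ghom (G l) E ->
  exact_rot b E L -> L 1 = pi *+ l / q%:R -> z j = lin v0 -> dotv v0 v0 = 1 ->
  exists v : RR -> vec, [/\ mcts v, forall t, dotv (v t) (v t) = 1,
    forall t, inframe (gmul E (tau ^+ l)%g E) (catc L (fun t => L 1 + L t)) j t = lin (v t),
    v 0 = v0 /\ (forall t, v (cl t) = v t) & v 1 = Rz (- (L 1 + L 1)) *m v0].
Proof.
move=> tj pE hE xE L1 zj v0u.
have y0 : inframe E L j 0 = lin v0.
  by have [_ L0 _ _] := xE; rewrite /inframe L0 oppr0 rotP0 (hom_0 _ hE).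
have [v [cv vu vQ v00 vcl]] := path_lift (@mcts_inframe _ _ j pE xE) (fun t => RP2_inframe L j t pE)
   (fun t => inframe_cl j t pE xE) v0u y0.
have [s s2 v1] : exists2 s : RR, s ^+ 2 = 1 & v 1 = s *: (Rz (- L 1) *m v0).
  have h : lin (v 1) = lin (Rz (- L 1) *m v0).
    by rewrite -vQ /inframe (hom_1 _ hE) tj zj rotP_lin.
  have [s e s2] := lin_inj (vu 1) h; exists s => //.
  by move: s2; rewrite Rz_dotv v0u mulr1.
pose w t := s *: (Rz (- L 1) *m v t).
have wu t : dotv (w t) (w t) = 1 by rewrite dotvZl dotvZr mulrA -expr2 s2 mul1r Rz_dotv.
have cw : mcts w.
  by apply: mctsZ; [exact: cts_cst|apply: mctsM => //; exact: mcts_cst].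
exists (catc v w); split.
- by apply: mcts_catc => //; rewrite v1 /w v00.
- by move=> t; rewrite /catc; case: ifP => _.
- move=> t; rewrite inframe_gmul // /catc; case: ifP => _; first exact: vQ.
  by rewrite /w linZ s2 scale1r -rotP_lin -vQ.
- by split=> [|t]; rewrite ?catc0 ?catc_cl.
rewrite catc1 /w v1 -scalemxAr scalerA -expr2 s2 scale1r mulmxA RzD; congr (Rz _ *m _).
by rewrite opprD.
Qed.

(** After the doubled exponent, the vector below u is the starting one rotated by - L 1. The twist
    of u0 with phase 1 lies over it too, so u 1 differs from that twist by a phase k, and positivity
    of [Pq] at both gives k^q = 1. *)
Lemma unit_lift l j1 j2 (v10 v20 : vec) (u0 : spinor) :
  (tau ^+ l)%g j1 = j1 -> (tau ^+ l)%g j2 = j2 -> (forall i, b i != j1) ->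
  z j1 = lin v10 -> z j2 = lin v20 -> dotv v20 v20 = 1 ->
  unit_spinor u0 -> hopf u0 = v10 -> 0 < Pq q u0 ->
  exists E L (u : RR -> spinor) (v : RR -> vec) k,
  [/\ [/\ gpath E, ghom (G (l + l)%N) E, exact_rot b E L & L 1 = pi *+ (l + l) / q%:R],
      [/\ ccts (fun t => (u t).1), ccts (fun t => (u t).2), mcts v &
         forall t, u (cl t) = u t /\ v (cl t) = v t],
      forall t, [/\ unit_spinor (u t), 0 < Pq q (u t), inframe E L j1 t = lin (hopf (u t)),
                    dotv (v t) (v t) = 1 & inframe E L j2 t = lin (v t)],
      [/\ u 0 = u0, v 0 = v20, nsq k = 1 & k ^+ q = 1] &
      u 1 = twist k (cis (L 1)) u0 /\ v 1 = Rz (- L 1) *m v20].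
Proof.
move=> t1 t2 bj1 z1 z2 v2u u0u hu0 P0.
have v1u : dotv v10 v10 = 1 by rewrite -hu0 hopf_unit.
have [E [L [pE hE xE L1]]] := exact_seq l.
have [v [cv vu vQ [v0 vcl] v1]] := double_lift t1 pE hE xE L1 z1 v1u.
have [w [cw wu wQ [w0 wcl] w1]] := double_lift t2 pE hE xE L1 z2 v2u.
set E2 := gmul E (tau ^+ l)%g E in vQ wQ; set L2 := catc L (fun t => L 1 + L t) in vQ wQ.
have pE2 : gpath E2.
  by apply: gpath_cat => // i; [rewrite (hom_1 _ hE)|rewrite (hom_0 _ hE)].
have xE2 : exact_rot b E2 L2 by exact: exact_gmul.
have L21 : L2 1 = L 1 + L 1 by rewrite /L2 catc1.
have cV : mcts (fun p : RR * RR => (fun _ t => v t) p.1 p.2).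
  exact: (mcts_precomp (g := fun p : RR * RR => p.2) (cts_snd cts_id) cv).
have av (s t : RR) : ~ (Z3 (v t) = 0 /\ xy (v t) ^+ q = 1).
  by apply: (base_avoid q2) => // i; rewrite -vQ; apply: inframe_avoid => //; exact: bj1.
have [u [cu1 cu2 uP u00 ucl]] := spinor_lift q0 cV (fun _ => vu) (fun _ => vcl) av u0u (etrans hu0 (esym v0)) P0.
have [uu uh up] := uP 0 1.
(* Here the doubling matters again: the angle is 2 pi l / q, so the twist leaves [Pq] unchanged. *)
have lq : cis (L2 1) ^+ q = 1.
  by rewrite L21 L1 -mulrDl -mulrnDr; exact: cis_root.
have tw : unit_spinor (twist 1 (cis (L2 1)) u0).
  by apply: unit_twist => //; [rewrite /nsq /= expr0n expr1n addr0|exact: nsq_cis].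
have n1 : nsq 1 = 1 by rewrite /nsq /= expr0n expr1n addr0.
have he : hopf (u 0 1) = hopf (twist 1 (cis (L2 1)) u0).
  by rewrite uh v1 -L21 -[L2 1 in RHS]opprK hopf_twist // hu0.
have [k k1 ek] := hopf_inj uu tw he.
have kq : k ^+ q = 1.
  move: up; rewrite ek Pq_scale Pq_twist // expr1n mul1r pmulr_lgt0 // => zq.
  have zz : nsq (k ^+ q) = 1 by rewrite nsqX k1 expr1n.
  move: zq zz; rewrite ltcE; case: (k ^+ q) => x y /= /andP[/eqP -> a0].
  by rewrite /nsq /= expr0n addr0 => /eqP; rewrite sqrp_eq1 ?ltW // => /eqP ->.
exists E2, L2, (u 0), w, k; split.
- split=> //; first exact: hom_gmul.
  by rewrite L21 L1 mulrnDr mulrDl.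
- have gt : continuous (fun t : RR => ((0 : RR), t)).
    by apply: (pair_cts (f := fun _ : RR => (0 : RR)) (g := fun t : RR => t)); [exact: cts_cst|exact: cts_id].
  split=> //.
  + exact: (ccts_precomp gt cu1).
  + exact: (ccts_precomp gt cu2).
  by move=> t; split=> //; rewrite -[RHS]ucl cl0.
- by move=> t; have [h1 h2 h3] := uP 0 t; split=> //; rewrite h2.
- by [].
by rewrite ek /twist /= !mul1r mulrA w1 L21.
Qed.

End Seq.

Lemma lifts_catc q Phi (y1 y2 y1' y2' : RR -> mx3) (e e' : RR -> Ed) :
  lifts q Phi y1 y2 e -> lifts q Phi y1' y2' e' -> e 1 = e' 0 ->
  lifts q Phi (catc y1 y1') (catc y2 y2') (catc e e').
Proof.
move=> [[c1 c2 c3 c4] h] [[d1 d2 d3 d4] h'] ee; split; last first.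
  by move=> t; rewrite /catc; case: (t <= 2^-1).
split.
- by rewrite (catcE (fun x : Ed => x.1.1.1)); apply: ccts_catc => //; rewrite ee.
- by rewrite (catcE (fun x : Ed => x.1.1.2)); apply: ccts_catc => //; rewrite ee.
- by rewrite (catcE (fun x : Ed => x.1.2)); apply: mcts_catc => //; rewrite ee.
by rewrite (catcE (fun x : Ed => x.2)); apply: cts_catc => //; rewrite ee.
Qed.

(** A symmetry of the covering over the rotation of both lines by - a: Phi must be multiplied by
    e^(ic), so the argument is translated by c. It moves a lift over one turn to a lift over the
    next. *)
Definition gact (k : CC) (a c : RR) (e : Ed) : Ed :=
  (twist k (cis a) e.1.1, Rz (- a) *m e.1.2, e.2 + c).

Lemma over_gact q Phi k a c y1 y2 e : nsq k = 1 -> k ^+ q = 1 -> cis a ^+ q = 1 ->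
  (forall u v, Phi (twist k (cis a) u) (Rz (- a) *m v) = cis c * Phi u v) ->
  over q Phi y1 y2 e -> over q Phi (rotP (- a) y1) (rotP (- a) y2) (gact k a c e).
Proof.
move=> k1 kq aq inv [u1 P0 -> [v1 ->] [r r0 er]]; split=> /=.
- by apply: unit_twist => //; exact: nsq_cis.
- by rewrite Pq_twist // kq mul1r.
- by rewrite -[cis a](congr1 cis (opprK a)) hopf_twist // rotP_lin.
- by rewrite Rz_dotv rotP_lin.
by exists r => //; rewrite inv er cisD mulrCA [cis e.2 * _]mulrC.
Qed.

Lemma ects_gact k a c (e : RR -> Ed) : ects e -> ects (fun t => gact k a c (e t)).
Proof.
move=> [c1 c2 c3 c4]; split=> /=.
- by apply: cctsM => //; exact: ccts_cst.
- by apply: cctsM => //; exact: ccts_cst.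
- by apply: mctsM => //; exact: mcts_cst.
- by apply: ctsD => //; exact: cts_cst.
Qed.

Lemma iter_gact_arg k a c n e : (iter n (gact k a c) e).2 = e.2 + c *+ n.
Proof. by elim: n => [|n IH] /=; rewrite ?addr0 // IH -addrA mulrSr. Qed.

Lemma lifts_iter q Phi k a c n (y1 y2 : RR -> mx3) (e : RR -> Ed) : nsq k = 1 -> k ^+ q = 1 ->
  cis a ^+ q = 1 -> (forall u v, Phi (twist k (cis a) u) (Rz (- a) *m v) = cis c * Phi u v) ->
  lifts q Phi y1 y2 e -> lifts q Phi (fun t => rotP (- (a *+ n)) (y1 t)) (fun t => rotP (- (a *+ n)) (y2 t))
     (fun t => iter n (gact k a c) (e t)).
Proof.
move=> k1 kq aq inv le; elim: n => [|n IH].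
  by apply: lifts_ext le => t; rewrite mulr0n oppr0 rotP0.
split; first by apply: ects_gact; have [] := IH.
move=> t; rewrite mulrS opprD -!rotPD; apply: over_gact => //.
by have [_ /(_ t)] := IH.
Qed.

Lemma spinor_ex q (v : vec) : (0 < q)%N -> dotv v v = 1 -> Z3 v != 0 ->
  exists u, [/\ unit_spinor u, hopf u = v & 0 < Pq q u].
Proof.
move=> q0 v1 zv.
have xv : X3 v != 1.
  apply: contra zv => /eqP x1; move: v1; rewrite dotv3 x1 => h.
  rewrite -sqrf_eq0; apply/eqP; have := sqr_ge0 (Y3 v); have := sqr_ge0 (Z3 v).
  rewrite !expr2; lra.
have [_ /= ] := gauge_spec v1 xv; set w := (_, _) => w1 hw.
have Pw : Pq q w != 0.
  by apply/eqP => /(Pq_eq0 q0 w1) [z0 _]; rewrite hw in z0; rewrite z0 eqxx in zv.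
have [h Ph r0] := cis_nsq Pw.
pose k := cis (- h / q%:R).
have k1 : nsq k = 1 by exact: nsq_cis.
exists (k * w.1, k * w.2); split.
- exact: unit_scale.
- rewrite -hw; have -> : (k * w.1, k * w.2) = twist k (cis (- 0)) w.
    by rewrite /twist oppr0 cis0 mulr1.
  by rewrite hopf_twist // Rz0 mul1mx.
rewrite Pq_scale -cisMn -(mulr_natr (_ / _)) divfK ?pnatr_eq0 -?lt0n // Ph mulrCA -cisD addNr cis0 mulr1.
by rewrite ltcR.
Qed.

Section Monodromy.
Variables (q K : nat) (b : 'I_q -> 'I_K) (z : 'I_K -> mx3)
    (G : nat -> strands K) (tau : {perm 'I_K}).
Hypothesis BS : braid_seq b z G tau.
Let q2 : (2 <= q)%N := bs_q BS.
Let q0 : (0 < q)%N. Proof. exact: leq_trans q2. Qed.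

Variables (l : nat) (j1 j2 : 'I_K) (E : strands K) (L : RR -> RR)
  (u : RR -> spinor) (v : RR -> vec) (k : CC).
Hypotheses (t1 : (tau ^+ l)%g j1 = j1) (t2 : (tau ^+ l)%g j2 = j2) (j12 : j1 != j2)
  (bj1 : forall i, b i != j1) (bj2 : forall i, b i != j2)
  (EL : [/\ gpath E, ghom (G (l + l)%N) E, exact_rot b E L & L 1 = pi *+ (l + l) / q%:R])
  (cuv : [/\ ccts (fun t => (u t).1), ccts (fun t => (u t).2), mcts v &
         forall t, u (cl t) = u t /\ v (cl t) = v t])
  (uv : forall t, [/\ unit_spinor (u t), 0 < Pq q (u t), inframe E L j1 t = lin (hopf (u t)),
                    dotv (v t) (v t) = 1 & inframe E L j2 t = lin (v t)])
  (kk : nsq k = 1 /\ k ^+ q = 1)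
  (uv1 : u 1 = twist k (cis (L 1)) (u 0) /\ v 1 = Rz (- L 1) *m v 0)
  (zz : Z3 (hopf (u 0)) != 0 /\ Z3 (v 0) != 0).

Let aq : cis (L 1) ^+ q = 1.
Proof.
have [_ _ _ ->] := EL; exact: cis_root.
Qed.

(* The monodromy acts on the argument of Phi by a translation; a power of the braid that is
   homotopic to the trivial braid must act trivially. *)
Lemma monodromy_trivial Phi mu : admissible q Phi -> nsq mu = 1 ->
  (forall u v, Phi (twist k (cis (L 1)) u) (Rz (- L 1) *m v) = mu * Phi u v) -> mu = 1.
Proof.
move=> adm mu1 inv.
have [k1 kq] := kk; have [pE hE xE L1] := EL; have [cu1 cu2 cv uvcl] := cuv.
have ne t : inframe E L j1 t <> inframe E L j2 t.
  move=> /rotP_inj; have [_ /(_ t) [_ h] _] := pE.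
  by move/h => e; move: j12; rewrite e eqxx.
have Pn t : Phi (u t) (v t) != 0.
  by have [h1 h2 h3 h4 h5] := uv t; apply: adm.2 => //; rewrite -h3 -h5.
have [h0 e00 r0] := cis_nsq (Pn 0).
have [] := @arg_lift (fun _ t => Phi (u t) (v t)) h0 _ _ (fun _ => Pn) _ r0 e00.
- apply: (ccts_precomp (f := fun t => Phi (u t) (v t)) (g := fun p : RR * RR => p.2)).
    exact: (cts_snd cts_id).
  exact: adm.1.
- by move=> s t; have [-> ->] := uvcl t.
move=> h [ch hP h00 hcl].
pose e t : Ed := (u t, v t, h 0 t).
have le : lifts q Phi (inframe E L j1) (inframe E L j2) e.
  split.
    split=> //=; apply: (cts_comp2 (F := h)) => //; [exact: cts_cst|exact: cts_id].
  move=> t; have [h1 h2 h3 h4 h5] := uv t; split=> //.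
  by exists (Num.sqrt (nsq (Phi (u t) (v t)))); [rewrite sqrtr_gt0 nsq_gt0|exact: hP].
pose c := h 0 1 - h0.
have mc : mu = cis c.
  have := hP 0 1; have [-> ->] := uv1; rewrite inv nsqM mu1 mul1r {1}e00 mulrCA.
  have rn : (Num.sqrt (nsq (Phi (u 0) (v 0))))%:C%C != 0.
    by rewrite eq_complex /= negb_and gt_eqF.
  by move=> /(mulfI rn) e1; rewrite /c cisD -e1 -mulrA -cisD subrr cis0 mulr1.
have {}inv u' v' : Phi (twist k (cis (L 1)) u') (Rz (- L 1) *m v') = cis c * Phi u' v'.
  by rewrite inv mc.
have e1 : e 1 = gact k (L 1) c (e 0).
  by rewrite /e /gact /= h00 /c addrC subrK; have [-> ->] := uv1.
(* The lift over n + 1 copies of the braid is a chain of translates of e by powers of the monodromy;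
   each copy adds c to the argument. *)
have P n : exists E' L' e', [/\ [/\ gpath E', ghom (G ((l + l) * n.+1)%N) E', exact_rot b E' L' &
      L' 1 = L 1 *+ n.+1],
    lifts q Phi (inframe E' L' j1) (inframe E' L' j2) e' &
    e' 0 = e 0 /\ e' 1 = iter n.+1 (gact k (L 1) c) (e 0)].
  elim: n => [|n [E' [L' [e' [[pE' hE' xE' L'1] le' [e'0 e'1]]]]]].
    by exists E, L, e; rewrite muln1.
  have pi2 : L' 1 = pi *+ ((l + l) * n.+1) / q%:R.
    by rewrite L'1 L1 mulrnA -mulrnAl.
  have tl j : (tau ^+ l)%g j = j -> (tau ^+ ((l + l) * n.+1))%g j = j.
    move=> h'; have -> : ((l + l) * n.+1 = l * (2 * n.+1))%N by lia.
    rewrite expgM; elim: (2 * n.+1)%N => [|p IH]; first by rewrite expg0 perm1.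
    by rewrite expgS permM h'.
  exists (gmul E' (tau ^+ ((l + l) * n.+1))%g E), (catc L' (fun t => L' 1 + L t)),
     (catc e' (fun t => iter n.+1 (gact k (L 1) c) (e t))); split.
  - split.
    + apply: (gpath_cat pE' pE) => i; first exact: (hom_1 BS _ hE').
      exact: (hom_0 BS _ hE).
    + by rewrite [((l + l) * n.+2)%N]mulnS addnC; exact: (hom_gmul BS hE' hE).
    + exact: (exact_gmul BS xE' xE pi2).
    + by rewrite catc1 L'1 -mulrSr.
  - have lr := lifts_iter n.+1 k1 kq aq inv le; rewrite -L'1 in lr.
    have := lifts_catc le' lr e'1.
    by apply: lifts_ext => t; rewrite inframe_gmul // tl.
  by rewrite catc0 catc1 e1 -iterSr.
(* Products of 2 q and of 4 q copies are compared: both exponents, 4 q l and 8 q l, are multiples of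
   the period, and both frame angles, 4 pi l and 8 pi l, are whole turns. Equal end points give 2 q
   c = 4 q c. *)
have q4 : exists n, (n.+1 = 2 * q)%N by exists (2 * q).-1; lia.
have q8 : exists n, (n.+1 = 4 * q)%N by exists (4 * q).-1; lia.
case: q4 => n hn; case: q8 => n' hn'.
have [E1 [L1' [e1' [[p1 h1 x1 l1] le1 [e10 e11]]]]] := P n.
have [E2 [L2' [e2' [[p2 h2 x2 l2] le2 [e20 e21]]]]] := P n'.
have h12 : ghom E1 E2.
  apply: ghom_trans (ghom_sym h1) _; apply: ghom_trans h2.
  have -> : ((l + l) * n.+1 = 4 * q * l)%N by lia.
  have -> : ((l + l) * n'.+1 = 4 * q * (2 * l))%N by lia.
  apply: ghom_trans (bs_per BS _) _; exact: ghom_sym (bs_per BS _).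
have Rt p : Rz (L 1 *+ (p * (2 * q))%N) = 1%:M.
  have -> : L 1 *+ (p * (2 * q))%N = pi *+ 2 *+ (2 * l * p).
    have -> : (p * (2 * q) = q * (2 * p))%N by lia.
    rewrite mulrnA -(mulr_natr (L 1)) L1 divfK ?pnatr_eq0 -?lt0n // -!mulrnA; congr (_ *+ _); lia.
  exact: Rz_turns.
have := frame_change q2 (bs_inj BS) j12 bj1 bj2 adm p1 p2 h12 x1 x2 _ le1 le2 _.
rewrite l1 l2 hn hn' e10 e20 e11 e21.
have := Rt 1%N; rewrite mul1n => ->.
have := Rt 2; have -> : (2 * (2 * q) = 4 * q)%N by lia.
move=> -> /(_ erefl erefl zz.1 zz.2) /(congr1 (fun x : Ed => x.2)).
rewrite !iter_gact_arg => /addrI h'.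
have c0 : c = 0.
  have : c *+ (2 * q) = 0.
    have -> : c *+ (2 * q) = c *+ (4 * q) - c *+ (2 * q).
      by rewrite -mulrnBr; [congr (_ *+ _)|]; lia.
    by rewrite hn hn' in h'; rewrite -h' subrr.
  by move=> /eqP; rewrite mulrn_eq0 => /orP[|/eqP //]; lia.
by rewrite mc c0 cis0.
Qed.

End Monodromy.

Lemma admissible_T q : admissible q Tfun.
Proof.
split; last by move=> u v u1 _ v1; exact: Tfun_neq0.
move=> T u v cu1 cu2 cv; have cxy := ccts_xy cv.
have cZ : ccts (fun t => (Z3 (v t))%:C%C).
  by split; [exact: (cv _ _)|exact: cts_cst].
rewrite /Tfun; apply: cctsB.
  apply: cctsD; first by apply: cctsM; [exact: cctsM|exact: cctsJ].
  by apply: cctsM => //; apply: cctsM => //; apply: cctsM => //; exact: ccts_cst.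
by apply: cctsM => //; exact: cctsM.
Qed.

Lemma admissible_F q : admissible q (fun u _ => Ffun u).
Proof.
split; last by move=> u v _ P0 _ _; exact: (Ffun_neq0 P0).
by move=> T u v cu1 cu2 _; apply: cctsB => //; exact: cctsJ.
Qed.

(** Both strands start off the equator so that the straight segments in [loop_closed] reach the
    plane of the base lines only at their ends. *)
Lemma fixed_strands_dvd q K (b : 'I_q -> 'I_K) z G (tau : {perm 'I_K}) l (j1 j2 : 'I_K) (v1 v2 : vec) :
  braid_seq b z G tau -> (tau ^+ l)%g j1 = j1 -> (tau ^+ l)%g j2 = j2 -> j1 != j2 ->
  (forall i, b i != j1) -> (forall i, b i != j2) ->
  dotv v1 v1 = 1 -> z j1 = lin v1 -> Z3 v1 != 0 ->
  dotv v2 v2 = 1 -> z j2 = lin v2 -> Z3 v2 != 0 -> (q %| l)%N.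
Proof.
move=> BS t1 t2 j12 bj1 bj2 v11 z1 Zv1 v21 z2 Zv2.
have q2 := bs_q BS; have q0 : (0 < q)%N by exact: leq_trans q2.
have [u0 [u01 hu0 P0]] := spinor_ex q0 v11 Zv1.
have [E [L [u [v [k [EL cuv uv [u00 v00 k1 kq] uv1]]]]]] :=
  unit_lift BS t1 t2 bj1 z1 z2 v21 u01 hu0 P0.
rewrite -u00 -v00 in uv1.
have zz : Z3 (hopf (u 0)) != 0 /\ Z3 (v 0) != 0 by rewrite u00 v00 hu0.
have mt := monodromy_trivial BS t1 t2 j12 bj1 bj2 EL cuv uv (conj k1 kq) uv1 zz.
have kc : k ^+ 2 * cis (L 1) = 1.
  apply: (mt Tfun); [exact: admissible_T|by rewrite nsqM nsqX k1 expr1n mul1r nsq_cis|].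
  by move=> u' v'; rewrite -{1}[L 1]opprK Tfun_twist opprK.
have k11 : k = 1.
  apply: (mt (fun u _ => Ffun u)) => //; first exact: admissible_F.
  by move=> u' v'; exact: Ffun_twist.
move: kc; rewrite k11 expr1n mul1r => /cis_eq1 [j].
have [_ _ _ ->] := EL => e.
have : (l%:Z = j * q%:Z)%R.
  have qn0 : q%:R != 0 :> RR by rewrite pnatr_eq0 -lt0n.
  have p0 : pi *+ 2 != 0 :> RR by rewrite mulrn_eq0 /= gt_eqF // pi_gt0.
  apply/eqP; rewrite -(eqr_int RR) intrM; apply/eqP/(mulIf p0).
  move/(congr1 (fun x => x * q%:R)): e; rewrite divfK // => e.
  have -> : (l%:Z)%:~R * (pi *+ 2) = pi *+ (l + l) :> RR.
    by rewrite -[RHS]mulr_natr -[pi *+ 2]mulr_natr addnn -mul2n natrM; ring.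
  by rewrite e; ring.
move=> h; have : (q%:Z %| l%:Z)%Z by rewrite h; exact: dvdz_mull.
by [].
Qed.

(** * Change of base points *)

(** Applied with c a clamp, this trades continuity within the interval or the square for continuity
    everywhere. *)
Lemma within_precomp (T U V : topologicalType) (A : set T) (f : T -> U) (c : V -> T) :
  {within A, continuous f} -> continuous c -> (forall x, A (c x)) -> continuous (fun x => f (c x)).
Proof.
move=> /subspace_continuousP cf cc Ac x; apply: cvg_trans (cf _ (Ac x)).
move=> B hB; have := cc x _ hB; rewrite !/(nbhs _) /=; apply: filterS => y; apply; exact: Ac.
Qed.

Definition clp K (g : strands K) : strands K := fun i t => g i (cl t).

Lemma gpath_clp K (g : strands K) : kpath g -> gpath (clp g).
Proof.
move=> [cg conf]; split.
- move=> i; apply/mctsP; apply: (within_precomp (cg i)); last exact: cl_I.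
  by apply: cts_cl; exact: cts_id.
- by move=> t; apply: conf; exact: cl_I.
by move=> i t; rewrite /clp clK.
Qed.

Lemma kpath_gpath K (E : strands K) : gpath E -> kpath E.
Proof. by move=> [cE conf _]; split=> // i; apply: continuous_subspaceT; apply/mctsP; exact: cE. Qed.

Lemma ghom_homotopic K (E F : strands K) : ghom E F -> homotopic E F.
Proof.
move=> [H [cH conf _ HE HE0]]; exists H; split; [|split; [|split]] => //.
  by move=> i; apply: continuous_subspaceT; apply/mctsP; exact: cH.
Qed.

Lemma homotopic_ghom K (g h : strands K) : homotopic g h -> ghom (clp g) (clp h).
Proof.
move=> [H [cH [conf [HE HE0]]]]; exists (fun i s t => H i (cl s) (cl t)); split.
- move=> i; apply/mctsP.
  apply: (within_precomp (f := fun p : RR * RR => H i p.1 p.2) (c := fun p : RR * RR => (cl p.1, cl p.2)) (cH i)).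
    apply: (pair_cts (f := fun p : RR * RR => cl p.1) (g := fun p : RR * RR => cl p.2)); apply: cts_cl.
      exact: (cts_fst cts_id).
    exact: (cts_snd cts_id).
  by move=> p; split; exact: cl_I.
- by move=> s t; apply: conf; exact: cl_I.
- by move=> i s t; rewrite !clK.
- by move=> i t; rewrite cl0 cl1; apply: HE; exact: cl_I.
by move=> i s; rewrite /clp cl0 cl1; apply: HE0; exact: cl_I.
Qed.

Lemma clp_id K (E : strands K) : gpath E -> clp E = E.
Proof. by move=> [_ _ clE]; apply/funext => i; apply/funext => t; exact: clE. Qed.

Lemma clp_bmul K (g h : strands K) sg : clp (bmul g sg h) = gmul (clp g) sg (clp h).
Proof.
apply/funext => i; apply/funext => t; rewrite /gmul -catc_cl /clp /bmul /catc.
have /andP[c0 c1] := cl_I t; have [ht|ht] := leP (cl t) 2^-1.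
  by rewrite (@clK (2 * cl t)) (@cl_id (2 * cl t)) //; apply/andP; split; lra.
by rewrite (@clK (2 * cl t - 1)) (@cl_id (2 * cl t - 1)) //; apply/andP; split; lra.
Qed.

Lemma bmul_gmul K (E F : strands K) sg : gpath E -> gpath F -> bmul E sg F = gmul E sg F.
Proof.
move=> [_ _ clE] [_ _ clF]; apply/funext => i; apply/funext => t; rewrite /gmul /bmul /catc.
by rewrite clE clF.
Qed.

Definition gbraid K (b : 'I_K -> mx3) (E : strands K) (sg : {perm 'I_K}) : Prop :=
  gpath E /\ forall i, E i 0 = b i /\ E i 1 = b (sg i).

Lemma gbraid_gmul K (b : 'I_K -> mx3) E F (sg tau : {perm 'I_K}) : gbraid b E sg -> gbraid b F tau ->
  gbraid b (gmul E sg F) (sg * tau)%g.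
Proof.
move=> [pE hE] [pF hF]; split.
  by apply: gpath_gmul => // i; rewrite (proj2 (hE i)) (proj1 (hF _)).
by move=> i; rewrite /gmul catc0 catc1 (proj1 (hE i)) (proj2 (hF _)) permM.
Qed.

Definition gsplits (n m : nat) (bc : 'I_(n + m) -> mx3) : Prop :=
  let b := fun i : 'I_n => bc (lshift m i) in
  exists s : ('I_n -> RR -> mx3) -> {perm 'I_n} ->
             ('I_(n + m) -> RR -> mx3) * {perm 'I_(n + m)},
  [/\ forall g sg, gbraid b g sg -> gbraid bc (s g sg).1 (s g sg).2,
      forall g sg h tau, gbraid b g sg -> gbraid b h tau -> ghom g h ->
        ghom (s g sg).1 (s h tau).1,
      forall g sg h tau, gbraid b g sg -> gbraid b h tau ->
        ghom (s (gmul g sg h) (sg * tau)%g).1 (gmul (s g sg).1 (s g sg).2 (s h tau).1) &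
      forall g sg, gbraid b g sg -> ghom (forget (s g sg).1) g].

Lemma qbar_gsplits n m (bc : 'I_(n + m) -> mx3) : qbar_splits bc -> gsplits bc.
Proof.
move=> [s [s1 [s2 [s3 s4]]]].
have br g sg : gbraid (fun i => bc (lshift m i)) g sg -> braid (fun i => bc (lshift m i)) g sg.
  move=> [pg hg]; split; first exact: kpath_gpath.
  by split=> i; have [] := hg i.
exists (fun g sg => (clp (s g sg).1, (s g sg).2)); split=> /=.
- move=> g sg /br /s1 [[kp [h0 h1]] _]; split; first exact: gpath_clp.
  by move=> i; rewrite /clp cl0 cl1.
- by move=> g sg h tau bg bh gh; apply: homotopic_ghom; apply: s2 (br _ _ bg) (br _ _ bh) _; exact: ghom_homotopic.
- move=> g sg h tau bg bh; rewrite -clp_bmul; apply: homotopic_ghom.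
  by rewrite -bmul_gmul; [exact: s3 (br _ _ bg) (br _ _ bh)|exact: bg.1|exact: bh.1].
move=> g sg bg; rewrite -{2}(clp_id bg.1).
exact: homotopic_ghom (s4 _ _ (br _ _ bg)).
Qed.

(** Mutually inverse homeomorphisms of RP^2, as maps of matrices restricted to [RP2]. Continuity is
    tested on families of points of [RP2], so that it applies directly to strands and homotopies. *)
Record homeo (phi psi : mx3 -> mx3) : Prop := Homeo {
  homeo_RP2 : forall P, RP2 P -> RP2 (phi P) /\ RP2 (psi P);
  homeo_K : forall P, RP2 P -> psi (phi P) = P /\ phi (psi P) = P;
  homeo_cts : forall (T : topologicalType) (p : T -> mx3), (forall x, RP2 (p x)) -> mcts p ->
    mcts (fun x => phi (p x)) /\ mcts (fun x => psi (p x)) }.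

Lemma homeo_sym phi psi : homeo phi psi -> homeo psi phi.
Proof.
move=> [h1 h2 h3]; split.
- by move=> P /h1 [].
- by move=> P /h2 [].
by move=> T p hp cp; have [] := h3 T p hp cp.
Qed.

Lemma homeo_comp phi psi phi' psi' : homeo phi psi -> homeo phi' psi' ->
  homeo (phi' \o phi) (psi \o psi').
Proof.
move=> [h1 h2 h3] [h1' h2' h3']; split.
- by move=> P hP; split; [apply: (h1' _ _).1; exact: (h1 _ _).1|apply: (h1 _ _).2; exact: (h1' _ _).2].
- move=> P hP; rewrite /= (h2' _ (h1 _ hP).1).1 (h2 _ hP).1.
  by rewrite (h2 _ (h1' _ hP).2).2 (h2' _ hP).2.
move=> T p hp cp; split=> /=.
  by apply: (h3' T (fun x => phi (p x)) _ _).1; [move=> x; exact: (h1 _ _).1|exact: (h3 _ _ _ _).1].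
by apply: (h3 T (fun x => psi' (p x)) _ _).2; [move=> x; exact: (h1' _ _).2|exact: (h3' _ _ _ _).2].
Qed.

Section Transport.
Variables (phi psi : mx3 -> mx3).
Hypothesis hh : homeo phi psi.

Definition push_strands K (E : strands K) : strands K := fun i t => phi (E i t).

Lemma homeo_inj P Q : RP2 P -> RP2 Q -> phi P = phi Q -> P = Q.
Proof. by move=> hP hQ e; rewrite -(homeo_K hh hP).1 e (homeo_K hh hQ).1. Qed.

Lemma in_conf_homeo K (x : 'I_K -> mx3) : in_conf x -> in_conf (fun i => phi (x i)).
Proof.
move=> [R inj]; split=> [i|i j]; first exact: (homeo_RP2 hh (R i)).1.
by move/(homeo_inj (R i) (R j)) => /inj.
Qed.

Lemma gpath_homeo K (E : strands K) : gpath E -> gpath (push_strands E).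
Proof.
move=> [cE conf clE]; split.
- by move=> i; apply: (homeo_cts hh _ (@cE i)).1 => t; exact: (conf t).1.
- by move=> t; exact: in_conf_homeo.
by move=> i t; rewrite /push_strands clE.
Qed.

Lemma ghom_homeo K (E F : strands K) : ghom E F -> ghom (push_strands E) (push_strands F).
Proof.
move=> [H [cH conf clH HE HE0]]; exists (fun i s t => phi (H i s t)); split.
- by move=> i; apply: (homeo_cts hh _ (@cH i)).1 => p; exact: (conf _ _).1.
- by move=> s t; exact: in_conf_homeo.
- by move=> i s t; rewrite clH.
- by move=> i t; have [-> ->] := HE i t.
by move=> i s; have [-> ->] := HE0 i s.
Qed.

Lemma gmul_homeo K (E F : strands K) sg :
  push_strands (gmul E sg F) = gmul (push_strands E) sg (push_strands F).
Proof. by apply/funext => i; apply/funext => t; rewrite /push_strands /gmul (app_catc phi). Qed.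

Lemma gbraid_homeo K (bc : 'I_K -> mx3) E sg : gbraid bc E sg -> gbraid (fun i => phi (bc i)) (push_strands E) sg.
Proof.
by move=> [pE hE]; split; [exact: gpath_homeo|move=> i; rewrite /push_strands; have [-> ->] := hE i].
Qed.

End Transport.

Lemma gsplits_homeo n m (bc : 'I_(n + m) -> mx3) phi psi : homeo phi psi -> in_conf bc ->
  gsplits bc -> gsplits (fun i => phi (bc i)).
Proof.
move=> hh [Rb _] [s [s1 s2 s3 s4]]; have hs := homeo_sym hh.
have bk g sg : gbraid (fun i => phi (bc (lshift m i))) g sg ->
    gbraid (fun i => bc (lshift m i)) (push_strands psi g) sg.
  move=> /(gbraid_homeo hs) [pg hg]; split=> // i.
  by have [-> ->] := hg i; rewrite !(homeo_K hh (Rb _)).1.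
exists (fun g sg => (push_strands phi (s (push_strands psi g) sg).1, (s (push_strands psi g) sg).2)).
split=> /=.
- move=> g sg /bk /s1; exact: (gbraid_homeo hh).
- move=> g sg h tau /bk bg /bk bh gh; apply: (ghom_homeo hh); by apply: s2 => //; exact: (ghom_homeo hs gh).
- move=> g sg h tau /bk bg /bk bh; rewrite (gmul_homeo psi) -(gmul_homeo phi); apply: (ghom_homeo hh).
  exact: s3.
move=> g sg bg; have := ghom_homeo hh (s4 _ _ (bk _ _ bg)).
have [[_ conf _] _] := bg.
have -> : push_strands phi (push_strands psi g) = g.
  apply/funext => i; apply/funext => t; rewrite /push_strands.
  by rewrite (homeo_K hh ((conf t).1 i)).2.
by [].
Qed.

(* A continuous bijection of R^3 commuting with scalars descends to the space of lines; the
   sum over the columns of P makes the formula independent of a choice of a vector. *)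
Definition descend (F : vec -> vec) (P : mx3) : mx3 :=
  let S := \sum_(k < 3) lin (F (col k P)) in (\tr S)^-1 *: S.

Record hmap (F F' : vec -> vec) : Prop := Hmap {
  hmap_Z : forall c v, F (c *: v) = c *: F v /\ F' (c *: v) = c *: F' v;
  hmap_K : forall v, F' (F v) = v /\ F (F' v) = v;
  hmap_cts : forall (T : topologicalType) (p : T -> vec), mcts p ->
    mcts (fun x => F (p x)) /\ mcts (fun x => F' (p x)) }.

Lemma hmap_sym F F' : hmap F F' -> hmap F' F.
Proof.
move=> [h1 h2 h3]; split.
- by move=> c v; have [] := h1 c v.
- by move=> v; have [] := h2 v.
by move=> T p cp; have [] := h3 T p cp.
Qed.

Lemma hmap_neq0 F F' v : hmap F F' -> v != 0 -> F v != 0.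
Proof.
move=> h; apply: contra => /eqP e; rewrite -(hmap_K h v).1 e.
by have := (hmap_Z h 0 0).2; rewrite !scale0r => ->.
Qed.

Lemma descend_lin F F' v : hmap F F' -> \sum_(k < 3) lin (F (col k (lin v))) = dotv v v *: lin (F v).
Proof.
move=> h; have cE k : col k (lin v) = v k 0 *: v.
  by apply/matrixP => i j; rewrite !mxE big_ord1 !mxE (ord1 j) mulrC.
under eq_bigr => k _ do rewrite cE (hmap_Z h _ _).1 linZ.
by rewrite -scaler_suml; congr (_ *: _); apply: eq_bigr => k _; rewrite expr2.
Qed.

Lemma descend_pl F F' v : hmap F F' -> v != 0 -> descend F (pl v) = pl (F v).
Proof.
move=> h v0; have [a a0 [a1 ->]] := pl_lin v0.
rewrite /descend (descend_lin _ h) a1 scale1r tr_lin -/(pl _) (hmap_Z h _ _).1 plZ //.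
by rewrite gt_eqF.
Qed.

Lemma RP2_plP P : RP2 P -> exists2 v, v != 0 & P = pl v.
Proof. by move=> /RP2P [v v1 ->]; exists v; [exact: unit_neq0|rewrite pl_unit]. Qed.

Lemma descend_homeo F F' : hmap F F' -> homeo (descend F) (descend F').
Proof.
move=> h; have h' := hmap_sym h.
have cd G G' : hmap G G' -> forall (T : topologicalType) (p : T -> mx3), (forall x, RP2 (p x)) ->
    mcts p -> mcts (fun x => descend G (p x)).
  move=> hG T p hp cp.
  have cS : mcts (fun x => \sum_(k < 3) lin (G (col k (p x)))).
    apply: mcts_sum => k; apply: mcts_lin; apply: (hmap_cts hG _).1 => i j.
    by under eq_fun do rewrite mxE; exact: cp.
  apply: mctsZ => //; apply: ctsV; first exact: cts_trace.
  move=> x; have [v v1 ->] := RP2P (hp x).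
  rewrite (descend_lin _ hG) v1 scale1r tr_lin gt_eqF // dotv_gt0 //.
  by apply: (hmap_neq0 hG); exact: unit_neq0.
split.
- move=> P /RP2_plP [v v0 ->]; rewrite (descend_pl h v0) (descend_pl h' v0).
  by split; apply: RP2_pl; [exact: (hmap_neq0 h)|exact: (hmap_neq0 h')].
- move=> P /RP2_plP [v v0 ->]; rewrite (descend_pl h v0) (descend_pl h' v0).
  rewrite (descend_pl h' (hmap_neq0 h v0)) (descend_pl h (hmap_neq0 h' v0)).
  by have [-> ->] := hmap_K h v.
by move=> T p hp cp; split; [exact: (cd _ _ h)|exact: (cd _ _ h')].
Qed.

Lemma linear_hmap (M : mx3) : M \in unitmx -> hmap (fun v => M *m v) (fun v => invmx M *m v).
Proof.
move=> uM; split.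
- by move=> c v; rewrite -!scalemxAr.
- by move=> v; rewrite !mulmxA mulmxV // mulVmx // mul1mx.
by move=> T p cp; split; apply: mctsM => //; exact: mcts_cst.
Qed.

(* Soft thresholding of z at level |w|: a continuous, odd and homogeneous bump. *)
Definition soft (z w : RR) : RR := z - Num.max (- `|w|) (Num.min `|w| z).

Lemma softZ c z w : soft (c * z) (c * w) = c * soft z w.
Proof.
have pos d x y : 0 <= d -> soft (d * x) (d * y) = d * soft x y.
  move=> d0; rewrite /soft normrM (ger0_norm d0) -mulrN -minr_pMr // -maxr_pMr //.
  by rewrite mulrBr.
have odd x y : soft (- x) (- y) = - soft x y.
  rewrite /soft normrN; have := normr_ge0 y; move: `|y| => a.
  move=> a0; have [h1|h1] := leP a x.
    have -> : Num.min a (- x) = - x by rewrite min_r; lra.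
    have -> : Num.max (- a) a = a by rewrite max_r; lra.
    by rewrite max_l; lra.
  have [h2|h2] := leP a (- x).
    have -> : Num.max (- a) a = a by rewrite max_r; lra.
    by rewrite max_l; lra.
  have -> : Num.max (- a) (- x) = - x by rewrite max_r; lra.
  by rewrite max_r; lra.
have [c0|c0] := leP 0 c; first exact: pos.
have nn x : c * x = - (- c * x) by rewrite mulNr opprK.
rewrite !nn odd pos //.
by rewrite oppr_ge0 ltW.
Qed.

Lemma soft_far w : 1 <= `|w| -> soft 1 w = 0.
Proof. by move=> h; rewrite /soft min_r // max_r ?subrr //; lra. Qed.

Lemma soft0 z : soft z 0 = z.
Proof. by rewrite /soft normr0 oppr0 max_l ?subr0 // ge_min lexx. Qed.

Definition vec3 (x y z : RR) : vec := \col_i nth 0 [:: x; y; z] i.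

Lemma X3_vec3 x y z : X3 (vec3 x y z) = x. Proof. by rewrite /X3 mxE. Qed.
Lemma Y3_vec3 x y z : Y3 (vec3 x y z) = y. Proof. by rewrite /Y3 mxE. Qed.
Lemma Z3_vec3 x y z : Z3 (vec3 x y z) = z. Proof. by rewrite /Z3 mxE. Qed.
Definition vec3E := (X3_vec3, Y3_vec3, Z3_vec3).

Lemma mcts_vec3 (T : topologicalType) (x y z : T -> RR) : cts x -> cts y -> cts z ->
  mcts (fun t => vec3 (x t) (y t) (z t)).
Proof.
move=> cx cy cz i j; under eq_fun do rewrite mxE.
by case: i => [[|[|[|//]]] ?] /=.
Qed.

(** In the chart Z3 = 1 this adds to the second coordinate c i times a tent of height 1 and
    half-width 1 / kap around x i; [soft] is the homogeneous form of the tent. The other two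
    coordinates are kept, so changing the signs of c gives the inverse. *)
Definition shear K (c x : 'I_K -> RR) (kap : RR) (v : vec) : vec :=
  vec3 (X3 v) (Y3 v + \sum_i c i * soft (Z3 v) (kap * (X3 v - x i * Z3 v))) (Z3 v).

Lemma shear_hmap K (c x : 'I_K -> RR) kap : hmap (shear c x kap) (shear (fun i => - c i) x kap).
Proof.
have hZ (d : 'I_K -> RR) a v : shear d x kap (a *: v) = a *: shear d x kap v.
  apply: vecP; rewrite /shear !(vec3E, lin3E) //.
  rewrite mulrDr mulr_sumr; congr (_ + _); apply: eq_bigr => i _.
  by rewrite [RHS]mulrCA -(softZ a); congr (_ * soft _ _); ring.
have hK (d d' : 'I_K -> RR) v : (forall i, d' i = - d i) -> shear d' x kap (shear d x kap v) = v.
  move=> dd; apply: vecP; rewrite /shear !vec3E // -addrA -big_split /= big1 ?addr0 // => i _.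
  by rewrite dd mulNr subrr.
have hc (d : 'I_K -> RR) (T : topologicalType) (p : T -> vec) : mcts p -> mcts (fun t => shear d x kap (p t)).
  move=> cp; apply: mcts_vec3; [exact: cp| |exact: cp].
  have cZ : cts (fun t => Z3 (p t)) by exact: cp.
  have cX : cts (fun t => X3 (p t)) by exact: cp.
  apply: ctsD; first exact: cp.
  apply: cts_sum => i; apply: ctsM; first exact: cts_cst.
  have cw : cts (fun t => `|kap * (X3 (p t) - x i * Z3 (p t))|).
    apply: cts_norm; apply: ctsM; first exact: cts_cst.
    by apply: ctsB => //; apply: ctsM => //; exact: cts_cst.
  by apply: ctsB => //; apply: cts_max; [exact: ctsN|exact: cts_min].
split.
- by move=> a v; rewrite !hZ.
- by move=> v; rewrite !hK // => i; rewrite opprK.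
by move=> T p cp; split; exact: hc.
Qed.

Lemma shear_ex K (x y y' : 'I_K -> RR) : injective x ->
  exists F F', hmap F F' /\ forall i, F (vec3 (x i) (y i) 1) = vec3 (x i) (y' i) 1.
Proof.
(* [kap] is at least the inverse of every mutual distance, so each x j lies outside the tents of the
   others; the diagonal terms are 0^-1 = 0. *)
move=> xI; pose kap := \sum_(p : 'I_K * 'I_K) `|x p.1 - x p.2|^-1.
have far i j : i != j -> 1 <= `|kap * (x j - x i)|.
  move=> ij; have d0 : 0 < `|x j - x i|.
    by rewrite normr_gt0 subr_eq0; apply: contra ij => /eqP /xI ->.
  have k0 : 0 <= kap by apply: sumr_ge0 => p _; rewrite invr_ge0.
  rewrite normrM (ger0_norm k0) -ler_pdivrMr // div1r /kap (bigD1 (j, i)) //= lerDl.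
  by apply: sumr_ge0 => p _; rewrite invr_ge0.
exists (shear (fun i => y' i - y i) x kap), (shear (fun i => - (y' i - y i)) x kap).
split=> [|i]; first exact: shear_hmap.
apply: vecP; rewrite /shear !vec3E // (bigD1 i) //= big1 => [|j ji].
  by rewrite mulr1 subrr mulr0 soft0 mulr1 addr0 addrC subrK.
by rewrite mulr1 soft_far ?mulr0 // far.
Qed.

(** * Moving finitely many lines into a normal position *)

Definition vpoly (v : vec) : {poly RR} := (X3 v)%:P + (Y3 v)%:P * 'X + (Z3 v)%:P * 'X^2.

Lemma vpolyE v s : (vpoly v).[s] = X3 v + Y3 v * s + Z3 v * s ^+ 2.
Proof. by rewrite /vpoly !hornerE. Qed.

Lemma vpolyB a c v w s : (vpoly (a *: v - c *: w)).[s] = a * (vpoly v).[s] - c * (vpoly w).[s].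
Proof. by rewrite !vpolyE /X3 /Y3 /Z3 !mxE; ring. Qed.

Lemma vpoly_neq0 v : v != 0 -> vpoly v != 0.
Proof.
apply: contra => /eqP h; have c k : (vpoly v)`_k = 0 by rewrite h coef0.
have := c 0%N; have := c 1%N; have := c 2; rewrite /vpoly !coefD !coefC !coefCM !coefX !coefXn /=.
rewrite !mulr0 !mulr1 !addr0 !add0r => cz cy cx.
by apply/eqP/vecP; rewrite ?cx ?cy ?cz /X3 /Y3 /Z3 mxE.
Qed.

(** [(vpoly v).[s]] is the value at v of the linear form (1, s, s^2) on the moment curve. A nonzero
    vector is annihilated by finitely many of these forms, so some s suits finitely many vectors at
    once; three such forms are independent by Vandermonde. *)
Lemma vpoly_avoid (J : finType) (w : J -> vec) (ex : seq RR) : (forall j, w j != 0) ->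
  exists2 s, s \notin ex & forall j, (vpoly (w j)).[s] != 0.
Proof.
move=> w0; pose p := (\prod_j vpoly (w j)) * \prod_(c <- ex) ('X - c%:P).
have p0 : p != 0.
  rewrite mulf_neq0 //; first by rewrite prodf_seq_neq0; apply/allP => j _ /=; exact: vpoly_neq0.
  by rewrite prodf_seq_neq0; apply/allP => c _ /=; rewrite polyXsubC_eq0.
have [s ps] : exists s, p.[s] != 0.
  apply: contrapT => h; have h' s : root p s.
    by apply/negPn/negP => hs; apply: h; exists s.
  have := max_poly_roots p0 (rs := [seq k%:R | k <- iota 0 (size p)]).
  rewrite size_map size_iota ltnn => a; suff : false by [].
  apply: a; first by apply/allP => x _; exact: h'.
  by rewrite map_inj_uniq ?iota_uniq // => a b /eqP; rewrite eqr_nat => /eqP.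
move: ps; rewrite hornerM mulf_eq0 negb_or !horner_prod !prodf_seq_neq0 => /andP[/allP h1 /allP h2].
exists s; last by move=> j; apply: (h1 j); exact: mem_index_enum.
by apply/negP => /h2; rewrite /= hornerXsubC subrr eqxx.
Qed.

Definition moment (s r t : RR) : mx3 := \matrix_(i, j) nth 0 [:: s; r; t] i ^+ j.

Lemma momentE s r t v : [/\ X3 (moment s r t *m v) = (vpoly v).[s],
  Y3 (moment s r t *m v) = (vpoly v).[r] & Z3 (moment s r t *m v) = (vpoly v).[t]].
Proof.
by rewrite !vpolyE; split; rewrite /X3 /Y3 /Z3 mxE !big_ord_recl big_ord0 !mxE /=; ring.
Qed.

Lemma moment_unit s r t : uniq [:: s; r; t] -> moment s r t \in unitmx.
Proof.
move=> u; have -> : moment s r t = (Vandermonde 3 (\row_i nth 0 [:: s; r; t] i))^T.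
  by apply/matrixP => i j; rewrite !mxE.
rewrite unitmx_tr unitmxE det_Vandermonde unitfE.
rewrite prodf_seq_neq0; apply/allP => i _ /=; rewrite prodf_seq_neq0; apply/allP => j _ /=.
apply/implyP => ij; rewrite !mxE subr_eq0 nth_uniq ?(ltn_ord i) ?(ltn_ord j) //.
by rewrite neq_ltn ij orbT.
Qed.

Lemma vec3_neq0 x y : vec3 x y 1 != 0.
Proof. by apply: contraTneq isT => /(congr1 Z3)/eqP; rewrite vec3E /Z3 mxE oner_eq0. Qed.

(** Generic linear coordinates put the lines into one affine chart with distinct first coordinates.
    One shear makes the second coordinate i; after a swap these distinct numbers allow another shear
    to clear the remaining coordinate. The result depends on the index only. *)
Lemma homeo_conf K (z : 'I_K -> mx3) : in_conf z ->
  exists phi psi, homeo phi psi /\ forall i, phi (z i) = pl (vec3 i%:R 0 1).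
Proof.
move=> [R inj].
have /choice [v hv] : forall i, exists v, v != 0 /\ z i = pl v.
  by move=> i; have [v v0 e] := RP2_plP (R i); exists v.
have [t _ tv] := vpoly_avoid [::] (fun i => (hv i).1).
(* The polynomial of w (i, j) at s is the numerator of x i - x j below, so its nonvanishing
   separates first coordinates; on the diagonal any nonzero vector will do. *)
pose w (p : 'I_K * 'I_K) := if p.1 == p.2 then vec3 0 0 1 else
  (vpoly (v p.2)).[t] *: v p.1 - (vpoly (v p.1)).[t] *: v p.2.
have w0 p : w p != 0.
  case: p => i j; rewrite /w /=; have [_|ij] := eqVneq i j.
    exact: vec3_neq0.
  rewrite subr_eq0; apply/eqP => h; move/eqP: ij; apply; apply: inj; rewrite (hv i).2 (hv j).2.
  by rewrite -(plZ (v i) (tv j)) h plZ.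
have [s st sw] := vpoly_avoid [:: t] w0.
have [r rst _] := vpoly_avoid (J := void) (w := fun _ => 0) [:: s; t] (fun j : void => match j with end).
have uM : moment s r t \in unitmx.
  apply: moment_unit; rewrite /= !inE in st rst *.
  by move: rst; rewrite !negb_or => /andP[h1 h2]; rewrite eq_sym h1 st h2.
set M := moment s r t in uM.
pose x i := (vpoly (v i)).[s] / (vpoly (v i)).[t]; pose y i := (vpoly (v i)).[r] / (vpoly (v i)).[t].
have hM i : pl (M *m v i) = pl (vec3 (x i) (y i) 1).
  rewrite -(plZ (vec3 _ _ _) (tv i)); congr pl.
  have [h1 h2 h3] := momentE s r t (v i).
  apply: vecP; rewrite ?h1 ?h2 ?h3 lin3E vec3E ?mulr1 // mulrC divfK //.
have xI : injective x.
  move=> i j; rewrite /x => /eqP; rewrite eqr_div // => /eqP e; apply/eqP; apply/negPn/negP => ij.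
  move/eqP: (sw (i, j)); apply; rewrite /w /= (negPf ij) vpolyB [_ * (vpoly (v i)).[s]]mulrC e.
  by rewrite [_ * (vpoly (v j)).[s]]mulrC subrr.
have nI : injective (fun i : 'I_K => i%:R : RR).
  by move=> i j /eqP; rewrite eqr_nat => /eqP; exact: val_inj.
have [F1 [F1' [h1 e1]]] := shear_ex y (fun i => i%:R) xI.
have [F2 [F2' [h2 e2]]] := shear_ex x (fun _ => 0) nI.
pose swap (u : vec) := vec3 (Y3 u) (X3 u) (Z3 u).
have hs : hmap swap swap.
  split.
  - by move=> c u; split; apply: vecP; rewrite /swap !(vec3E, lin3E).
  - by move=> u; split; apply: vecP; rewrite /swap !vec3E.
  by move=> T p cp; split; apply: mcts_vec3; exact: cp.
have H := homeo_comp (homeo_comp (homeo_comp (descend_homeo (linear_hmap uM)) (descend_homeo h1))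
  (descend_homeo hs)) (descend_homeo h2).
eexists; eexists; split; first exact: H.
have n0 := vec3_neq0.
move=> i /=; rewrite (hv i).2 (descend_pl (linear_hmap uM) (hv i).1) hM.
rewrite (descend_pl h1 (n0 _ _)) e1 (descend_pl hs (n0 _ _)).
have -> : swap (vec3 (x i) i%:R 1) = vec3 i%:R (x i) 1 by rewrite /swap !vec3E.
by rewrite (descend_pl h2 (n0 _ _)) e2.
Qed.

Lemma gsplits_any n m (bc bc' : 'I_(n + m) -> mx3) : in_conf bc -> in_conf bc' ->
  gsplits bc -> gsplits bc'.
Proof.
move=> hb hb' gs; have [phi [psi [h e]]] := homeo_conf hb; have [phi' [psi' [h' e']]] := homeo_conf hb'.
have H := homeo_comp h (homeo_sym h').
have := gsplits_homeo H hb gs.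
have -> : (fun i => (psi' \o phi) (bc i)) = bc'; last by [].
by apply/funext => i; rewrite /= e -e' (homeo_K h' (hb'.1 i)).1.
Qed.

(** * The rotation braid *)

Definition Rx (a : RR) : mx3 := \matrix_(i, j)
  (nth [::] [:: [:: 1; 0; 0]; [:: 0; cos a; - sin a]; [:: 0; sin a; cos a]] i)`_j.

Lemma RxT a : (Rx a)^T = Rx (- a).
Proof.
apply/matrixP => i j; rewrite !mxE trigo.cosN trigo.sinN.
by case: i => [[|[|[|//]]] ?]; case: j => [[|[|[|//]]] ?] //=; rewrite ?opprK.
Qed.

Lemma Rx0 : Rx 0 = 1%:M.
Proof.
apply/matrixP => i j; rewrite !mxE trigo.cos0 trigo.sin0.
by case: i => [[|[|[|//]]] ?]; case: j => [[|[|[|//]]] ?] //=; rewrite ?oppr0.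
Qed.

Lemma RxV a : Rx a *m Rx (- a) = 1%:M.
Proof.
have h := cos2Dsin2 a; rewrite !expr2 in h.
apply/matrixP => i j; rewrite !mxE !big_ord_recl big_ord0 !mxE trigo.cosN trigo.sinN.
case: i => [[|[|[|//]]] ?]; case: j => [[|[|[|//]]] ?] //=; rewrite ?mulr1n ?mulr0n; lra.
Qed.

(** A half turn about the x-axis reverses the z-axis and so inverts rotations about it. *)
Lemma Rx_pi a : Rx pi *m Rz a *m Rx (- pi) = Rz (- a).
Proof.
apply/matrixP => i j; rewrite !mxE !big_ord_recl big_ord0 !mxE !big_ord_recl !big_ord0 !mxE.
rewrite !trigo.cosN !trigo.sinN cospi sinpi.
by case: i => [[|[|[|//]]] ?]; case: j => [[|[|[|//]]] ?] //=; ring.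
Qed.

Lemma conj_RP2 (A : mx3) P : A *m A^T = 1%:M -> RP2 P -> RP2 (A *m P *m A^T).
Proof.
move=> h /RP2P [v v1 ->]; rewrite lin_act; apply: RP2_lin.
by rewrite dotv_mull mulmxA (mulmx1C h) mul1mx.
Qed.

Lemma conj_inj (A : mx3) P Q : A *m A^T = 1%:M -> A *m P *m A^T = A *m Q *m A^T -> P = Q.
Proof.
move=> h /(congr1 (fun M => A^T *m M *m A)).
by rewrite !mulmxA (mulmx1C h) !mul1mx -!mulmxA (mulmx1C h) !mulmx1.
Qed.

Lemma orthM (A B : mx3) : A *m A^T = 1%:M -> B *m B^T = 1%:M -> (A *m B) *m (A *m B)^T = 1%:M.
Proof. by move=> hA hB; rewrite trmx_mul mulmxA -(mulmxA A) hB mulmx1. Qed.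

Section RotHom.
Variables (K : nat) (b0 : 'I_K -> mx3).
Hypothesis hb : in_conf b0.

Lemma mcts_Rx (T : topologicalType) (a : T -> RR) : cts a -> mcts (fun t => Rx (a t)).
Proof.
move=> ca i j; under eq_fun do rewrite mxE.
case: i => [[|[|[|//]]] ?]; case: j => [[|[|[|//]]] ?] /=;
  try exact: cts_cst; try exact: cts_cos; try exact: cts_sin; apply: ctsN; exact: cts_sin.
Qed.

Lemma conf_rotP a : in_conf (fun i => rotP a (b0 i)).
Proof.
have [R inj] := hb; split=> [i|i j /rotP_inj /inj //]; exact: RP2_rotP.
Qed.

Lemma gpath_rotP (th : RR -> RR) : cts th -> (forall t, th (cl t) = th t) ->
  gpath (fun i t => rotP (th t) (b0 i)).
Proof.
move=> ct clt; split.
- by move=> i; apply: mcts_rotP => //; exact: mcts_cst.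
- by move=> t; exact: conf_rotP.
by move=> i t; rewrite clt.
Qed.

Lemma ghom_rotP (th th' : RR -> RR) : cts th -> cts th' -> (forall t, th (cl t) = th t) ->
  (forall t, th' (cl t) = th' t) -> th 0 = th' 0 -> th 1 = th' 1 ->
  ghom (fun i t => rotP (th t) (b0 i)) (fun i t => rotP (th' t) (b0 i)).
Proof.
move=> ct ct' h h' e0 e1.
exists (fun i s t => rotP ((1 - cl s) * th t + cl s * th' t) (b0 i)); split.
- move=> i; apply: mcts_rotP; last exact: mcts_cst.
  have c1 : cts (fun p : RR * RR => cl p.1) by apply: cts_cl; exact: (cts_fst cts_id).
  apply: ctsD; apply: ctsM => //; [by apply: ctsB => //; exact: cts_cst|exact: (cts_snd ct)|exact: (cts_snd ct')].
- by move=> s t; exact: conf_rotP.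
- by move=> i s t; rewrite clK h h'.
- by move=> i t; rewrite cl0 cl1 subr0 subrr !mul0r !mul1r addr0 add0r.
by move=> i s; rewrite -e0 -e1 -!mulrDl !subrK !mul1r.
Qed.

(* Twice a full turn is contracted by turning the axis of one of the two turns upside down. *)
Lemma ghom_double_turn (th : RR -> RR) : cts th -> (forall t, th (cl t) = th t) ->
  th 0 = 0 -> Rz (th 1) = 1%:M ->
  ghom (fun i t => rotP (th t + th t) (b0 i)) (fun i _ => b0 i).
Proof.
move=> ct clt h0 h1.
pose A s t := Rz (th t) *m (Rx (pi * cl s) *m Rz (th t) *m Rx (- (pi * cl s))).
have orth s t : A s t *m (A s t)^T = 1%:M.
  have oz a : Rz a *m (Rz a)^T = 1%:M by rewrite RzT RzD subrr Rz0.
  have ox a : Rx a *m (Rx a)^T = 1%:M by rewrite RxT RxV.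
  by do 3?[apply: orthM => //].
have cA : mcts2 A.
  have c1 : cts (fun p : RR * RR => pi * cl p.1).
    by apply: ctsM; [exact: cts_cst|apply: cts_cl; exact: (cts_fst cts_id)].
  have cz : mcts (fun p : RR * RR => Rz (th p.2)) by apply: mcts_Rz; exact: (cts_snd ct).
  apply: mctsM => //; apply: mctsM; last by apply: mcts_Rx; exact: ctsN.
  by apply: mctsM => //; exact: mcts_Rx.
have [R inj] := hb.
have c1 (P : mx3) : (1%:M : mx3) *m P *m (1%:M : mx3)^T = P by rewrite trmx1 mul1mx mulmx1.
exists (fun i s t => A s t *m b0 i *m (A s t)^T); split.
- by move=> i; apply: mctsM; [apply: mctsM => //; exact: mcts_cst|exact: mcts_tr].
- by move=> s t; split=> [i|i j /(conj_inj (orth _ _)) /inj //]; exact: conj_RP2.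
- by move=> i s t; rewrite /A clt clK.
- move=> i t; rewrite /A cl0 cl1 mulr0 mulr1 oppr0 Rx0 mul1mx mulmx1 RzD; split=> //.
  by rewrite Rx_pi RzD subrr Rz0.
move=> i s; rewrite /A h0 h1 Rz0 !mulmx1 RxV mulmx1 c1; split; first by rewrite addr0 rotP0.
by rewrite /rotP -RzD h1 mulmx1 c1.
Qed.

End RotHom.

Lemma cyc_subproof q n (i : 'I_n) : (q <= n)%N -> ((if i < q then i.+1 %% q else i) < n)%N.
Proof.
move=> qn; case: ifP => // iq; apply: leq_trans qn; rewrite ltn_mod.
exact: leq_ltn_trans iq.
Qed.

(** The effect of the rotation by pi / q on the base points: the q equatorial lines shift by one,
    and a pole of index q stays. *)
Definition cycf q n (qn : (q <= n)%N) (i : 'I_n) : 'I_n := Ordinal (cyc_subproof i qn).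

Lemma cycf_inj q n (qn : (q <= n)%N) : injective (cycf qn).
Proof.
move=> i j /(congr1 val) /= h; apply: val_inj => /=; move: h.
case: ifP => iq; case: ifP => jq //.
- have q0 : (0 < q)%N by exact: leq_ltn_trans iq.
  move=> h; have : i = j %[mod q] by apply/eqP; rewrite -(eqn_modDr 1) !addn1 h.
  by rewrite !modn_small.
- have q0 : (0 < q)%N by exact: leq_ltn_trans iq.
  by move=> h; move: jq; rewrite -h ltn_mod q0.
have q0 : (0 < q)%N by exact: leq_ltn_trans jq.
by move=> h; move: iq; rewrite h ltn_mod q0.
Qed.

Definition cyc q n (qn : (q <= n)%N) : {perm 'I_n} := perm (@cycf_inj q n qn).

Lemma cycX q n (qn : (q <= n)%N) e i :
  val ((cyc qn ^+ e)%g i) = if (i < q)%N then ((e + i) %% q)%N else i.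
Proof.
elim: e => [|e IH]; first by rewrite expg0 perm1; case: ifP => // iq; rewrite modn_small.
rewrite expgSr permM permE /= IH; have [iq|iq] := ltnP i q; last by rewrite ltnNge iq.
rewrite ltn_mod (leq_ltn_trans _ iq) //.
by rewrite -addn1 modnDml addn1 addSn.
Qed.

Section Standard.
Variables (q n m : nat) (bc : 'I_(n + m) -> mx3).
Hypotheses (q2 : (2 <= q)%N) (qn : (q <= n)%N) (hbc : in_conf bc)
  (hbase : forall i : 'I_n, (i < q)%N -> bc (lshift m i) = zb q i)
  (hfix : forall i : 'I_n, (q <= i)%N -> forall a, rotP a (bc (lshift m i)) = bc (lshift m i)).

Let q0 : (0 < q)%N. Proof. exact: leq_trans q2. Qed.
Let b0 (i : 'I_n) := bc (lshift m i).

Let hb0 : in_conf b0.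
Proof.
have [R inj] := hbc; split=> [i|i j /inj]; first exact: R.
by move=> /(congr1 val) /= /val_inj.
Qed.

Definition rotbraid e : 'I_n -> RR -> mx3 := fun i t => rotP (ang q e t) (b0 i).

Let ang_cl e t : ang q e (cl t) = ang q e t. Proof. by rewrite /ang clK. Qed.
Let ang0 e : ang q e 0 = 0. Proof. by rewrite /ang cl0 mulr0. Qed.
Let ang1 e : ang q e 1 = pi *+ e / q%:R. Proof. by rewrite /ang cl1 mulr1. Qed.

Let rot1 e i : rotP (ang q e 1) (b0 i) = b0 ((cyc qn ^+ e)%g i).
Proof.
rewrite /b0; have := cycX qn e i; have [iq|iq] := ltnP i q => h.
  by rewrite !hbase ?h ?ltn_mod // ang1 zb_rot zb_mod.
by rewrite !hfix ?h //; congr (bc (lshift _ _)); apply: val_inj; rewrite h.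
Qed.

Let gb e : gbraid b0 (rotbraid e) (cyc qn ^+ e)%g.
Proof.
split; first by apply: gpath_rotP => //; exact: cts_ang.
by move=> i; rewrite /rotbraid rot1 ang0 rotP0.
Qed.

Let rot_mul e f : ghom (rotbraid (e + f)) (gmul (rotbraid e) (cyc qn ^+ e)%g (rotbraid f)).
Proof.
have -> : gmul (rotbraid e) (cyc qn ^+ e)%g (rotbraid f) =
    fun i t => rotP (catc (ang q e) (fun t => ang q f t + ang q e 1) t) (b0 i).
  apply/funext => i; apply/funext => t; rewrite /gmul /rotbraid /catc; case: ifP => // _.
  by rewrite -rot1 rotPD.
apply: ghom_rotP => //.
- exact: cts_ang.
- apply: cts_catc; last by rewrite ang0 add0r.
    exact: cts_ang.
  by apply: ctsD; [exact: cts_ang|exact: cts_cst].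
- by move=> t; rewrite catc_cl.
- by rewrite catc0 !ang0.
by rewrite catc1 !ang1 mulrnDr mulrDl addrC.
Qed.

Let rot_per e : ghom (rotbraid (4 * q * e)) (rotbraid 0).
Proof.
have -> : rotbraid 0 = fun i _ => b0 i.
  by apply/funext => i; apply/funext => t; rewrite /rotbraid /ang mulr0n !mul0r rotP0.
(* The angle 4 pi e is split into two equal rotations, each of e full turns, the shape that
   [ghom_double_turn] contracts. *)
have -> : rotbraid (4 * q * e) = fun i t => rotP (ang q (2 * q * e) t + ang q (2 * q * e) t) (b0 i).
  apply/funext => i; apply/funext => t; rewrite /rotbraid /ang -mulrDl -mulrDl -mulrnDr.
  by congr (rotP (_ *+ _ / _ * _) _); lia.
apply: ghom_double_turn => //; first exact: cts_ang.
have -> : ang q (2 * q * e) 1 = pi *+ 2 *+ e.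
  rewrite ang1 mulnAC mulrnA -(mulr_natr (pi *+ (2 * e)) q) mulfK ?mulrnA //.
  by rewrite pnatr_eq0 -lt0n.
exact: Rz_turns.
Qed.

Definition base_strand (i : 'I_q) : 'I_(n + m) := lshift m (widen_ord qn i).

(** Homotopies speak of strands and not of the permutations returned by the section. As [bc] is
    injective, end points determine permutations; this makes T multiplicative, hence T e = tau^e,
    and forgetting strands fixes tau on the first n. *)
Lemma section_braid_seq : gsplits bc -> exists G tau, [/\ braid_seq base_strand bc G tau,
  forall i : 'I_n, exists i' : 'I_n, tau (lshift m i) = lshift m i' &
  forall i : 'I_n, (q <= i)%N -> tau (lshift m i) = lshift m i].
Proof.
move=> [s [s1 s2 s3 s4]]; have [R inj] := hbc.
pose G e := (s (rotbraid e) (cyc qn ^+ e)%g).1.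
pose T e := (s (rotbraid e) (cyc qn ^+ e)%g).2.
have GT e : gbraid bc (G e) (T e) by exact: s1 (gb e).
have Gmul e f : ghom (G (e + f)%N) (gmul (G e) (T e) (G f)).
  apply: ghom_trans (s3 _ _ _ _ (gb e) (gb f)).
  by apply: s2 (rot_mul e f); [exact: gb|exact: gbraid_gmul].
have Tmul e f : T (e + f)%N = (T e * T f)%g.
  apply/permP => i; apply: inj; have [_ h] := ghom_ends i (Gmul e f).
  rewrite -((GT _).2 i).2 -h /gmul catc1 ((GT f).2 _).2 permM //.
have T0 : T 0%N = 1%g by apply: (mulgI (T 0%N)); rewrite -Tmul mulg1.
have TX e : T e = (T 1%N ^+ e)%g by elim: e => [|e IH]; rewrite ?T0 // expgSr -IH -Tmul addn1.
have frgt e : ghom (forget (G e)) (rotbraid e) by exact: s4 (gb e).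
have Tl i : T 1%N (lshift m i) = lshift m ((cyc qn ^+ 1)%g i).
  apply: inj; have [_ h] := ghom_ends i (frgt 1%N).
  by rewrite -((GT 1%N).2 _).2 -[LHS]h (proj2 ((gb 1%N).2 i)).
exists G, (T 1%N); split; last 2 first.
- by move=> i; rewrite Tl; eexists.
- move=> i iq; rewrite Tl; congr (lshift _ _); apply: val_inj.
  by rewrite cycX ltnNge iq.
split=> //.
- by move=> i j /(congr1 val) /= /val_inj.
- by move=> e; exact: (GT e).1.
- by move=> e i; exact: ((GT e).2 i).1.
- by move=> e i; rewrite -TX; exact: ((GT e).2 i).2.
- by move=> i; rewrite /base_strand hbase /=.
- by move=> e f; rewrite -TX; exact: Gmul.
- move=> e; have [H [cH conf clH HE HE0]] := frgt e.
  exists (fun i => H (widen_ord qn i)); split=> //.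
  + move=> r t; have [R' inj'] := conf r t; split=> [i|i j /inj']; first exact: R'.
    by move=> /(congr1 val) /= /val_inj.
  by move=> i t; have [-> ->] := HE (widen_ord qn i) t; rewrite /rotbraid /b0 hbase /=.
move=> e; apply: s2 (rot_per e); exact: gb.
Qed.

End Standard.

(** * Cycle lengths *)

Lemma card_porbits (T : finType) (p : {perm T}) : #|T| = (\sum_(A in porbits p) #|A|)%N.
Proof.
rewrite -sum1_card (partition_big (porbit p) (mem (porbits p))) /=; last first.
  by move=> x _; apply/imsetP; exists x.
apply: eq_bigr => A /imsetP [y _ ->]; rewrite -sum1_card; apply: eq_bigl => x.
by rewrite eq_porbit_mem.
Qed.

Lemma expg_porbit (T : finType) (p : {perm T}) x : (p ^+ #|porbit p x|)%g x = x.
Proof. by rewrite permX iter_porbit. Qed.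

Lemma dvd_card_perm (T : finType) (p : {perm T}) d :
  (forall l x, (p ^+ l)%g x = x -> (d %| l)%N) -> (d %| #|T|)%N.
Proof.
move=> h; rewrite (card_porbits p); apply: dvdn_sum => A /imsetP [x _ ->].
exact: h (expg_porbit p x).
Qed.

(** Without a fixed point, x and p x are two distinct points fixed by the power of p at the length
    of their cycle, so d divides every length. With a fixed point x0, pairing x0 with x treats all
    other cycles, and x0 contributes 1. *)
Lemma card_perm_mod1 (T : finType) (p : {perm T}) d :
  (forall l x y, x != y -> (p ^+ l)%g x = x -> (p ^+ l)%g y = y -> (d %| l)%N) ->
  (d %| #|T|)%N \/ #|T| = 1 %[mod d].
Proof.
move=> h; have [/existsP [x0 /eqP px0]|nf] := boolP [exists x, p x == x]; last first.
  left; rewrite (card_porbits p); apply: dvdn_sum => A /imsetP [x _ ->].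
  apply: (h _ x (p x)); [|exact: expg_porbit|by rewrite -permM -expgS expgSr permM expg_porbit].
  by move: nf; rewrite negb_exists => /forallP /(_ x); rewrite eq_sym.
right; have xl l : (p ^+ l)%g x0 = x0 by elim: l => [|l IH]; rewrite ?expg0 ?perm1 // expgSr permM IH.
rewrite (card_porbits p) (bigD1 (porbit p x0)) /=; last by apply/imsetP; exists x0.
have orb y : (y \in porbit p x0) = (y == x0).
  by apply/porbitP/eqP => [[i ->] //|->]; exists 0%N; rewrite expg0 perm1.
rewrite (eq_card (B := pred1 x0)) // card1 -modnDmr; set s := (\sum_(_ in _ | _) _)%N.
have /eqP -> : (d %| s)%N; last by rewrite addn0.
apply: dvdn_sum => A /andP [/imsetP [x _ ->] ne].
apply: (h _ x0 x) => //; last exact: expg_porbit.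
by apply: contra ne => /eqP <-.
Qed.

Lemma right_perm n m (tau : {perm 'I_(n + m)}) :
  (forall i : 'I_n, exists i' : 'I_n, tau (lshift m i) = lshift m i') ->
  exists p : {perm 'I_m}, forall l k, (tau ^+ l)%g (rshift n k) = rshift n ((p ^+ l)%g k).
Proof.
move=> /choice [f hf].
have fI : injective f by move=> i j e; apply: (@lshift_inj n m); apply: (@perm_inj _ tau); rewrite !hf e.
have /choice [g hg] : forall k : 'I_m, exists k', tau (rshift n k) = rshift n k'.
  move=> k; have [i|k'] := split_ordP (tau (rshift n k)); last by exists k'.
  move=> e; have [f' _ fK] := injF_bij fI.
  have : tau (rshift n k) = tau (lshift m (f' i)) by rewrite e hf fK.
  by move/perm_inj => /eqP; rewrite eq_rlshift.
have gI : injective g by move=> i j e; apply: (@rshift_inj n m); apply: (@perm_inj _ tau); rewrite !hg e.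
exists (perm gI); elim=> [|l IH] k; first by rewrite !expg0 !perm1.
by rewrite !expgSr !permM IH hg permE.
Qed.

(* Index q is the pole. *)
Definition std q K (j : 'I_K) : mx3 := if (j < q)%N then zb q j else pl (vec3 (j - q)%:R 0 1).

Lemma std_off q K (j : 'I_K) : (q <= j)%N ->
  exists v, [/\ dotv v v = 1, std q j = lin v & Z3 v != 0].
Proof.
move=> qj; have v0 := vec3_neq0 (j - q)%:R 0.
have [a a0 [a1 e]] := pl_lin v0; exists (a *: vec3 (j - q)%:R 0 1); split=> //.
  by rewrite /std ltnNge qj.
by rewrite lin3E vec3E mulr1 gt_eqF.
Qed.

Lemma zb_inj q (i j : nat) : (i < q)%N -> (j < q)%N -> zb q i = zb q j -> i = j.
Proof.
move=> iq jq h; have q0 : (0 < q)%N by exact: leq_ltn_trans iq.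
have qn0 : q%:R != 0 :> RR by rewrite pnatr_eq0 -lt0n.
have [c e c2] := lin_inj (dir_unit _) h; rewrite dir_unit mulr1 in c2.
(* Squaring removes the sign by which two unit vectors of one line may differ, and turns the angles
   into 2 pi i / q and 2 pi j / q. *)
have : cis (pi *+ i / q%:R) ^+ 2 = cis (pi *+ j / q%:R) ^+ 2.
  rewrite -!xy_dir e; have -> : xy (c *: dir (pi *+ j / q%:R)) = c%:C%C * xy (dir (pi *+ j / q%:R)).
    by rewrite /xy !lin3E; apply/eqP; rewrite eq_complex /= !mul0r subr0 addr0 !eqxx.
  rewrite exprMn; have -> : c%:C%C ^+ 2 = 1 :> CC by rewrite -rmorphXn c2.
  by rewrite mul1r.
rewrite -!cisMn => /cis_inj_int [k].
have p0 : pi != 0 :> RR by rewrite gt_eqF // pi_gt0.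
clear h e c2; move: p0; move: (pi : RR) => P p0 ek; have {ek} : i%:R - j%:R = k%:~R * q%:R :> RR.
  by rewrite -ek -!(mulr_natr P) -!(mulr_natr (_ / _)); field; rewrite qn0 p0.
move=> e; have {e} : (i%:Z - j%:Z)%:~R = (k * q%:Z)%:~R :> RR by rewrite rmorphB rmorphM.
move=> /eqP; rewrite eqr_int => /eqP e.
have [k1|[k0|k1]] : k <= -1 \/ k = 0 \/ 1 <= k by lia.
- have : k * q%:Z <= - q%:Z by rewrite -mulN1r ler_wpM2r.
  by rewrite -e; lia.
- by move: e; rewrite k0 mul0r; lia.
have : q%:Z <= k * q%:Z by rewrite -{1}[q%:Z]mul1r ler_wpM2r.
by rewrite -e; lia.
Qed.

Lemma std_conf q K : in_conf (@std q K).
Proof.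
have v0 x := vec3_neq0 x 0.
have ne i x : zb q i <> pl (vec3 x 0 1).
  have [a a0 [_ ->]] := pl_lin (v0 x).
  move/(lin_inj (dir_unit _)) => [c e c2]; have [_ _ dz] := dirE (pi *+ i / q%:R).
  move: (congr1 Z3 e); rewrite dz !lin3E vec3E mulr1 => /esym/eqP.
  rewrite mulf_eq0 (gt_eqF a0) orbF => /eqP c0; move: c2; rewrite c0 expr0n mul0r => /eqP.
  by rewrite eq_sym oner_eq0.
split=> [i|i j]; rewrite /std.
  by case: ifP => _; [apply: RP2_lin; exact: dir_unit|exact: RP2_pl].
case: ifP => iq; case: ifP => jq.
- by move/(zb_inj iq jq)/val_inj.
- by move/ne.
- by move/esym/ne.
move/(pl_inj (v0 _) (v0 _)) => [c c0 e].
have := congr1 Z3 e; rewrite lin3E !vec3E mulr1 => c1.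
have := congr1 X3 e; rewrite lin3E !vec3E -c1 mul1r => /eqP; rewrite eqr_nat => /eqP h.
apply: val_inj; move: iq jq => /negbT; rewrite -leqNgt => iq /negbT; rewrite -leqNgt => jq.
by move: h => /=; lia.
Qed.

Lemma std_pole q K (j : 'I_K) a : j = q :> nat -> rotP a (std q j) = std q j.
Proof.
move=> e; rewrite /std e ltnn subnn.
have pu : dotv (vec3 0 0 1) (vec3 0 0 1) = 1 by rewrite dotv3 !vec3E; ring.
rewrite pl_unit // rotP_lin; congr lin; have [h1 h2 h3] := mulRz a (vec3 0 0 1).
by apply: vecP; rewrite ?h1 ?h2 ?h3 !vec3E; ring.
Qed.

Lemma last_strands q n m (bc : 'I_(n + m) -> mx3) : (2 <= q)%N -> (q <= n <= q.+1)%N -> in_conf bc ->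
  qbar_splits bc -> exists (tau : {perm 'I_(n + m)}) (p : {perm 'I_m}),
  [/\ forall l k, (tau ^+ l)%g (rshift n k) = rshift n ((p ^+ l)%g k),
      forall i : 'I_n, i = q :> nat -> tau (lshift m i) = lshift m i &
      forall l (j1 j2 : 'I_(n + m)), (q <= j1)%N -> (q <= j2)%N -> j1 != j2 ->
        (tau ^+ l)%g j1 = j1 -> (tau ^+ l)%g j2 = j2 -> (q %| l)%N].
Proof.
move=> q2 /andP[qn nq] hbc /qbar_gsplits /(gsplits_any hbc (@std_conf q _)) gs.
have hbase (i : 'I_n) : (i < q)%N -> std q (lshift m i) = zb q i by rewrite /std /= => ->.
have hfix (i : 'I_n) : (q <= i)%N -> forall a, rotP a (std q (lshift m i)) = std q (lshift m i).
  by move=> qi a; apply: std_pole => /=; have := ltn_ord i; lia.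
have [G [tau [BS tl tfix]]] := section_braid_seq q2 qn (@std_conf q _) hbase hfix gs.
have [p hp] := right_perm tl.
exists tau, p; split=> //.
  by move=> i iq; apply: tfix; rewrite iq.
move=> l j1 j2 qj1 qj2 j12 t1 t2.
have [v1 [u1 e1 z1]] := std_off qj1; have [v2 [u2 e2 z2]] := std_off qj2.
have nb (j : 'I_(n + m)) : (q <= j)%N -> forall i, base_strand m qn i != j.
  by move=> qj i; apply: contraTneq qj => <- /=; rewrite -ltnNge.
exact: (fixed_strands_dvd BS t1 t2 j12 (nb _ qj1) (nb _ qj2) u1 e1 z1 u2 e2 z2).
Qed.

Theorem theoremB (n m : nat) (bc : 'I_(n + m) -> mx3) :
  (3 <= n)%N -> in_conf bc -> qbar_splits bc ->
  m = 0 %[mod n * (n - 1)] \/ m = (n - 1) ^ 2 %[mod n * (n - 1)].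
Proof.
move=> n3 hbc sp.
have dn : (n %| m)%N \/ m = 1 %[mod n].
  have nn : (n <= n <= n.+1)%N by lia.
  have [tau [p [hp _ h]]] := last_strands (ltnW n3) nn hbc sp.
  rewrite -[m]card_ord; apply: (@card_perm_mod1 _ p) => l x y xy px py.
  apply: (h l (rshift n x) (rshift n y)); rewrite ?hp ?px ?py ?leq_addr //.
  by rewrite eq_rshift.
have dn1 : (n.-1 %| m)%N.
  (* From n >= 3. For q = 1 the base lines of indices 0 and 1, used in [loop_closed], would
     coincide. *)
  have n2 : (2 <= n.-1)%N by lia.
  have nn : (n.-1 <= n <= n.-1.+1)%N by lia.
  have [tau [p [hp hpole h]]] := last_strands n2 nn hbc sp.
  rewrite -[m]card_ord; apply: (@dvd_card_perm _ p) => l x px.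
  have kn : (n.-1 < n)%N by lia.
  apply: (h l (lshift m (Ordinal kn)) (rshift n x)); rewrite ?hp ?px //=.
  - by lia.
  - by rewrite eq_lrshift.
  by elim: (l) => [|k IH]; rewrite ?expg0 ?perm1 // expgSr permM IH hpole.
have co : coprime n n.-1 by rewrite coprimenP //; lia.
rewrite subn1; case: dn => [dn|dn]; [left|right]; apply/eqP; rewrite chinese_remainder //.
  by rewrite !mod0n -!/(dvdn _ _) dn dn1.
(* So (n - 1)^2 is the class that is 1 modulo n and 0 modulo n - 1. *)
have e : (n.-1 ^ 2 = n * (n - 2) + 1)%N by nia.
apply/andP; split; last by rewrite expnS modnMr; exact: dn1.
by rewrite e [(n * _)%N]mulnC modnMDl dn.
Qed.
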